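(* Let $\beta\in\mathbb{R}^n$ and let $c:\mathbb{R}^n\to(0,\infty)$ be a locally bounded measurable function such that $\lim_{|h|\to\infty}c(t+h)/c(h)=e^{\beta\cdot t}$ uniformly for $t$ in compact subsets of $\mathbb{R}^n$. Let $f\in\mathcal{K}_{1}'(\mathbb{R}^{n})$ and $\psi \in \mathcal{K}_{1}(\mathbb{R}^{n} )\setminus\{0\}$. If $f$ has the S-asymptotic behavior $f(t+h)\sim c(h)g(t)$ in $\mathcal{K}_1'(\mathbb{R}^n)$ as $|h|\to\infty$, then, for every $\lambda\geq0$, $$\lim_{|h|\to\infty}e^{2 \pi i z\cdot h}\frac{V_{\psi} f(x+h,z)}{c(h)}= V_\psi g(x,z),$$ uniformly for $z\in\Pi_{\lambda}$ and $x$ in compact subsets of $\mathbb{R}^{n}$. Conversely, suppose that the limits $$\lim_{|x|\to \infty }e^{2\pi i \xi\cdot x}\frac{V_{\psi}f(x,\xi)}{c(x)}=J(\xi)\in\mathbb{C}$$ exist for almost every $\xi\in\mathbb{R}^{n}$. If there is $s\in\mathbb{R}$ such that $$\sup_{(x,\xi)\in\mathbb{R}^{2n}}(1+|\xi|)^{-s}\frac{|V_\psi f(x,\xi)|}{c(x)}<\infty,$$ then $f$ has the S-asymptotic behavior $f(t+h)\sim c(h)g(t)$ in $\mathcal{K}_1'(\mathbb{R}^n)$ as $|h|\to\infty$ with $g(t)=C e^{\beta \cdot t}$, where the constant $C$ is completely determined by the equation $J(\xi)=C\, \overline{\widehat{\psi}(-\xi+i\beta/(2\pi))}$.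
   Context: $\mathcal{K}_1(\mathbb{R}^n)$ is the Fréchet space of all $\varphi\in C^\infty(\mathbb{R}^n)$ with $\sup_{t\in\mathbb{R}^n,|\alpha|\le k}e^{k|t|}|\varphi^{(\alpha)}(t)|<\infty$ for all $k\in\mathbb{N}_0$; $\mathcal{K}'_1(\mathbb{R}^n)$ is its dual with the strong topology. $\Pi_\lambda=\mathbb{R}^n+i[-\lambda,\lambda]^n\subset\mathbb{C}^n$. For $f\in\mathcal{K}'_1(\mathbb{R}^n)$ and $\psi\in\mathcal{K}_1(\mathbb{R}^n)$, $V_\psi f(x,z)=\langle f(t),e^{-2\pi iz\cdot t}\overline{\psi(t-x)}\rangle_t$, $x\in\mathbb{R}^n$, $z\in\mathbb{C}^n$. $\widehat\psi(z)=\int_{\mathbb{R}^n}e^{-2\pi i z\cdot t}\psi(t)\,dt$, an entire function for $\psi\in\mathcal{K}_1(\mathbb{R}^n)$. With $T_{-h}f=f(\cdot+h)$, the notation $f(t+h)\sim c(h)g(t)$ in $\mathcal{K}_1'(\mathbb{R}^n)$ as $|h|\to\infty$ means $\lim_{|h|\to\infty}T_{-h}f/c(h)=g$ in $\mathcal{K}'_1(\mathbb{R}^n)$, i.e. $\langle T_{-h}f,\varphi\rangle/c(h)\to\langle g,\varphi\rangle$ for each $\varphi\in\mathcal{K}_1(\mathbb{R}^n)$.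
   Formalization: In the direct part, convergence is uniform for z in compact subsets of Π_λ (and x in compact sets), not over all of Π_λ: uniformity on the whole tube fails, e.g. for n=1, β=0, c=1, f=δ', g=0, ψ(t)=exp(-t²), where the transform is unbounded in Re z. *)

(* Defs.v *)
From HB Require Import structures.
From mathcomp Require Import all_boot all_order all_algebra.
From mathcomp Require Import complex.
From mathcomp Require Import all_classical all_reals all_analysis.

Set Implicit Arguments.
Unset Strict Implicit.
Unset Printing Implicit Defensive.

Import Order.TTheory GRing.Theory Num.Theory.
Import ComplexField.Normc.
Import numFieldNormedType.Exports.

Local Open Scope classical_set_scope.
Local Open Scope ring_scope.
Local Open Scope complex_scope.

(** * Topology of the complex numbers *)

Set Warnings "-redundant-canonical-projection".
HB.instance Definition _ (R : rcfType) := NormedModule.copy R[i] R[i]^o.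

(** * Euclidean space *)

Section euclidean.
Context {R : realType} {n : nat}.

(** The library norm on ['rV_n] is the max norm. *)
Definition enorm (x : 'rV[R]_n) : R := Num.sqrt (\sum_i x 0 i ^+ 2).

Definition dotv {K : pzRingType} (u v : 'rV[K]_n) : K :=
  \sum_i u 0 i * v 0 i.

Definition cvec (x : 'rV[R]_n) : 'rV[R[i]]_n := map_mx (real_complex R) x.

(** The filter [|h| -> oo]. *)
Definition at_infty : set_system 'rV[R]_n :=
  [set A | exists M : R, forall h, M < enorm h -> A h].

Global Instance at_infty_filter : Filter at_infty.
Proof.
split; first by exists 0.
- move=> A B [M MA] [N NB]; exists (Num.max M N) => h.
  by rewrite gt_max => /andP[Mh Nh]; split; [exact: MA|exact: NB].
- by move=> A B AB [M MA]; exists M => h /MA /AB.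
Qed.

End euclidean.

(** * Borel sets and Lebesgue measure on ['rV[R]_n] *)

Section measurable_rV.
Context {R : realType} (n : nat).

Let coord (i : 'I_n) (v : 'rV[R]_n) : R := v 0 i.

Let rV_set0 : g_sigma_preimage coord set0.
Proof. exact: sigma_algebra0. Qed.

Let rV_setC A : g_sigma_preimage coord A -> g_sigma_preimage coord (~` A).
Proof. exact: sigma_algebraC. Qed.

Let rV_bigcup (F : _^nat) : (forall i, g_sigma_preimage coord (F i)) ->
  g_sigma_preimage coord (\bigcup_i (F i)).
Proof. exact: sigma_algebra_bigcup. Qed.

HB.instance Definition _ := @isMeasurable.Build default_measure_display
  'rV[R]_n (g_sigma_preimage coord) rV_set0 rV_setC rV_bigcup.

Lemma measurable_coord (i : 'I_n) :
  measurable_fun [set: 'rV[R]_n] (fun v : 'rV[R]_n => v 0 i).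
Proof.
move=> _ Y mY; rewrite setTI; apply: sub_sigma_algebra => /=.
rewrite -bigcup_seq/=; exists i => /=; first by rewrite mem_index_enum.
by exists Y => //; rewrite setTI.
Qed.

Lemma measurable_fun_rV d (T : measurableType d) (f : T -> 'rV[R]_n) :
  (forall i, measurable_fun [set: T] (fun x => f x 0 i)) ->
  measurable_fun [set: T] f.
Proof.
move=> mf; apply: (@measurability _ _ _ _ _ _
  (\big[setU/set0]_(i < n) preimage_set_system setT (coord i) measurable)) => //.
move=> _ [B + <-]; rewrite -bigcup_seq/= => -[i _ [A mA <-]].
by rewrite !setTI -comp_preimage -[X in measurable X]setTI; exact: mf.
Qed.

End measurable_rV.

Section rV_cons.
Context {R : realType} (n : nat).

Definition rV_cons (p : measurableTypeR R * 'rV[R]_n) : 'rV[R]_n.+1 :=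
  \row_i oapp (p.2 0) p.1 (unlift ord0 i).

Definition rV_uncons (v : 'rV[R]_n.+1) : measurableTypeR R * 'rV[R]_n :=
  (v 0 ord0, \row_i v 0 (lift ord0 i)).

Lemma rV_consK : cancel rV_cons rV_uncons.
Proof.
case=> a v; rewrite /rV_uncons mxE unlift_none/=; congr pair.
by apply/rowP => i; rewrite !mxE liftK.
Qed.

Lemma rV_unconsK : cancel rV_uncons rV_cons.
Proof.
by move=> v; apply/rowP => i; rewrite mxE; case: unliftP => [j ->|->]//=; rewrite mxE.
Qed.

Lemma measurable_rV_cons : measurable_fun [set: _] rV_cons.
Proof.
apply: measurable_fun_rV => i; case: (unliftP ord0 i) => [j|] ->{i}.
- rewrite (_ : (fun _ => _) = (fun v : 'rV[R]_n => v 0 j) \o snd).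
    exact: measurableT_comp (measurable_coord j) measurable_snd.
  by apply/funext => p; rewrite mxE liftK.
- rewrite (_ : (fun _ => _) = fst); first exact: measurable_fst.
  by apply/funext => p; rewrite mxE unlift_none.
Qed.

Lemma measurable_rV_uncons : measurable_fun [set: _] rV_uncons.
Proof.
apply/measurable_fun_pairP; split; first exact: measurable_coord.
apply: measurable_fun_rV => i.
rewrite (_ : (fun _ => _) = (fun v : 'rV[R]_n.+1 => v 0 (lift ord0 i))).
  exact: measurable_coord.
by apply/funext => v; rewrite /= mxE.
Qed.

Variable m : {sigma_finite_measure set 'rV[R]_n -> \bar R}.

Definition lebesgue_rVS : set 'rV[R]_n.+1 -> \bar R :=
  pushforward (@lebesgue_measure R \x m)%E rV_cons.

Let lebesgue_rVS0 : lebesgue_rVS set0 = 0%E.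
Proof. by rewrite /lebesgue_rVS /pushforward preimage_set0 measure0. Qed.

Let lebesgue_rVS_ge0 A : (0 <= lebesgue_rVS A)%E.
Proof. by rewrite /lebesgue_rVS /pushforward; apply: measure_ge0. Qed.

Let lebesgue_rVS_sigma_additive : semi_sigma_additive lebesgue_rVS.
Proof.
move=> F mF tF mUF; rewrite /lebesgue_rVS /pushforward preimage_bigcup.
apply: measure_semi_sigma_additive.
- by move=> k; rewrite -[X in measurable X]setTI; exact: measurable_rV_cons.
- apply/trivIsetP => /= i j _ _ ij; rewrite -preimage_setI.
  by move/trivIsetP : tF => /(_ _ _ _ _ ij) ->//; rewrite preimage_set0.
- by rewrite -preimage_bigcup -[X in measurable X]setTI;
    exact: measurable_rV_cons.
Qed.

HB.instance Definition _ := isMeasure.Build _ _ _ lebesgue_rVS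
  lebesgue_rVS0 lebesgue_rVS_ge0 lebesgue_rVS_sigma_additive.

Let lebesgue_rVS_sigma_finite : sigma_finite setT lebesgue_rVS.
Proof.
have /sigma_finiteP[F [TF ndF Foo]] := sigma_finiteT (@lebesgue_measure R).
have /sigma_finiteP[G [TG ndG Goo]] := sigma_finiteT m.
exists (fun k => rV_uncons @^-1` (F k `*` G k)).
  rewrite -preimage_bigcup; apply/esym; rewrite -subTset => v _.
  have [i _ Fi] : (\bigcup_i F i) (rV_uncons v).1 by rewrite -TF.
  have [j _ Gj] : (\bigcup_j G j) (rV_uncons v).2 by rewrite -TG.
  exists (maxn i j) => //; split=> /=.
    by move: Fi; exact/subsetPset/ndF/leq_maxl.
  by move: Gj; exact/subsetPset/ndG/leq_maxr.
move=> k; have [mFk Fkoo] := Foo k; have [mGk Gkoo] := Goo k; split.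
  rewrite -[X in measurable X]setTI; apply: measurable_rV_uncons => //.
  exact: measurableX.
rewrite /lebesgue_rVS /pushforward -comp_preimage.
rewrite (_ : _ \o _ = id) ?preimage_id; last first.
  by apply/funext => p; exact: rV_consK.
by rewrite product_measure1E// lte_mul_pinfty// ge0_fin_numE.
Qed.

HB.instance Definition _ := Measure_isSigmaFinite.Build _ _ _ lebesgue_rVS
  lebesgue_rVS_sigma_finite.

End rV_cons.

Section lebesgue_rV.
Context {R : realType}.

Definition lebesgue_rV0 : set 'rV[R]_0 -> \bar R := \d_(0 : 'rV[R]_0).

HB.instance Definition _ := Measure.on lebesgue_rV0.

Let lebesgue_rV0_sigma_finite : sigma_finite setT lebesgue_rV0.
Proof.
exists (fun=> setT); first by rewrite bigcup_const.
by move=> _; split=> //; rewrite /lebesgue_rV0 diracT ltry.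
Qed.

HB.instance Definition _ := Measure_isSigmaFinite.Build _ _ _ lebesgue_rV0
  lebesgue_rV0_sigma_finite.

(** Lebesgue measure on R^n as the n-fold product of [lebesgue_measure]. *)
Fixpoint lebesgue_rV n : {sigma_finite_measure set 'rV[R]_n -> \bar R} :=
  if n is m.+1 then lebesgue_rVS (lebesgue_rV m) else lebesgue_rV0.

End lebesgue_rV.

Section complex_functions.
Context {R : realType} {n : nat}.

Definition cexp (z : R[i]) : R[i] :=
  (expR (complex.Re z))%:C * (cos (complex.Im z) +i* sin (complex.Im z)).

Definition cintegral (F : 'rV[R]_n -> R[i]) : R[i] :=
  (\int[lebesgue_rV n]_t complex.Re (F t))%R +i*
  (\int[lebesgue_rV n]_t complex.Im (F t))%R.

(** Measurability with respect to the Lebesgue (completed Borel) sets. *)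
Definition lebesgue_measurable_fun (c : 'rV[R]_n -> R) : Prop :=
  forall B : set R, measurable B ->
    measurable_realfun.completed_algebra_gen (lebesgue_rV n) (c @^-1` B).

End complex_functions.

(** * The space K_1 and its dual *)

Section K1.
Context {R : realType} {n : nat}.

(** Iterated partial derivative along the word [s]; the multi-index alpha
    corresponds to the words in which each [i] occurs [alpha i] times, all of
    which give the same derivative when the function is smooth. *)
Definition pderiv (s : seq 'I_n) (u : 'rV[R]_n -> R) : 'rV[R]_n -> R :=
  foldr (fun i v x => 'D_(delta_mx 0 i) v x) u s.

Definition cpderiv (s : seq 'I_n) (phi : 'rV[R]_n -> R[i]) (t : 'rV[R]_n) :
    R[i] :=
  pderiv s (fun x => complex.Re (phi x)) t +i*
  pderiv s (fun x => complex.Im (phi x)) t.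

Definition smooth (phi : 'rV[R]_n -> R[i]) : Prop :=
  forall (s : seq 'I_n) (t : 'rV[R]_n),
    differentiable (pderiv s (fun x => complex.Re (phi x))) t /\
    differentiable (pderiv s (fun x => complex.Im (phi x))) t.

Definition K1_seminorm (k : nat) (phi : 'rV[R]_n -> R[i]) : \bar R :=
  ereal_sup [set y | exists (s : seq 'I_n) (t : 'rV[R]_n), (size s <= k)%N /\
    y = (expR (k%:R * enorm t) * normc (cpderiv s phi t))%:E].

Definition K1 (phi : 'rV[R]_n -> R[i]) : Prop :=
  smooth phi /\ forall k, (K1_seminorm k phi < +oo)%E.

(** A functional on K_1 is given by a functional on all functions, of which
    only the values on K_1 are relevant. *)
Definition functional := ('rV[R]_n -> R[i]) -> R[i].

(** Linearity, and continuity for the Frechet topology: the sets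
    [{chi | K1_seminorm k (chi - phi) < delta}] are a basis of neighborhoods
    of [phi], the seminorms being nondecreasing in [k]. *)
Definition K1_dual (f : functional) : Prop :=
  (forall (a : R[i]) phi chi, K1 phi -> K1 chi ->
     f (fun t => a * phi t + chi t) = a * f phi + f chi) /\
  (forall phi, K1 phi -> forall eps : R, 0 < eps ->
     exists (k : nat) (delta : R), 0 < delta /\
       forall chi, K1 chi ->
         (K1_seminorm k (fun t => (chi t - phi t)%R) < delta%:E)%E ->
         normc (f chi - f phi) < eps).

(** [translate h f] is [f(. + h)]. *)
Definition translate (h : 'rV[R]_n) (f : functional) : functional :=
  fun phi => f (fun t => phi (t - h)).

(** The functional given by integration against the function [G]. *)
Definition regular (G : 'rV[R]_n -> R[i]) : functional :=
  fun phi => cintegral (fun t => G t * phi t).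

(** [f(t + h) ~ c(h) g(t)] in K_1' as [|h| -> oo]. *)
Definition S_asymptotic (f : functional) (c : 'rV[R]_n -> R) (g : functional) :
    Prop :=
  forall phi, K1 phi ->
    (fun h => translate h f phi / (c h)%:C) @ at_infty --> g phi.

End K1.

Arguments functional : clear implicits.

(** * Short-time Fourier transform *)

Section stft.
Context {R : realType} {n : nat}.

Definition two_pi_i : R[i] := (2 * pi)%:C * 'i%C.

Definition STFT (psi : 'rV[R]_n -> R[i]) (f : functional R n)
    (x : 'rV[R]_n) (z : 'rV[R[i]]_n) : R[i] :=
  f (fun t => cexp (- (two_pi_i * dotv z (cvec t))) * ((psi (t - x))^*)%C).

Definition fourier (psi : 'rV[R]_n -> R[i]) (z : 'rV[R[i]]_n) : R[i] :=
  cintegral (fun t => cexp (- (two_pi_i * dotv z (cvec t))) * psi t).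

(** The tube R^n + i[-lambda, lambda]^n. *)
Definition tube (lambda : R) : set 'rV[R[i]]_n :=
  [set z | forall i, `|complex.Im (z 0 i)| <= lambda].

End stft.

(* Main.v *)
Require Import Defs.
From HB Require Import structures.
From mathcomp Require Import all_boot all_order all_algebra.
From mathcomp Require Import complex.
From mathcomp Require Import all_classical all_reals all_analysis.
From mathcomp Require Import measurable_realfun.
From mathcomp Require Import ring lra zify.

Set Implicit Arguments.
Unset Strict Implicit.
Unset Printing Implicit Defensive.

Import Order.TTheory GRing.Theory Num.Theory.
Import ComplexField.Normc.
Import numFieldNormedType.Exports.

Local Open Scope classical_set_scope.
Local Open Scope ring_scope.
Local Open Scope complex_scope.

(** Write [eta] for the conjugate of the window [psi], and [<f, u>] for the value
    of a functional. The short-time Fourier transform at [(x, z)] is, up to a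
    unimodular factor for real [z], the value of [f (. + x)] on the window [eta]
    modulated by [z] ([STFT_translate]).

    Abelian half. The functionals [T_h = f (. + h) / c h - g] converge to zero on
    every test function. K_1 is a Frechet space, so by uniform boundedness they
    are small, for all large [h] at once, on a neighborhood of the origin
    ([uniform_boundedness], proved by a gliding hump). The modulated and
    translated windows depend continuously on their parameters, hence
    compactness makes the convergence uniform ([STFT_uniform_limit]).

    Tauberian half. Three representations lead from the modulated windows
    [wave xi * eta] to all test functions. By Fourier inversion ([ift_inversion])
    a product [eta * a] is a superposition of them, with a rapidly decreasing
    density, so that polynomial growth and pointwise convergence in [xi] give a
    bound and a limit on these products ([windowed_bound], [windowed_limit]).
    With [zeta = |eta|^2], a test function [phi] is, up to the mass of [zeta], the
    integral over [x] of [zeta (. - x) * phi], and such a piece is the translate by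
    [x] of a product [eta * a]; replacing [f (. + h)] by [f (. + h + x)] costs the
    quotient [c (h + x) / c h], which converges to [expR (dotv beta x)] and is at
    most exponential in [x] once [c] is modified near the origin
    ([slow_majorant]). Dominated convergence gives a limit [L phi]
    ([rescaled_limit]). For the same reason
    [L (phi (. - x)) = expR (dotv beta x) * L phi], and the commutativity of
    convolution shows that such an [L] is an exponential ([exponential_limit]).
    The value of [L] on the modulated windows is the equation for the constant,
    which the nonvanishing of the transform of the window makes unique
    ([exponential_constant_unique]).

    The exchange of a functional with an integral of test functions rests on one
    lemma ([functional_pettis]): if a family is approximated by finite sums of
    products, with an error dominated by an integrable weight, then
    differentiation, functionals and the integral commute. For the counting
    measure it yields the series of the gliding hump, for Lebesgue measure the
    three representations above; applied to the integral itself as a functional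
    it takes the place of the theorem of Fubini. Fourier inversion is proved with
    an unspecified constant other than zero: [ift_exchange] compares two
    functions at the origin through a dilation that shrinks to a point. *)

(** * Complex numbers *)

Section complex_basics.
Context {R : realType}.
Implicit Types z w : R[i].

Lemma normc_ge0 z : 0 <= normc z.
Proof. by case: z => a b /=; exact: sqrtr_ge0. Qed.

Lemma normc_real (x : R) : normc x%:C = `|x|.
Proof. by rewrite /= expr0n/= addr0 sqrtr_sqr. Qed.

Lemma normc_conj z : normc z^* = normc z.
Proof. by case: z => a b /=; rewrite sqrrN. Qed.

Lemma cReD z w : complex.Re (z + w) = complex.Re z + complex.Re w.
Proof. by case: z w => [a b] [c d]. Qed.

Lemma cImD z w : complex.Im (z + w) = complex.Im z + complex.Im w.
Proof. by case: z w => [a b] [c d]. Qed.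

Lemma cReM z w : complex.Re (z * w) =
  complex.Re z * complex.Re w - complex.Im z * complex.Im w.
Proof. by case: z w => [a b] [c d]. Qed.

Lemma cImM z w : complex.Im (z * w) =
  complex.Re z * complex.Im w + complex.Im z * complex.Re w.
Proof. by case: z w => [a b] [c d]. Qed.

Lemma cReB z w : complex.Re (z - w) = complex.Re z - complex.Re w.
Proof. by case: z w => [a b] [c d]. Qed.

Lemma cImB z w : complex.Im (z - w) = complex.Im z - complex.Im w.
Proof. by case: z w => [a b] [c d]. Qed.

Lemma complexP z w : complex.Re z = complex.Re w ->
  complex.Im z = complex.Im w -> z = w.
Proof. by case: z w => [a b] [c d] /= -> ->. Qed.

Lemma Re_le_normc z : `|complex.Re z| <= normc z.
Proof.
case: z => a b /=; rewrite -sqrtr_sqr ler_sqrt ?addr_ge0 ?sqr_ge0//.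
by rewrite lerDl sqr_ge0.
Qed.

Lemma Im_le_normc z : `|complex.Im z| <= normc z.
Proof.
case: z => a b /=; rewrite -sqrtr_sqr ler_sqrt ?addr_ge0 ?sqr_ge0//.
by rewrite lerDr sqr_ge0.
Qed.

Lemma normc_le_ReIm z : normc z <= `|complex.Re z| + `|complex.Im z|.
Proof.
case: z => a b /=; rewrite -[leRHS]ger0_norm ?addr_ge0// -sqrtr_sqr.
rewrite ler_sqrt ?sqr_ge0// sqrrD !real_normK ?num_real//.
by rewrite -addrA lerD2l lerDr mulrn_wge0 ?mulr_ge0.
Qed.

Lemma normcBC z w : normc (z - w) = normc (w - z).
Proof. by rewrite -normcN opprB. Qed.

Lemma normc_le_sub z w : normc z <= normc w + normc (z - w).
Proof. by have := le_normcD w (z - w); rewrite addrC subrK. Qed.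

Lemma cRe_sum I (r : seq I) (P : pred I) (F : I -> R[i]) :
  complex.Re (\sum_(i <- r | P i) F i) = \sum_(i <- r | P i) complex.Re (F i).
Proof. by elim/big_rec2 : _ => // i y1 y2 _ H; rewrite cReD H. Qed.

Lemma cIm_sum I (r : seq I) (P : pred I) (F : I -> R[i]) :
  complex.Im (\sum_(i <- r | P i) F i) = \sum_(i <- r | P i) complex.Im (F i).
Proof. by elim/big_rec2 : _ => // i y1 y2 _ H; rewrite cImD H. Qed.

Lemma normc_gt0 z : (0 < normc z) = (z != 0).
Proof.
rewrite lt_def normc_ge0 andbT; congr (~~ _); apply/eqP/eqP => [|->].
  exact: eq0_normc.
exact: normc0.
Qed.

Lemma cexpD z w : cexp (z + w) = cexp z * cexp w.
Proof.
case: z w => [a b] [c d]; rewrite /cexp/= expRD cosD sinD.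
by apply: complexP; rewrite /= ?(mul0r,mulr0,subr0,addr0,add0r); ring.
Qed.

Lemma cexp0 : cexp (0 : R[i]) = 1.
Proof. by rewrite /cexp/= expR0 cos0 sin0 mul1r. Qed.

Lemma normc_cexp z : normc (cexp z) = expR (complex.Re z).
Proof.
rewrite /cexp normcM normc_real ger0_norm ?expR_ge0//=.
by rewrite cos2Dsin2 sqrtr1 mulr1.
Qed.

Lemma cexp_conj z : (cexp z)^* = cexp z^*.
Proof.
by case: z => a b; rewrite /cexp/= cosN sinN; apply: complexP => /=; ring.
Qed.

Lemma cexp_real (x : R) : cexp x%:C = (expR x)%:C.
Proof. by rewrite /cexp/= cos0 sin0 mulr1. Qed.

End complex_basics.

Section complex_limits.
Context {R : realType} {T : Type} (F : set_system T) {FF : Filter F}.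

Lemma cvgc_normcP (u : T -> R[i]) (l : R[i]) :
  u @ F --> l <-> forall e : R, 0 < e -> \forall x \near F, normc (u x - l) < e.
Proof.
split.
  move=> /cvgrPdist_lt h e e0.
  have e0' : 0 < e%:C by rewrite ltcR.
  apply: filterS (h _ e0') => x /=.
  by rewrite ltcE => /andP[_ hx]; rewrite normcBC; case: (l - u x) hx.
move=> h; apply/cvgrPdist_lt => -[a b] /[dup]; rewrite ltcE/= => /andP[/eqP b0 a0].
rewrite -b0 => _; apply: filterS (h _ a0) => x.
by rewrite normcBC ltcE; case: (l - u x) => c d /= ->; rewrite b0 eqxx.
Qed.

End complex_limits.

Definition re (R : realType) (T : Type) (u : T -> R[i]) t := complex.Re (u t).
Definition im (R : realType) (T : Type) (u : T -> R[i]) t := complex.Im (u t).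

(** * Taylor estimates for real functions of several variables *)

Section row_norm.
Context {R : realType} {n : nat}.
Implicit Types t v : 'rV[R]_n.

Lemma coord_le_norm v i : `|v 0 i| <= `|v|.
Proof.
rewrite /Num.norm/= mx_normrE.
exact: (@le_bigmax _ _ _ _ (fun p : 'I_1 * 'I_n => `|v p.1 p.2|) (0, i)).
Qed.

Lemma norm_le_coord v (M : R) : 0 <= M ->
  (forall i, `|v 0 i| <= M) -> `|v| <= M.
Proof.
move=> M0 vM; rewrite /Num.norm/= mx_normrE; apply: bigmax_le => // -[i j] _ /=.
by rewrite (ord1 i).
Qed.

Lemma dotv_le t v : `|dotv t v| <= n%:R * (`|t| * `|v|).
Proof.
rewrite /dotv (le_trans (ler_norm_sum _ _ _))//.
rewrite (@le_trans _ _ (\sum_(i < n) `|t| * `|v|))//.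
  by apply: ler_sum => i _; rewrite normrM ler_pM ?coord_le_norm.
by rewrite sumr_const card_ord mulr_natl.
Qed.

Lemma dotvDr (K : pzRingType) (a b c : 'rV[K]_n) : dotv a (b + c) = dotv a b + dotv a c.
Proof. by rewrite -big_split; apply: eq_bigr => i _; rewrite mxE mulrDr. Qed.

Lemma dotvDl (K : pzRingType) (a b c : 'rV[K]_n) : dotv (a + b) c = dotv a c + dotv b c.
Proof. by rewrite -big_split; apply: eq_bigr => i _; rewrite mxE mulrDl. Qed.

Lemma dotvNr (K : pzRingType) (a b : 'rV[K]_n) : dotv a (- b) = - dotv a b.
Proof. by rewrite -sumrN; apply: eq_bigr => i _; rewrite mxE mulrN. Qed.

Lemma dotvNl (K : pzRingType) (a b : 'rV[K]_n) : dotv (- a) b = - dotv a b.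
Proof. by rewrite -sumrN; apply: eq_bigr => i _; rewrite mxE mulNr. Qed.

Lemma dotv0r (K : pzRingType) (a : 'rV[K]_n) : dotv a 0 = 0.
Proof. by rewrite /dotv big1// => i _; rewrite mxE mulr0. Qed.

Lemma dotvC (K : comPzRingType) (a b : 'rV[K]_n) : dotv a b = dotv b a.
Proof. by apply: eq_bigr => i _; rewrite mulrC. Qed.

Lemma dotvZl (K : pzRingType) (k : K) (a b : 'rV[K]_n) : dotv (k *: a) b = k * dotv a b.
Proof. by rewrite mulr_sumr; apply: eq_bigr => i _; rewrite mxE mulrA. Qed.

Lemma dotvZr (K : comPzRingType) (k : K) (a b : 'rV[K]_n) : dotv a (k *: b) = k * dotv a b.
Proof. by rewrite dotvC dotvZl dotvC. Qed.

End row_norm.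

Lemma diff_remainder (K : realFieldType) (V W : normedModType K) (f : V -> W)
    (df : {linear V -> W}) (x : V) : continuous df ->
  (forall e : K, 0 < e ->
     \forall v \near 0, `|f (v + x) - f x - df v| <= e * `|v|) ->
  differentiable f x /\ 'd f x = df :> (V -> W).
Proof.
move=> dfc H.
have ex : f \o shift x = cst (f x) + df +o_ 0 id.
  apply/eqaddoP => _/posnumP[e]; apply: filterS (H e%:num _) => // v.
  by rewrite opprD addrA.
have du := diff_unique dfc ex.
split=> //; apply/diff_locallyP; rewrite du; split=> //.
Qed.

Lemma differentiable_shift (K : realFieldType) (V W : normedModType K)
    (f : V -> W) (x t : V) : differentiable f (t + x) ->
  differentiable (fun t => f (t + x)) t.
Proof.
move=> df; have := diff_locally df; have dfc := diff_continuous df.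
have -> : f \o shift (t + x) = (fun t => f (t + x)) \o shift t.
  by apply/funext => v /=; rewrite addrA.
rewrite [X in cst X](_ : _ = (fun t => f (t + x)) t)// => ex.
have du := diff_unique dfc ex.
by apply/diff_locallyP; rewrite du.
Qed.

Section real_calculus.
Context {R : realType} {n : nat}.
Implicit Types (t v a : 'rV[R]_n) (u : 'rV[R]_n -> R).

Local Notation "'e_ i" := (delta_mx 0 i : 'rV[R]_n) (at level 8, i at level 2).

Definition linform a v : R := dotv v a.

Lemma linform_is_linear a : linear (linform a).
Proof. by move=> k x y; rewrite /linform dotvDl dotvZl. Qed.

HB.instance Definition _ a := GRing.isLinear.Build R 'rV[R]_n R _ (linform a)
  (linform_is_linear a).

Lemma linform_continuous a : continuous (linform a).
Proof.
rewrite /linform /dotv; apply: continuous_big => [|i _ x].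
  exact: add_continuous.
apply: (@cvgMr_tmp _ _ _ _ (fun x : 'rV[R]_n => x 0 i) (x 0 i)).
  exact: nbhs_filter.
exact: (@coord_continuous R 1 n 0 i x).
Qed.

Lemma linform_delta a i : linform a 'e_i = a 0 i.
Proof.
rewrite /linform /dotv (bigD1 i)//= mxE !eqxx mul1r big1 ?addr0// => j ji.
by rewrite mxE (negbTE ji) mul0r.
Qed.

Lemma diff_partials u t v : differentiable u t ->
  'd u t v = \sum_i v 0 i * 'D_('e_i) u t.
Proof.
move=> du; rewrite {1}(row_sum_delta v) linear_sum; apply: eq_bigr => i _.
by rewrite linearZ deriveE.
Qed.

(** Quadratic remainders survive integration with respect to a parameter, so
    this criterion gives differentiability under the integral sign. *)
Lemma quadratic_remainder_diff u t a (C : R) :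
  (forall v, `|v| <= 1 -> `|u (t + v) - u t - dotv v a| <= C * `|v| ^+ 2) ->
  differentiable u t /\ forall i, 'D_('e_i) u t = a 0 i.
Proof.
move=> H.
have [|df du] := @diff_remainder R 'rV[R]_n R u (linform a) t (@linform_continuous a).
  move=> e e0; apply/(@nbhs_norm0P R 'rV[R]_n).
  exists (Num.min 1 (e / (`|C| + 1))) => /=.
    by rewrite lt_min ltr01 divr_gt0// ltr_wpDl.
  move=> v; rewrite /= lt_min => /andP[/ltW v1].
  rewrite ltr_pdivlMr ?ltr_wpDl// => /ltW ve.
  have := H v v1; rewrite (addrC t) => /le_trans; apply.
  rewrite [leLHS](_ : _ = (C * `|v|) * `|v|); last by rewrite -mulrA.
  rewrite ler_wpM2r//.
  rewrite (@le_trans _ _ ((`|C| + 1) * `|v|))// ?ler_wpM2r//.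
    by rewrite (le_trans (ler_norm _))// lerDl.
  by rewrite mulrC.
by split=> // i; rewrite deriveE// du; exact: linform_delta.
Qed.

Lemma mean_value u t v : (forall x, differentiable u x) ->
  exists2 s : R, 0 <= s <= 1 &
    u (t + v) - u t = \sum_i v 0 i * 'D_('e_i) u (t + s *: v).
Proof.
move=> du.
pose g (s : R) := u (t + s *: v).
have dg (s : R) : is_derive s 1 g (\sum_i v 0 i * 'D_('e_i) u (t + s *: v)).
  have E : (fun h : R => h^-1 *: ((g \o shift s) (h *: (1 : R)) - g s)) =
      (fun h : R => h^-1 *: ((u \o shift (t + s *: v)) (h *: v) - u (t + s *: v))).
    apply/funext => h /=; rewrite /g [h *: 1]mulr1 scalerDl.
    by rewrite addrCA.
  apply: DeriveDef; first by rewrite /derivable E; exact/diff_derivable.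
  by rewrite /derive E -diff_partials// -deriveE.
have gc : {within `[0, 1], continuous g}.
  by apply: derivable_within_continuous => s _; have [] := dg s.
have [s s01] := @MVT_segment R g _ 0 1 ler01 (fun s _ => dg s) gc.
rewrite subr0 mulr1 {1 2}/g scale1r scale0r addr0 => h.
by exists s => //; move: s01; rewrite in_itv.
Qed.

Lemma mean_value_bound u t v (B : R) : (forall x, differentiable u x) ->
  (forall (s : R) i, 0 <= s <= 1 -> `|'D_('e_i) u (t + s *: v)| <= B) ->
  `|u (t + v) - u t| <= n%:R * `|v| * B.
Proof.
move=> du uB; have [s s01 ->] := mean_value t v du.
rewrite (le_trans (ler_norm_sum _ _ _))//.
rewrite (@le_trans _ _ (\sum_(i < n) `|v| * B))//.
  by apply: ler_sum => i _; rewrite normrM ler_pM ?coord_le_norm ?uB.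
by rewrite sumr_const card_ord -mulrA mulr_natl.
Qed.

Lemma taylor2_bound u t v (B : R) : (forall x, differentiable u x) ->
  (forall i x, differentiable ('D_('e_i) u) x) ->
  (forall (s : R) i j, 0 <= s <= 1 ->
     `|'D_('e_j) ('D_('e_i) u) (t + s *: v)| <= B) ->
  `|u (t + v) - u t - \sum_i v 0 i * 'D_('e_i) u t| <=
     n%:R * `|v| * (n%:R * `|v| * B).
Proof.
move=> du d2u uB; have [s /andP[s0 s1] ->] := mean_value t v du.
rewrite -sumrB (le_trans (ler_norm_sum _ _ _))//.
rewrite (@le_trans _ _ (\sum_(i < n) `|v| * (n%:R * `|v| * B)))//.
  apply: ler_sum => i _; rewrite -mulrBr normrM ler_pM ?coord_le_norm//.
  have B0 : 0 <= B by apply: (le_trans _ (uB 0 i i _)); rewrite ?lexx ?ler01.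
  have d2i : forall x, differentiable ('D_('e_i) u) x by move=> x; exact: d2u.
  have di r j : 0 <= r <= 1 ->
      `|'D_('e_j) ('D_('e_i) u) (t + r *: (s *: v))| <= B.
    move=> /andP[r0 r1]; rewrite scalerA; apply: uB.
    by rewrite mulr_ge0//= mulr_ile1.
  have := mean_value_bound d2i di; move/le_trans; apply.
  rewrite ler_wpM2r// ler_wpM2l ?ler0n// normrZ ger0_norm//.
  by rewrite ler_piMl.
by rewrite sumr_const card_ord -[leLHS]mulr_natl [leLHS]mulrA.
Qed.

End real_calculus.

(** * Smooth complex functions and pointwise bounds on their derivatives *)

Section smooth.
Context {R : realType} {n : nat}.
Local Notation V := 'rV[R]_n.
Implicit Types (u v w : V -> R[i]) (t x : V) (s : seq 'I_n) (i : 'I_n) (k : nat).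

Local Notation "'e_ i" := (delta_mx 0 i : 'rV[R]_n) (at level 8, i at level 2).

Definition cdiff u := forall t, differentiable (re u) t /\ differentiable (im u) t.

Definition cD i u t : R[i] := 'D_('e_i) (re u) t +i* 'D_('e_i) (im u) t.

Lemma cpderiv_nil u : cpderiv [::] u = u.
Proof. by apply/funext => t; rewrite /cpderiv/=; case: (u t). Qed.

Lemma cpderiv_cons i s u : cpderiv (i :: s) u = cD i (cpderiv s u).
Proof. by []. Qed.

Lemma cpderiv_rcons i s u : cpderiv (rcons s i) u = cpderiv s (cD i u).
Proof. by apply/funext => t; rewrite /cpderiv /pderiv !foldr_rcons. Qed.

Lemma smoothP u : smooth u <-> forall s, cdiff (cpderiv s u).
Proof. by split => h s t; exact: (h s t). Qed.

Lemma smooth_cdiff u : smooth u -> cdiff u.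
Proof. by move=> /smoothP /(_ [::]); rewrite cpderiv_nil. Qed.

Lemma smooth_cD i u : smooth u -> smooth (cD i u).
Proof. by move=> /smoothP h; apply/smoothP => s; rewrite -cpderiv_rcons. Qed.

Lemma smooth_cpderiv s u : smooth u -> smooth (cpderiv s u).
Proof.
by elim: s => [|i s IH] h; rewrite ?cpderiv_nil ?cpderiv_cons//; exact/smooth_cD/IH.
Qed.

(** Coinduction principle: it makes the closure of smooth functions under sums,
    products, translations, conjugation, ... consequences of the first-order
    rules of calculus alone. *)
Lemma smooth_coind (P : (V -> R[i]) -> Prop) :
  (forall u, P u -> cdiff u /\ forall i, P (cD i u)) ->
  forall u, P u -> smooth u.
Proof.
move=> H u Pu; apply/smoothP => s; elim/last_ind: s u Pu => [|s i IH] u Pu.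
  by rewrite cpderiv_nil; exact: (H _ Pu).1.
by rewrite cpderiv_rcons; apply: IH; exact: (H _ Pu).2.
Qed.

Lemma cdiffD u v : cdiff u -> cdiff v -> cdiff (fun t => u t + v t).
Proof.
move=> du dv t; have [ur ui] := du t; have [vr vi] := dv t; split.
- rewrite (_ : re _ = re u + re v); first exact: differentiableD.
  by apply/funext => x; rewrite /re cReD.
- rewrite (_ : im _ = im u + im v); first exact: differentiableD.
  by apply/funext => x; rewrite /im cImD.
Qed.

Lemma cD_add i u v : cdiff u -> cdiff v ->
  cD i (fun t => u t + v t) = fun t => cD i u t + cD i v t.
Proof.
move=> du dv; apply/funext => t; have [ur ui] := du t; have [vr vi] := dv t.
rewrite /cD.
rewrite (_ : re _ = re u + re v); last by apply/funext => x; rewrite /re cReD.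
rewrite (_ : im _ = im u + im v); last by apply/funext => x; rewrite /im cImD.
by rewrite !deriveD//; exact: diff_derivable.
Qed.

Lemma re_mul u v : re (fun t => u t * v t) = re u * re v - im u * im v.
Proof. by apply/funext => t; rewrite /re cReM. Qed.

Lemma im_mul u v : im (fun t => u t * v t) = re u * im v + im u * re v.
Proof. by apply/funext => t; rewrite /im cImM. Qed.

Lemma cdiffM u v : cdiff u -> cdiff v -> cdiff (fun t => u t * v t).
Proof.
move=> du dv t; have [ur ui] := du t; have [vr vi] := dv t.
rewrite re_mul im_mul; split.
- by apply: differentiableB; exact: differentiableM.
- by apply: differentiableD; exact: differentiableM.
Qed.

Lemma cD_mul i u v : cdiff u -> cdiff v ->
  cD i (fun t => u t * v t) = fun t => cD i u t * v t + u t * cD i v t.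
Proof.
move=> du dv; apply/funext => t; have [ur ui] := du t; have [vr vi] := dv t.
have dur : derivable (re u) t 'e_i by exact: diff_derivable.
have dui : derivable (im u) t 'e_i by exact: diff_derivable.
have dvr : derivable (re v) t 'e_i by exact: diff_derivable.
have dvi : derivable (im v) t 'e_i by exact: diff_derivable.
have m1 : derivable (re u * re v) t 'e_i := derivableM dur dvr.
have m2 : derivable (im u * im v) t 'e_i := derivableM dui dvi.
have m3 : derivable (re u * im v) t 'e_i := derivableM dur dvi.
have m4 : derivable (im u * re v) t 'e_i := derivableM dui dvr.
rewrite {1}/cD re_mul im_mul (deriveB m1 m2) (deriveD m3 m4).
rewrite (deriveM dur dvr) (deriveM dui dvi) (deriveM dur dvi) (deriveM dui dvr).
have -> : u t = re u t +i* im u t by rewrite /re /im; case: (u t).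
have -> : v t = re v t +i* im v t by rewrite /re /im; case: (v t).
rewrite /cD.
move: ('D_('e_i) (re u) t) ('D_('e_i) (im u) t) ('D_('e_i) (re v) t) ('D_('e_i) (im v) t).
move: (re u t) (im u t) (re v t) (im v t) => a b c d p q r s.
by apply: complexP => /=; rewrite /GRing.scale /=; ring.
Qed.

Lemma cdiff_cst (c : R[i]) : cdiff (fun _ : V => c).
Proof.
by move=> t; split; [exact: (@differentiable_cst R V R (complex.Re c) t)|
  exact: (@differentiable_cst R V R (complex.Im c) t)].
Qed.

Lemma cD_cst i (c : R[i]) : cD i (fun=> c) = fun=> 0.
Proof.
apply/funext => t; apply: complexP.
  exact: (@derive_cst R V R (complex.Re c)).
exact: (@derive_cst R V R (complex.Im c)).
Qed.

Lemma cdiff_conj u : cdiff u -> cdiff (fun t => (u t)^*).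
Proof.
move=> du t; have [ur ui] := du t; split.
- by rewrite (_ : re _ = re u)//; apply/funext => x; rewrite /re; case: (u x).
- rewrite (_ : im _ = - im u); first exact: differentiableN.
  by apply/funext => x; rewrite /im /GRing.opp/=; case: (u x).
Qed.

Lemma cD_conj i u : cdiff u -> cD i (fun t => (u t)^*) = fun t => (cD i u t)^*.
Proof.
move=> du; apply/funext => t; have [ur ui] := du t; rewrite /cD.
rewrite (_ : re _ = re u); last by apply/funext => x; rewrite /re; case: (u x).
rewrite (_ : im _ = - im u).
  by rewrite deriveN//; exact: diff_derivable.
by apply/funext => x; rewrite /im /GRing.opp/=; case: (u x).
Qed.

Lemma cdiff_shift x u : cdiff u -> cdiff (fun t => u (t + x)).
Proof.
by move=> du t; have [ur ui] := du (t + x); split;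
  [exact: (@differentiable_shift R V R (re u))|exact: (@differentiable_shift R V R (im u))].
Qed.

Lemma cD_shift i x u : cD i (fun t => u (t + x)) = fun t => cD i u (t + x).
Proof.
have H (f : V -> R) t : 'D_('e_i) (fun t => f (t + x)) t = 'D_('e_i) f (t + x).
  by rewrite /derive /=; under eq_fun do rewrite -addrA.
by apply/funext => t; rewrite /cD; congr (_ +i* _); rewrite -H.
Qed.

Inductive smooth_alg : (V -> R[i]) -> Prop :=
| smooth_alg_base u : smooth u -> smooth_alg u
| smooth_alg_add u v : smooth_alg u -> smooth_alg v -> smooth_alg (fun t => u t + v t)
| smooth_alg_mul u v : smooth_alg u -> smooth_alg v -> smooth_alg (fun t => u t * v t).

Lemma smooth_algP u : smooth_alg u -> smooth u.
Proof.
apply: smooth_coind => {}u; elim => {u} [u su|u v _ [du Du] _ [dv Dv]|u v pu [du Du] pv [dv Dv]].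
- by split=> [|i]; [exact: smooth_cdiff|apply: smooth_alg_base; exact: smooth_cD].
- by split=> [|i]; [exact: cdiffD|rewrite cD_add//; exact: smooth_alg_add].
- split=> [|i]; [exact: cdiffM|rewrite cD_mul//].
  by apply: smooth_alg_add; exact: smooth_alg_mul.
Qed.

Lemma smoothD u v : smooth u -> smooth v -> smooth (fun t => u t + v t).
Proof. by move=> su sv; apply/smooth_algP/smooth_alg_add; exact: smooth_alg_base. Qed.

Lemma smoothM u v : smooth u -> smooth v -> smooth (fun t => u t * v t).
Proof. by move=> su sv; apply/smooth_algP/smooth_alg_mul; exact: smooth_alg_base. Qed.

Lemma smooth_cst (c : R[i]) : smooth (fun _ : V => c).
Proof.
apply: (@smooth_coind (fun u => exists c, u = fun _ : V => c)); last by exists c.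
move=> _ [{}c ->]; split=> [|i]; first exact: cdiff_cst.
by exists 0; exact: cD_cst.
Qed.

Lemma smoothZ (c : R[i]) u : smooth u -> smooth (fun t => c * u t).
Proof. by move=> su; apply: smoothM => //; exact: smooth_cst. Qed.

Lemma smooth_conj u : smooth u -> smooth (fun t => (u t)^*).
Proof.
move=> su; apply: (@smooth_coind (fun w => exists2 u, smooth u & w = fun t => (u t)^*)).
  move=> _ [{su}u su ->]; split=> [|i]; first exact/cdiff_conj/smooth_cdiff.
  by exists (cD i u); [exact: smooth_cD|rewrite cD_conj//; exact: smooth_cdiff].
by exists u.
Qed.

Lemma smooth_shift x u : smooth u -> smooth (fun t => u (t + x)).
Proof.
move=> su; apply: (@smooth_coind (fun w => exists2 u, smooth u & w = fun t => u (t + x))).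
  move=> _ [{su}u su ->]; split=> [|i]; first exact/cdiff_shift/smooth_cdiff.
  by exists (cD i u); [exact: smooth_cD|rewrite cD_shift].
by exists u.
Qed.

Lemma cpderivD s u v : smooth u -> smooth v ->
  cpderiv s (fun t => u t + v t) = fun t => cpderiv s u t + cpderiv s v t.
Proof.
elim/last_ind: s u v => [|s i IH] u v su sv; first by rewrite !cpderiv_nil.
by rewrite !cpderiv_rcons cD_add ?IH//; [exact: smooth_cD..|exact: smooth_cdiff|exact: smooth_cdiff].
Qed.

Lemma cD_scale i (c : R[i]) u : cdiff u -> cD i (fun t => c * u t) = fun t => c * cD i u t.
Proof.
move=> du; rewrite cD_mul//; last exact: cdiff_cst.
by apply/funext => t; rewrite cD_cst mul0r add0r.
Qed.

Lemma cpderivZ s (c : R[i]) u : smooth u ->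
  cpderiv s (fun t => c * u t) = fun t => c * cpderiv s u t.
Proof.
elim/last_ind: s u => [|s i IH] u su; first by rewrite !cpderiv_nil.
by rewrite !cpderiv_rcons cD_scale ?IH//; [exact: smooth_cD|exact: smooth_cdiff].
Qed.

Lemma cpderiv_conj s u : smooth u ->
  cpderiv s (fun t => (u t)^*) = fun t => (cpderiv s u t)^*.
Proof.
elim/last_ind: s u => [|s i IH] u su; first by rewrite !cpderiv_nil.
by rewrite !cpderiv_rcons cD_conj ?IH//; [exact: smooth_cD|exact: smooth_cdiff].
Qed.

Lemma cpderiv_shift s x u : cpderiv s (fun t => u (t + x)) = fun t => cpderiv s u (t + x).
Proof.
elim/last_ind: s u => [|s i IH] u; first by rewrite !cpderiv_nil.
by rewrite !cpderiv_rcons cD_shift IH.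
Qed.

(** ** Bounds on jets *)

Definition jet_bound k u t (B : R) :=
  forall s, (size s <= k)%N -> normc (cpderiv s u t) <= B.

Lemma jet_bound_ge0 k u t B : jet_bound k u t B -> 0 <= B.
Proof. by move=> /(_ [::] isT); apply: le_trans; exact: normc_ge0. Qed.

Lemma jet_bound_normc k u t B : jet_bound k u t B -> normc (u t) <= B.
Proof. by move=> /(_ [::] isT); rewrite cpderiv_nil. Qed.

Lemma jet_bound_le k l u t B C : (k <= l)%N -> B <= C ->
  jet_bound l u t B -> jet_bound k u t C.
Proof. by move=> kl BC h s sk; rewrite (le_trans _ BC)// h// (leq_trans sk). Qed.

Lemma jet_boundS k u t B :
  jet_bound k.+1 u t B <-> normc (u t) <= B /\ forall i, jet_bound k (cD i u) t B.
Proof.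
split=> [h|[h0 hi] s].
  split=> [|i s sk]; first exact: jet_bound_normc h.
  by rewrite -cpderiv_rcons h// size_rcons.
case/lastP: s => [|s i]; first by rewrite cpderiv_nil.
by rewrite size_rcons cpderiv_rcons => sk; exact: hi.
Qed.

Lemma jet_bound0 u t B : jet_bound 0 u t B <-> normc (u t) <= B.
Proof.
split=> [|h s]; first exact: jet_bound_normc.
by rewrite leqn0 size_eq0 => /eqP ->; rewrite cpderiv_nil.
Qed.

Lemma jet_boundD k u v t A B : smooth u -> smooth v ->
  jet_bound k u t A -> jet_bound k v t B -> jet_bound k (fun t => u t + v t) t (A + B).
Proof.
move=> su sv hu hv s sk; rewrite cpderivD// (le_trans (le_normcD _ _))//.
by rewrite lerD ?hu ?hv.
Qed.

Lemma jet_boundZ k (c : R[i]) u t A : smooth u ->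
  jet_bound k u t A -> jet_bound k (fun t => c * u t) t (normc c * A).
Proof. by move=> su hu s sk; rewrite cpderivZ// normcM ler_wpM2l ?normc_ge0 ?hu. Qed.

Lemma jet_bound_conj k u t A : smooth u ->
  jet_bound k u t A -> jet_bound k (fun t => (u t)^*) t A.
Proof. by move=> su hu s sk; rewrite cpderiv_conj// normc_conj hu. Qed.

Lemma jet_bound_shift k x u t A :
  jet_bound k u (t + x) A -> jet_bound k (fun t => u (t + x)) t A.
Proof. by move=> hu s sk; rewrite cpderiv_shift hu. Qed.

(** The Leibniz rule doubles the number of terms with each derivative. *)
Lemma jet_boundM k u v t A B : smooth u -> smooth v ->
  jet_bound k u t A -> jet_bound k v t B ->
  jet_bound k (fun t => u t * v t) t (2 ^+ k * (A * B)).
Proof.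
elim: k u v => [|k IH] u v su sv hu hv.
  by apply/jet_bound0; rewrite expr0 mul1r normcM ler_pM ?normc_ge0//; exact/jet_bound0.
have [hu0 hui] := (jet_boundS _ _ _ _).1 hu.
have [hv0 hvi] := (jet_boundS _ _ _ _).1 hv.
have A0 := jet_bound_ge0 hu; have B0 := jet_bound_ge0 hv.
apply/jet_boundS; split.
  rewrite normcM (@le_trans _ _ (1 * (A * B)))//.
    by rewrite mul1r ler_pM ?normc_ge0.
  by rewrite ler_wpM2r ?mulr_ge0// exprn_ege1// ler1n.
move=> i; rewrite cD_mul; [|exact: smooth_cdiff..].
rewrite exprS mulr2n mulrDl mulrDl mul1r.
have hu' : jet_bound k u t A by exact: jet_bound_le (leqnSn k) (lexx _) hu.
have hv' : jet_bound k v t B by exact: jet_bound_le (leqnSn k) (lexx _) hv.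
have su' := smooth_cD i su; have sv' := smooth_cD i sv.
by apply: jet_boundD; [exact: smoothM|exact: smoothM|exact: IH|exact: IH].
Qed.

(** The factor 2 pays for real and imaginary parts being estimated apart. *)
Lemma smooth_mean_value u t (v : V) (B : R) : smooth u ->
  (forall (r : R) i, 0 <= r <= 1 -> normc (cD i u (t + r *: v)) <= B) ->
  normc (u (t + v) - u t) <= 2 * (n%:R * `|v| * B).
Proof.
move=> su uB; have du := smooth_cdiff su.
rewrite (le_trans (normc_le_ReIm _))// mulr2n mulrDl mul1r.
rewrite cReB cImB lerD//.
- apply: (@mean_value_bound _ _ (re u) t v B) => [x|r i h]; first exact: (du x).1.
  exact: le_trans (Re_le_normc _) (uB r i h).
- apply: (@mean_value_bound _ _ (im u) t v B) => [x|r i h]; first exact: (du x).2.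
  exact: le_trans (Im_le_normc _) (uB r i h).
Qed.

Lemma jet_bound_increment k u t (v : V) (B : R) : smooth u ->
  (forall r : R, 0 <= r <= 1 -> jet_bound k.+1 u (t + r *: v) B) ->
  jet_bound k (fun t => u (t + v) - u t) t (2 * (n%:R * `|v| * B)).
Proof.
move=> su uB s sk.
rewrite (_ : (fun t => _) = (fun t => u (t + v) + (-1) * u t)); last first.
  by apply/funext => x; rewrite mulN1r.
rewrite cpderivD; [|exact: smooth_shift|exact: smoothZ].
rewrite cpderivZ// cpderiv_shift mulN1r.
apply: smooth_mean_value; first exact: smooth_cpderiv.
by move=> r i r01; have := uB r r01 (i :: s) sk; rewrite cpderiv_cons.
Qed.

Lemma smooth_taylor2 u t (v : V) (B : R) : smooth u ->
  (forall r : R, 0 <= r <= 1 -> jet_bound 2 u (t + r *: v) B) ->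
  normc (u (t + v) - u t - \sum_i (v 0 i)%:C * cD i u t) <=
    2 * (n%:R * `|v| * (n%:R * `|v| * B)).
Proof.
move=> su uB; have du := smooth_cdiff su.
have uB' (r : R) i j : 0 <= r <= 1 -> normc (cD j (cD i u) (t + r *: v)) <= B.
  by move=> /uB h; have := h [:: j; i] isT; rewrite !cpderiv_cons cpderiv_nil.
rewrite (le_trans (normc_le_ReIm _))// mulr2n mulrDl mul1r.
rewrite !cReB !cImB cRe_sum cIm_sum lerD//.
- rewrite (eq_bigr (fun i => v 0 i * 'D_('e_i) (re u) t)); last first.
    by move=> i _; rewrite cReM/= mul0r subr0.
  apply: (@taylor2_bound _ _ (re u) t v B) => [x|i x|r i j /uB' h].
  + exact: (du x).1.
  + exact: (smooth_cdiff (smooth_cD i su) x).1.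
  + exact: le_trans (Re_le_normc _) (h i j).
- rewrite (eq_bigr (fun i => v 0 i * 'D_('e_i) (im u) t)); last first.
    by move=> i _; rewrite cImM/= mul0r addr0.
  apply: (@taylor2_bound _ _ (im u) t v B) => [x|i x|r i j /uB' h].
  + exact: (du x).2.
  + exact: (smooth_cdiff (smooth_cD i su) x).2.
  + exact: le_trans (Im_le_normc _) (h i j).
Qed.

(** A converse of [smooth_taylor2], for functions given by integrals. *)
Lemma cdiff_remainder u t (a : 'I_n -> R[i]) (C : R) :
  (forall v : V, `|v| <= 1 ->
    normc (u (t + v) - u t - \sum_i (v 0 i)%:C * a i) <= C * `|v| ^+ 2) ->
  [/\ differentiable (re u) t, differentiable (im u) t & forall i, cD i u t = a i].
Proof.
move=> H.
have [|dr Dr] := @quadratic_remainder_diff R n (re u) t (\row_i complex.Re (a i)) C.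
  move=> v /H; apply: le_trans; apply: le_trans (Re_le_normc _).
  rewrite !cReB cRe_sum /dotv /re; rewrite (eq_bigr (fun i => complex.Re ((v 0 i)%:C * a i)))//.
  by move=> i _; rewrite mxE cReM/= mul0r subr0.
have [|di Di] := @quadratic_remainder_diff R n (im u) t (\row_i complex.Im (a i)) C.
  move=> v /H; apply: le_trans; apply: le_trans (Im_le_normc _).
  rewrite !cImB cIm_sum /dotv /im; rewrite (eq_bigr (fun i => complex.Im ((v 0 i)%:C * a i)))//.
  by move=> i _; rewrite mxE cImM/= mul0r addr0.
split=> // i; rewrite /cD Dr Di !mxE; exact/complexP.
Qed.

End smooth.

(** * Exponentials *)

Section exponentials.
Context {R : realType} {n : nat}.
Local Notation V := 'rV[R]_n.
Local Notation "'e_ i" := (delta_mx 0 i : 'rV[R]_n) (at level 8, i at level 2).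
Implicit Types (a b : 'rV[R[i]]_n) (t x : V) (k m : nat).

Definition chr a t : R[i] := cexp (dotv a (cvec t)).

Lemma cvecD t x : cvec (t + x) = cvec t + cvec x.
Proof. by apply/rowP => i; rewrite !mxE rmorphD. Qed.

Lemma cvecN t : cvec (- t) = - cvec t.
Proof. by apply/rowP => i; rewrite !mxE rmorphN. Qed.

Lemma cvec0 : cvec (0 : V) = 0.
Proof. by apply/rowP => i; rewrite !mxE. Qed.

Lemma dotv_cvec t x : dotv (cvec t) (cvec x) = (dotv t x)%:C.
Proof. by rewrite /dotv rmorph_sum; apply: eq_bigr => i _; rewrite !mxE rmorphM. Qed.

Lemma chrDl a b t : chr (a + b) t = chr a t * chr b t.
Proof. by rewrite /chr dotvDl cexpD. Qed.

Lemma chrDr a t x : chr a (t + x) = chr a t * chr a x.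
Proof. by rewrite /chr cvecD dotvDr cexpD. Qed.

Lemma chr0r a : chr a 0 = 1.
Proof. by rewrite /chr cvec0 dotv0r cexp0. Qed.

Definition re_row a : V := \row_i complex.Re (a 0 i).
Definition im_row a : V := \row_i complex.Im (a 0 i).

Lemma Re_dotv a t : complex.Re (dotv a (cvec t)) = dotv (re_row a) t.
Proof.
rewrite /dotv cRe_sum; apply: eq_bigr => i _.
by rewrite cReM !mxE/= mulr0 subr0.
Qed.

Lemma Im_dotv a t : complex.Im (dotv a (cvec t)) = dotv (im_row a) t.
Proof.
rewrite /dotv cIm_sum; apply: eq_bigr => i _.
by rewrite cImM !mxE/= mulr0 add0r.
Qed.

Lemma normc_chr a t : normc (chr a t) = expR (dotv (re_row a) t).
Proof. by rewrite /chr normc_cexp Re_dotv. Qed.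

Let comp_linform (f f' : R -> R) (l : V) t : (forall y : R, is_derive y 1 f (f' y)) ->
  differentiable (f \o linform l) t /\
  forall i, 'D_('e_i) (f \o linform l) t = l 0 i * f' (linform l t).
Proof.
move=> df.
have dfx : differentiable f (linform l t).
  by apply/derivable1_diffP; have [] := df (linform l t).
split.
  apply: (@differentiable_comp R V R R (linform l) f) => //.
  exact: (@linear_differentiable R V R (linform l) t (@linform_continuous R n l)).
move=> i; transitivity ('D_(l 0 i) f (linform l t)).
  by rewrite /derive /=; under eq_fun do rewrite linform_is_linear linform_delta.
have <- : 'D_1 f (linform l t) = f' (linform l t) by have [] := df (linform l t).
rewrite deriveE// -derive1E deriv1E//; exact/derivable1_diffP.
Qed.

Let re_chr a : re (chr a) = (expR \o linform (re_row a)) * (cos \o linform (im_row a)).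
Proof.
apply/funext => t; rewrite /re /chr /cexp cReM /= mul0r subr0.
by rewrite Re_dotv Im_dotv /linform !(dotvC _ t).
Qed.

Let im_chr a : im (chr a) = (expR \o linform (re_row a)) * (sin \o linform (im_row a)).
Proof.
apply/funext => t; rewrite /im /chr /cexp cImM /= mul0r addr0.
by rewrite Re_dotv Im_dotv /linform !(dotvC _ t).
Qed.

Lemma cdiff_chr a : cdiff (chr a).
Proof.
move=> t; rewrite re_chr im_chr.
have [de _] := comp_linform (re_row a) t (@is_derive_expR R).
have [dc _] := comp_linform (im_row a) t (@is_derive_cos R).
have [ds _] := comp_linform (im_row a) t (@is_derive_sin R).
by split; exact: differentiableM.
Qed.

Lemma cD_chr a i : cD i (chr a) = fun t => a 0 i * chr a t.
Proof.
apply/funext => t; rewrite /cD re_chr im_chr.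
have [de De] := comp_linform (re_row a) t (@is_derive_expR R).
have [dc Dc] := comp_linform (im_row a) t (@is_derive_cos R).
have [ds Ds] := comp_linform (im_row a) t (@is_derive_sin R).
have He : derivable (expR \o linform (re_row a)) t 'e_i by exact: diff_derivable.
have Hc : derivable (cos \o linform (im_row a)) t 'e_i by exact: diff_derivable.
have Hs : derivable (sin \o linform (im_row a)) t 'e_i by exact: diff_derivable.
rewrite (deriveM He Hc) (deriveM He Hs) De Dc Ds.
have -> : chr a t = re (chr a) t +i* im (chr a) t by rewrite /re /im; case: (chr a t).
rewrite re_chr im_chr !mulrfctE /= !mxE.
case: (a 0 i) => p q /=.
move: (expR _) (cos _) (sin _) => A B C.
by apply: complexP => /=; rewrite /GRing.scale /=; ring.
Qed.

Lemma smooth_chr a : smooth (chr a).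
Proof.
apply: (@smooth_coind _ _ (fun u => exists c, u = fun t => c * chr a t)); last first.
  by exists 1; apply/funext => t; rewrite mul1r.
move=> _ [c ->]; split=> [|i]; first exact/cdiffM/cdiff_chr/cdiff_cst.
exists (c * a 0 i); rewrite cD_scale ?cD_chr; last exact: cdiff_chr.
by apply/funext => t; rewrite mulrA.
Qed.

Lemma jet_bound_chr k a t (A : R) : 1 <= A -> (forall i, normc (a 0 i) <= A) ->
  jet_bound k (chr a) t (A ^+ k * normc (chr a t)).
Proof.
move=> A1 aA; have A0 : 0 <= A by exact: le_trans ler01 A1.
elim: k => [|k IH]; first by apply/jet_bound0; rewrite expr0 mul1r.
apply/jet_boundS; split.
  by rewrite ler_peMl ?normc_ge0// exprn_ege1.
move=> i; rewrite cD_chr exprS -mulrA.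
apply: jet_bound_le (leqnn _) _ (jet_boundZ (a 0 i) (smooth_chr a) IH).
by rewrite ler_wpM2r// mulr_ge0 ?normc_ge0// exprn_ge0.
Qed.

Lemma normc_chr_le a t (d : R) : (forall i, normc (a 0 i) <= d) ->
  normc (chr a t) <= expR (n%:R * d * `|t|).
Proof.
move=> ad; rewrite normc_chr ler_expR.
rewrite (le_trans (ler_norm _))// (le_trans (dotv_le _ _))// -mulrA.
have [n0|n_gt0] := posnP n.
  have -> : (n%:R : R) = 0 by rewrite n0.
  by rewrite !mul0r.
rewrite ler_wpM2l ?ler0n// ler_wpM2r//.
apply: norm_le_coord => [|i]; first exact: le_trans (normc_ge0 _) (ad (Ordinal n_gt0)).
by rewrite mxE (le_trans (Re_le_normc _)).
Qed.

(** For small frequencies an exponential is close to 1, linearly in the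
    frequency. The factor [|t|] of the mean value theorem is absorbed by one
    more order of exponential growth. *)
Lemma jet_bound_chr1 k a t (d : R) : d <= 1 -> (forall i, normc (a 0 i) <= d) ->
  0 <= d ->
  jet_bound k (fun t => chr a t - 1) t
    ((2 * n%:R + 1) * d * expR (n.+1%:R * `|t|)).
Proof.
move=> d1 ad d0.
have E x : `|x| <= `|t| -> normc (chr a x) <= expR (n%:R * `|t|).
  move=> xt; rewrite (le_trans (normc_chr_le x ad))// ler_expR -mulrA.
  by rewrite ler_wpM2l ?ler0n// (le_trans _ xt)// ler_piMl.
have tE : `|t| * expR (n%:R * `|t|) <= expR (n.+1%:R * `|t|).
  have -> : n.+1%:R = n%:R + 1 :> R by rewrite -addn1 natrD.
  rewrite mulrDl mul1r expRD mulrC ler_wpM2l ?expR_ge0//.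
  by rewrite (le_trans _ (expR_ge1Dx _))// lerDr.
have nE : expR (n%:R * `|t|) <= expR (n.+1%:R * `|t|).
  by rewrite ler_expR ler_wpM2r// ler_nat.
have b0 : normc (chr a t - 1) <= (2 * n%:R + 1) * d * expR (n.+1%:R * `|t|).
  have := @smooth_mean_value _ _ (chr a) 0 t (d * expR (n%:R * `|t|)) (smooth_chr a).
  rewrite add0r chr0r => /(_ _)/le_trans; apply.
    move=> r i /andP[r0 r1]; rewrite cD_chr normcM ler_pM ?normc_ge0//.
    by apply: E; rewrite add0r normrZ ger0_norm// ler_piMl.
  have h1 : 2 * n%:R * d * (`|t| * expR (n%:R * `|t|)) <=
            2 * n%:R * d * expR (n.+1%:R * `|t|) by rewrite ler_wpM2l// !mulr_ge0.
  have h2 : 0 <= d * expR (n.+1%:R * `|t|) by rewrite mulr_ge0 ?expR_ge0.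
  by move: h1 h2; move: (expR _) (expR _) => A B; lra.
case: k => [|k]; first exact/jet_bound0.
apply/jet_boundS; split=> // i.
have -> : cD i (fun t => chr a t - 1) = fun t => a 0 i * chr a t.
  transitivity (fun t => cD i (chr a) t + cD i (fun=> -1) t).
    exact: (cD_add i (cdiff_chr a) (cdiff_cst (-1))).
  by apply/funext => x; rewrite cD_cst cD_chr addr0.
have a1 j : normc (a 0 j) <= 1 by rewrite (le_trans (ad j)).
have := jet_boundZ (a 0 i) (smooth_chr a) (@jet_bound_chr k a t 1 (lexx 1) a1).
apply: jet_bound_le => //.
rewrite expr1n mul1r (@le_trans _ _ (d * expR (n.+1%:R * `|t|)))//.
  by rewrite ler_pM ?normc_ge0// (le_trans (E _ _)).
rewrite -[leRHS]mulrA ler_peMl ?mulr_ge0 ?expR_ge0//.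
by rewrite lerDr mulr_ge0.
Qed.

End exponentials.

(** * The space K_1 through bounds in the max norm *)

Section K1_bounds.
Context {R : realType} {n : nat}.
Local Notation V := 'rV[R]_n.
Implicit Types (u v : V -> R[i]) (t x : V) (k m N : nat) (F : functional R n).

(** The max norm in the weight is equivalent to the Euclidean one up to a
    factor [n], which only changes the index [N]. One index controls the order
    of the derivatives and their decay, so that these bounds decrease in
    strength with [N] and can be compared. *)
Definition kbound N u (B : R) :=
  forall t, jet_bound N u t (B * expR (- (N%:R * `|t|))).

Lemma kbound_ge0 N u B : kbound N u B -> 0 <= B.
Proof.
by move=> /(_ 0) /jet_bound_ge0; rewrite normr0 mulr0 oppr0 expR0 mulr1.
Qed.

Lemma kbound_jet N u B k m t : kbound N u B -> (k <= N)%N -> (m <= N)%N ->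
  jet_bound k u t (B * expR (- (m%:R * `|t|))).
Proof.
move=> uB kN mN; apply: jet_bound_le kN _ (uB t).
by rewrite ler_wpM2l ?(kbound_ge0 uB)// ler_expR lerN2 ler_wpM2r// ler_nat.
Qed.

Lemma kbound_le k N u B C : (k <= N)%N -> B <= C -> kbound N u B -> kbound k u C.
Proof.
move=> kN BC uB t; apply: jet_bound_le (leqnn _) _ (kbound_jet t uB kN kN).
by rewrite ler_wpM2r// expR_ge0.
Qed.

Lemma le_mul_expRN (a b x : R) : (a <= b * expR (- x)) = (expR x * a <= b).
Proof. by rewrite expRN ler_pdivlMr ?expR_gt0// mulrC. Qed.

Lemma norm_le_enorm t : `|t| <= enorm t.
Proof.
apply: norm_le_coord => [|i]; first exact: sqrtr_ge0.
rewrite -sqrtr_sqr ler_sqrt; last by apply: sumr_ge0 => j _; exact: sqr_ge0.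
by rewrite (bigD1 i)//= lerDl; apply: sumr_ge0 => j _; exact: sqr_ge0.
Qed.

Lemma enorm_le_norm t : enorm t <= n%:R * `|t|.
Proof.
rewrite -[leRHS]ger0_norm ?mulr_ge0// -sqrtr_sqr ler_sqrt ?sqr_ge0//.
rewrite (@le_trans _ _ (\sum_(i < n) `|t| ^+ 2))//.
  by apply: ler_sum => i _; rewrite -real_normK ?num_real// ler_sqr ?nnegrE ?coord_le_norm.
rewrite sumr_const card_ord exprMn -[leLHS]mulr_natl ler_wpM2r ?sqr_ge0//.
by rewrite -natrX ler_nat; case: (n) => // p; rewrite leq_pmulr.
Qed.

Lemma seminorm_le k u (B : R) : (K1_seminorm k u <= B%:E)%E <->
  forall s t, (size s <= k)%N -> expR (k%:R * enorm t) * normc (cpderiv s u t) <= B.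
Proof.
split=> [h s t sk|h].
  rewrite -lee_fin; apply: le_trans h; apply: ereal_sup_ubound.
  by exists s, t.
by apply: ge_ereal_sup => _ [s [t [sk ->]]]; rewrite lee_fin; exact: h.
Qed.

Lemma seminorm_kbound k u (B : R) : (K1_seminorm k u <= B%:E)%E -> kbound k u B.
Proof.
move=> /seminorm_le h t s sk; rewrite le_mul_expRN (le_trans _ (h s t sk))// ler_wpM2r ?normc_ge0// ler_expR.
by rewrite ler_wpM2l// norm_le_enorm.
Qed.

Lemma kbound_seminorm k u (B : R) : kbound (k * n.+1) u B -> (K1_seminorm k u <= B%:E)%E.
Proof.
move=> h; apply/seminorm_le => s t sk.
have sk' : (size s <= k * n.+1)%N by rewrite (leq_trans sk)// leq_pmulr.
have := h t s sk'; rewrite le_mul_expRN; apply: le_trans.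
rewrite ler_wpM2r ?normc_ge0// ler_expR natrM -mulrA.
rewrite ler_wpM2l// (le_trans (enorm_le_norm t))// ler_wpM2r// ler_nat.
exact: leqnSn.
Qed.

Lemma K1P u : K1 u <-> smooth u /\ forall N, exists B, kbound N u B.
Proof.
split=> -[su h]; split=> // k.
  have := h k; case E : (K1_seminorm k u) => [r| |]// _.
    by exists r; apply: seminorm_kbound; rewrite E.
  exists 0; apply: seminorm_kbound; rewrite E; exact: leNye.
have [B uB] := h (k * n.+1)%N.
exact: le_lt_trans (kbound_seminorm uB) (ltry _).
Qed.

Lemma K1_smooth u : K1 u -> smooth u. Proof. by case. Qed.

Lemma K1_kbound u N : K1 u -> exists B, kbound N u B.
Proof. by move=> /K1P[_ /(_ N)]. Qed.

Lemma kboundD N u v A B : smooth u -> smooth v -> kbound N u A -> kbound N v B ->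
  kbound N (fun t => u t + v t) (A + B).
Proof. by move=> su sv hu hv t; rewrite mulrDl; exact: jet_boundD. Qed.

Lemma kboundZ N u c A : smooth u -> kbound N u A ->
  kbound N (fun t => c * u t) (normc c * A).
Proof. by move=> su hu t; rewrite -mulrA; exact: jet_boundZ. Qed.

Lemma K1D u v : K1 u -> K1 v -> K1 (fun t => u t + v t).
Proof.
move=> /K1P[su hu] /K1P[sv hv]; apply/K1P; split=> [|N]; first exact: smoothD.
have [A uA] := hu N; have [B vB] := hv N.
by exists (A + B); exact: kboundD.
Qed.

Lemma K1Z c u : K1 u -> K1 (fun t => c * u t).
Proof.
move=> /K1P[su hu]; apply/K1P; split=> [|N]; first exact: smoothZ.
by have [A uA] := hu N; exists (normc c * A); exact: kboundZ.
Qed.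

Lemma K1B u v : K1 u -> K1 v -> K1 (fun t => u t - v t).
Proof.
move=> hu hv; rewrite (_ : (fun _ => _) = fun t => u t + (-1) * v t).
  by apply: K1D => //; exact: K1Z.
by apply/funext => t; rewrite mulN1r.
Qed.

Lemma kboundB N u v A B : smooth u -> smooth v -> kbound N u A -> kbound N v B ->
  kbound N (fun t => u t - v t) (A + B).
Proof.
move=> su sv hu hv; rewrite (_ : (fun _ => _) = fun t => u t + (-1) * v t).
  apply: kboundD => //; first exact: smoothZ.
  by rewrite -(mul1r B) -normc1 -[X in X * _]normcN; exact: kboundZ.
by apply/funext => t; rewrite mulN1r.
Qed.

Lemma K1_0 : K1 (fun _ : V => 0).
Proof.
apply/K1P; split=> [|N]; first exact: smooth_cst.
exists 0 => t s _; rewrite mul0r.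
have -> : (fun _ : V => 0) = (fun t => 0 * (fun _ : V => 0 : R[i]) t).
  by apply/funext => x; rewrite mul0r.
by rewrite cpderivZ ?mul0r ?normc0//; exact: smooth_cst.
Qed.

Lemma K1_conj u : K1 u -> K1 (fun t => (u t)^*).
Proof.
move=> /K1P[su hu]; apply/K1P; split=> [|N]; first exact: smooth_conj.
by have [A uA] := hu N; exists A => t; apply: jet_bound_conj.
Qed.

Lemma expR_shift N t x : expR (- (N%:R * `|t + x|)) <= expR (N%:R * `|x|) * expR (- (N%:R * `|t|)) :> R.
Proof.
rewrite -expRD ler_expR -mulrBr -mulrN ler_wpM2l// lerNl opprB lerBlDr.
by rewrite -{1}(addrK x t) (le_trans (ler_normB _ _)).
Qed.

Lemma kbound_shift N u x A : kbound N u A ->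
  kbound N (fun t => u (t + x)) (A * expR (N%:R * `|x|)).
Proof.
move=> hu t; apply: jet_bound_shift; apply: jet_bound_le (leqnn N) _ (hu (t + x)).
by rewrite -mulrA ler_wpM2l ?(kbound_ge0 hu)// expR_shift.
Qed.

Lemma K1_shift x u : K1 u -> K1 (fun t => u (t + x)).
Proof.
move=> /K1P[su hu]; apply/K1P; split=> [|N]; first exact: smooth_shift.
by have [A uA] := hu N; exists (A * expR (N%:R * `|x|)); exact: kbound_shift.
Qed.

(** Multiplication by a function whose jets grow at most like [expR (m |t|)]
    costs [m] orders of decay. *)
Lemma kbound_mul k m N u v (A D : R) : smooth u -> smooth v -> kbound N v A ->
  (k + m <= N)%N -> 0 <= D ->
  (forall t, jet_bound k u t (D * expR (m%:R * `|t|))) ->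
  kbound k (fun t => u t * v t) (2 ^+ k * (D * A)).
Proof.
move=> su sv hv kmN D0 uC t; have uCt := uC t.
have := jet_boundM su sv uCt (kbound_jet t hv (leq_trans (leq_addr m k) kmN) kmN).
apply: jet_bound_le => //; rewrite -[leRHS]mulrA ler_wpM2l ?exprn_ge0//.
rewrite -[leRHS]mulrA -[leLHS]mulrA ler_wpM2l//.
rewrite [leLHS]mulrCA ler_wpM2l ?(kbound_ge0 hv)//.
by rewrite -expRD ler_expR natrD mulrDl opprD addrCA subrr addr0.
Qed.

Lemma K1M u v : K1 u -> K1 v -> K1 (fun t => u t * v t).
Proof.
move=> /K1P[su hu] /K1P[sv hv]; apply/K1P; split=> [|N]; first exact: smoothM.
have [A uA] := hu N; have [B vB] := hv N.
exists (2 ^+ N * (A * B)) => t; have := jet_boundM su sv (uA t) (vB t).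
apply: jet_bound_le => //.
rewrite -[leRHS]mulrA ler_wpM2l ?exprn_ge0//.
rewrite -[leRHS]mulrA -[leLHS]mulrA ler_wpM2l ?(kbound_ge0 uA)//.
rewrite [leLHS]mulrCA ler_wpM2l ?(kbound_ge0 vB)// -[leRHS]mul1r ler_wpM2r ?expR_ge0//.
Qed.

(** ** Functionals *)

Definition K1_linear F := forall (a : R[i]) phi chi, K1 phi -> K1 chi ->
  F (fun t => a * phi t + chi t) = a * F phi + F chi.

Definition K1_bounded F N (C : R) := 0 <= C /\
  forall u B, K1 u -> kbound N u B -> normc (F u) <= C * B.

Lemma K1_linearD F u v : K1_linear F -> K1 u -> K1 v ->
  F (fun t => u t + v t) = F u + F v.
Proof.
move=> lF hu hv; have := lF 1 _ _ hu hv; rewrite mul1r => <-.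
by under [in RHS]eq_fun do rewrite mul1r.
Qed.

Lemma K1_linear0 F : K1_linear F -> F (fun=> 0) = 0.
Proof.
move=> lF; have := K1_linearD lF K1_0 K1_0; under eq_fun do rewrite addr0.
by move=> /eqP; rewrite -subr_eq0 opprD addNKr oppr_eq0 => /eqP.
Qed.

Lemma K1_linearZ F c u : K1_linear F -> K1 u -> F (fun t => c * u t) = c * F u.
Proof.
move=> lF hu; have := lF c _ _ hu K1_0; rewrite K1_linear0// addr0 => <-.
by under [in RHS]eq_fun do rewrite addr0.
Qed.

Lemma K1_linearB F u v : K1_linear F -> K1 u -> K1 v ->
  F (fun t => u t - v t) = F u - F v.
Proof.
move=> lF hu hv; rewrite -(mulN1r (F v)) -K1_linearZ// -K1_linearD//; last exact: K1Z.
by under [in RHS]eq_fun do rewrite mulN1r.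
Qed.

Lemma K1_linear_sum F I (r : seq I) (c : I -> R[i]) (u : I -> V -> R[i]) :
  K1_linear F -> (forall i, K1 (u i)) ->
  K1 (fun t => \sum_(i <- r) c i * u i t) /\
  F (fun t => \sum_(i <- r) c i * u i t) = \sum_(i <- r) c i * F (u i).
Proof.
move=> lF hu; elim: r => [|i r [IH1 IH2]].
  under eq_fun do rewrite big_nil.
  by rewrite big_nil K1_linear0//; split=> //; exact: K1_0.
under eq_fun do rewrite big_cons.
by split; [apply: K1D => //; exact: K1Z|rewrite big_cons -IH2 lF].
Qed.

(** Homogeneity turns continuity at the origin into a bound by one norm. *)
Lemma dualP F : K1_dual F <-> K1_linear F /\ exists N C, K1_bounded F N C.
Proof.
split=> [[lF cF]|[lF [N [C [C0 FC]]]]]; split=> //.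
  have [k [d [d0 H]]] := cF _ K1_0 1 ltr01.
  exists (k * n.+1)%N, (2 / d); split; first by rewrite divr_ge0// ltW.
  move=> u B Ku uB; have B0 := kbound_ge0 uB.
  apply/ler_addgt0Pr => e e0.
  pose B' := B + e * d / 2.
  have B'0 : 0 < B' by rewrite ltr_wpDl// divr_gt0// mulr_gt0.
  pose a : R := d / (2 * B').
  have a0 : 0 < a by rewrite divr_gt0// mulr_gt0.
  have := H (fun t => a%:C * u t) (K1Z _ Ku).
  rewrite K1_linear0// K1_linearZ// subr0 normcM normc_real gtr0_norm//.
  under eq_fun do rewrite subr0.
  have -> : 2 / d * B + e = 2 / d * B' by rewrite /B'; field; rewrite gt_eqF.
  have -> : 2 / d * B' = 1 / a by rewrite /a; field; rewrite !gt_eqF.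
  rewrite ler_pdivlMr// mulrC => h; apply/ltW/h.
  apply: (@le_lt_trans _ _ (d / 2)%:E); last by rewrite lte_fin ltr_pdivrMr// ltr_pMr// ltr1n.
  apply: kbound_seminorm.
  have := kboundZ a%:C (K1_smooth Ku) uB; apply: kbound_le => //.
  rewrite normc_real gtr0_norm// (@le_trans _ _ (a * B'))//.
    by rewrite ler_wpM2l ?(ltW a0)// lerDl divr_ge0// mulr_ge0 ?ltW.
  by rewrite /a le_eqVlt; apply/orP; left; apply/eqP; field; rewrite gt_eqF.
move=> phi Kphi e e0; exists N, (e / (C + 1)).
have C1 : 0 < C + 1 by rewrite ltr_wpDl.
split; first by rewrite divr_gt0.
move=> chi Kchi h; rewrite -K1_linearB//.
have := FC _ _ (K1B Kchi Kphi) (seminorm_kbound (ltW h)) => /le_lt_trans; apply.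
by rewrite mulrCA gtr_pMr// ltr_pdivrMr// mul1r ltrDl.
Qed.

End K1_bounds.

(** * Integrals of complex functions dominated by a fixed weight *)

Section complex_measurable.
Context {R : realType} d {T : measurableType d}.
Implicit Types F G : T -> R[i].

Definition cmeas F := measurable_fun setT (re F) /\ measurable_fun setT (im F).

Lemma cmeas_cst (c : R[i]) : cmeas (fun=> c).
Proof. by split; exact: measurable_cst. Qed.

Lemma cmeasD F G : cmeas F -> cmeas G -> cmeas (fun x => F x + G x).
Proof.
move=> [Fr Fi] [Gr Gi]; split.
- rewrite (_ : re _ = re F \+ re G); first exact: measurable_funD.
  by apply/funext => x; rewrite /re cReD.
- rewrite (_ : im _ = im F \+ im G); first exact: measurable_funD.
  by apply/funext => x; rewrite /im cImD.
Qed.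

Lemma cmeasM F G : cmeas F -> cmeas G -> cmeas (fun x => F x * G x).
Proof.
move=> [Fr Fi] [Gr Gi]; split.
- rewrite (_ : re _ = (re F \* re G) \- (im F \* im G)).
    by apply: measurable_funB; exact: measurable_funM.
  by apply/funext => x; rewrite /re cReM.
- rewrite (_ : im _ = (re F \* im G) \+ (im F \* re G)).
    by apply: measurable_funD; exact: measurable_funM.
  by apply/funext => x; rewrite /im cImM.
Qed.

Lemma cmeasZ c F : cmeas F -> cmeas (fun x => c * F x).
Proof. by move=> mF; apply: cmeasM => //; exact: cmeas_cst. Qed.

Lemma cmeasB F G : cmeas F -> cmeas G -> cmeas (fun x => F x - G x).
Proof.
move=> mF mG; rewrite (_ : (fun _ => _) = fun x => F x + (-1) * G x).
  by apply: cmeasD => //; exact: cmeasZ.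
by apply/funext => x; rewrite mulN1r.
Qed.

Lemma cmeas_sum I (r : seq I) (F : I -> T -> R[i]) :
  (forall i, cmeas (F i)) -> cmeas (fun x => \sum_(i <- r) F i x).
Proof.
move=> mF; elim: r => [|i r IH].
  by under eq_fun do rewrite big_nil; exact: cmeas_cst.
by under eq_fun do rewrite big_cons; exact: cmeasD.
Qed.

Lemma cmeas_conj F : cmeas F -> cmeas (fun x => (F x)^*).
Proof.
move=> [Fr Fi]; split.
- by rewrite (_ : re _ = re F)//; apply/funext => x; rewrite /re; case: (F x).
- rewrite (_ : im _ = -%R \o im F); first exact: measurableT_comp.
  by apply/funext => x; rewrite /im /=; case: (F x).
Qed.

Lemma cvg_cReIm (u : nat -> R[i]) l :
  (forall e : R, 0 < e -> \forall k \near \oo, normc (u k - l) < e) ->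
  complex.Re (u k) @[k --> \oo] --> complex.Re l /\
  complex.Im (u k) @[k --> \oo] --> complex.Im l.
Proof.
move=> h; split; apply/cvgrPdist_lt => e e0; apply: filterS (h e e0) => k.
- by apply: le_lt_trans; rewrite distrC -cReB Re_le_normc.
- by apply: le_lt_trans; rewrite distrC -cImB Im_le_normc.
Qed.

(** The radii of the topology of [R[i]] are complex; real ones suffice. *)
Definition ccvg (u : nat -> R[i]) l :=
  forall e : R, 0 < e -> \forall k \near \oo, normc (u k - l) < e.

Lemma ccvg_unique (u : nat -> R[i]) l l' : ccvg u l -> ccvg u l' -> l = l'.
Proof.
move=> h h'; apply/eqP; rewrite -subr_eq0; apply: contraT => ll'.
have e0 : 0 < normc (l - l') / 2 by rewrite divr_gt0// normc_gt0.
near \oo => k.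
have h1 : normc (u k - l) < normc (l - l') / 2 by near: k; exact: h.
have h2 : normc (u k - l') < normc (l - l') / 2 by near: k; exact: h'.
have := le_normcD (l - u k) (u k - l'); rewrite addrA subrK.
by rewrite (normcBC l (u k)) => h3; exfalso; lra.
Unshelve. all: by end_near. Qed.

Lemma cmeas_cvg (F : nat -> T -> R[i]) G : (forall k, cmeas (F k)) ->
  (forall x, ccvg (F ^~ x) (G x)) -> cmeas G.
Proof.
move=> mF FG; split.
- apply: (@measurable_fun_cvg _ _ _ setT (fun k => re (F k))) => [k|x _].
    exact: (mF k).1.
  exact: (cvg_cReIm (FG x)).1.
- apply: (@measurable_fun_cvg _ _ _ setT (fun k => im (F k))) => [k|x _].
    exact: (mF k).2.
  exact: (cvg_cReIm (FG x)).2.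
Qed.

(** The limit is replaced by zero on a measurable null set that contains
    the points without convergence. *)
Lemma cmeas_ae_cvg (mu : {measure set T -> \bar R}) (F : nat -> T -> R[i]) G :
  (forall k, cmeas (F k)) -> {ae mu, forall x, ccvg (F ^~ x) (G x)} ->
  exists G', cmeas G' /\ {ae mu, forall x, G x = G' x}.
Proof.
move=> mF [N [mN N0 sN]].
exists (fun x => (\1_(~` N) x : R)%:C * G x); split.
  apply: (@cmeas_cvg (fun k x => (\1_(~` N) x : R)%:C * F k x)) => [k|x].
    apply: cmeasM => //; split; last exact: measurable_cst.
    exact/measurable_indic/measurableC.
  rewrite indicE; have [xN|xN] := boolP (x \in N).
    have -> : x \in ~` N = false by rewrite in_setC xN.
    by move=> e e0; apply: nearW => k; rewrite /= !mul0r subrr normc0.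
  have -> : x \in ~` N by rewrite in_setC xN.
  have -> : (true%:R : R)%:C = 1 by [].
  under eq_fun do rewrite mul1r.
  rewrite mul1r; apply: contrapT => h; move: xN; rewrite notin_setE; apply.
  exact: (sN x h).
exists N; split=> // x /= h; apply: contrapT => xN; apply: h.
by rewrite indicE mem_set// mul1r.
Qed.

End complex_measurable.

Section complex_integral.
Context {R : realType} d {T : measurableType d} (mu : {measure set T -> \bar R}).
Context (q : T -> R) (q0 : forall x, 0 <= q x)
  (iq : mu.-integrable setT (EFin \o q)).
Implicit Types F G : T -> R[i].

Definition cint F : R[i] := (\int[mu]_x re F x)%R +i* (\int[mu]_x im F x)%R.

Definition tame F := cmeas F /\ exists C : R, forall x, normc (F x) <= C * q x.

Definition qmass : R := (\int[mu]_x q x)%R.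

Lemma qmass_ge0 : 0 <= qmass.
Proof. by apply: Rintegral_ge0. Qed.

Let dominated_integrable (f : T -> R) (C : R) : measurable_fun setT f ->
  (forall x, `|f x| <= C * q x) -> mu.-integrable setT (EFin \o f).
Proof.
move=> mf fC; apply: (@le_integrable _ _ _ _ _ measurableT _ (fun x => (C * q x)%:E)).
- exact/measurable_EFinP.
- move=> x _ /=; rewrite lee_fin (le_trans (fC x))// ler_norm//.
- exact: (integrableZl measurableT C iq).
Qed.

Lemma tame_re F : tame F -> mu.-integrable setT (EFin \o re F).
Proof.
move=> [[mF _] [C FC]]; apply: (@dominated_integrable _ C) => // x.
exact: le_trans (Re_le_normc _) (FC x).
Qed.

Lemma tame_im F : tame F -> mu.-integrable setT (EFin \o im F).
Proof.
move=> [[_ mF] [C FC]]; apply: (@dominated_integrable _ C) => // x.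
exact: le_trans (Im_le_normc _) (FC x).
Qed.

Lemma tameD F G : tame F -> tame G -> tame (fun x => F x + G x).
Proof.
move=> [mF [A FA]] [mG [B GB]]; split; first exact: cmeasD.
by exists (A + B) => x; rewrite (le_trans (le_normcD _ _))// mulrDl lerD.
Qed.

Lemma tameZ c F : tame F -> tame (fun x => c * F x).
Proof.
move=> [mF [A FA]]; split; first exact: cmeasZ.
by exists (normc c * A) => x; rewrite normcM -mulrA ler_wpM2l ?normc_ge0.
Qed.

Lemma cintD F G : tame F -> tame G -> cint (fun x => F x + G x) = cint F + cint G.
Proof.
move=> tF tG; apply: complexP => /=.
- rewrite -RintegralD//; [|exact: tame_re..].
  by congr Rintegral; apply/funext => x; rewrite /re cReD.
- rewrite -RintegralD//; [|exact: tame_im..].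
  by congr Rintegral; apply/funext => x; rewrite /im cImD.
Qed.

Lemma cintZ c F : tame F -> cint (fun x => c * F x) = c * cint F.
Proof.
move=> tF; have iR := tame_re tF; have iI := tame_im tF.
have iZ (r : R) (f : T -> R) : mu.-integrable setT (EFin \o f) ->
    mu.-integrable setT (EFin \o (fun x => r * f x)).
  by move=> /(integrableZl measurableT r).
apply: complexP; rewrite ?cReM ?cImM /=.
- rewrite -!RintegralZl// -RintegralB//; [|exact: iZ..].
  by congr Rintegral; apply/funext => x; rewrite /re cReM.
- rewrite -!RintegralZl// -RintegralD//; [|exact: iZ..].
  by congr Rintegral; apply/funext => x; rewrite /im cImM.
Qed.

Lemma tameB F G : tame F -> tame G -> tame (fun x => F x - G x).
Proof.
move=> tF tG; rewrite (_ : (fun _ => _) = fun x => F x + (-1) * G x).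
  by apply: tameD => //; exact: tameZ.
by apply/funext => x; rewrite mulN1r.
Qed.

Lemma cintB F G : tame F -> tame G -> cint (fun x => F x - G x) = cint F - cint G.
Proof.
move=> tF tG; rewrite -(mulN1r (cint G)) -cintZ// -cintD//; last exact: tameZ.
by congr cint; apply/funext => x; rewrite mulN1r.
Qed.

Lemma tame0 : tame (fun=> 0).
Proof.
by split; [exact: cmeas_cst|exists 0 => x; rewrite mul0r normc0].
Qed.

Lemma cint0 : cint (fun=> 0) = 0.
Proof.
by apply: complexP => /=; rewrite /Rintegral /re /im /=; rewrite integral0.
Qed.

Lemma cint_sum I (r : seq I) (F : I -> T -> R[i]) : (forall i, tame (F i)) ->
  tame (fun x => \sum_(i <- r) F i x) /\
  cint (fun x => \sum_(i <- r) F i x) = \sum_(i <- r) cint (F i).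
Proof.
move=> tF; elim: r => [|i r [IH1 IH2]].
  under eq_fun do rewrite big_nil.
  by rewrite big_nil; split; [exact: tame0|exact: cint0].
under eq_fun do rewrite big_cons.
by split; [exact: tameD|rewrite big_cons -IH2 cintD].
Qed.

(** The factor 2 spares the rotation argument for complex integrands. *)
Lemma normc_cint_le F (C : R) : cmeas F -> (forall x, normc (F x) <= C * q x) ->
  normc (cint F) <= 2 * (C * qmass).
Proof.
move=> mF FC; have tF : tame F by split=> //; exists C.
rewrite (le_trans (normc_le_ReIm _))// mulr2n mulrDl mul1r.
have H (f : T -> R) : mu.-integrable setT (EFin \o f) -> (forall x, `|f x| <= normc (F x)) ->
    `|(\int[mu]_x f x)%R| <= C * qmass.
  move=> fi fF; rewrite (le_trans (le_normr_Rintegral measurableT fi))//.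
  rewrite /qmass -RintegralZl//; apply: le_Rintegral => //.
  - exact: (integrable_norm fi).
  - exact: (integrableZl measurableT C iq).
  - by move=> x _; exact: le_trans (fF x) (FC x).
by apply: lerD; apply: H; [exact: tame_re|move=> x; exact: Re_le_normc|
  exact: tame_im|move=> x; exact: Im_le_normc].
Qed.

Lemma cint_dominated_cvg (F : nat -> T -> R[i]) G (C : R) :
  (forall k, cmeas (F k)) -> cmeas G -> (forall k x, normc (F k x) <= C * q x) ->
  {ae mu, forall x, ccvg (F ^~ x) (G x)} -> ccvg (fun k => cint (F k)) (cint G).
Proof.
move=> mF mG FC FG.
have iC : mu.-integrable setT (fun x => (C * q x)%:E).
  exact: (integrableZl measurableT C iq).
have H (f : nat -> T -> R) (g : T -> R) : (forall k, measurable_fun setT (f k)) ->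
    measurable_fun setT g -> (forall k x, `|f k x| <= C * q x) ->
    {ae mu, forall x, f k x @[k --> \oo] --> g x} ->
    (\int[mu]_x f k x)%R @[k --> \oo] --> (\int[mu]_x g x)%R.
  move=> mf mg fC fg.
  have [] := @dominated_convergence _ _ _ mu setT measurableT
    (fun k x => (f k x)%:E) (fun x => (g x)%:E) (fun x => (C * q x)%:E).
  - by move=> k; exact/measurable_EFinP.
  - exact/measurable_EFinP.
  - by apply: filterS fg => x h _; apply: cvg_EFin => //; exact: nearW.
  - exact: iC.
  - by apply: aeW => x k _; rewrite lee_fin.
  move=> ig _ h; rewrite /Rintegral; apply: fine_cvg; rewrite fineK//.
  exact: integrable_fin_num.
have hr : (\int[mu]_x re (F k) x)%R @[k --> \oo] --> (\int[mu]_x re G x)%R.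
  apply: H => [k||k x|]; [exact: (mF k).1|exact: mG.1|exact: le_trans (Re_le_normc _) (FC k x)|].
  by apply: filterS FG => x h; exact: (cvg_cReIm h).1.
have hi : (\int[mu]_x im (F k) x)%R @[k --> \oo] --> (\int[mu]_x im G x)%R.
  apply: H => [k||k x|]; [exact: (mF k).2|exact: mG.2|exact: le_trans (Im_le_normc _) (FC k x)|].
  by apply: filterS FG => x h; exact: (cvg_cReIm h).2.
move=> e e0; have e2 : 0 < e / 2 by rewrite divr_gt0.
move/cvgrPdist_lt : hr => /(_ _ e2) hr; move/cvgrPdist_lt : hi => /(_ _ e2) hi.
near=> k; rewrite (le_lt_trans (normc_le_ReIm _))//.
rewrite cReB cImB/= (splitr e) distrC [X in _ + X]distrC ltrD//.
- by near: k.
- by near: k.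
Unshelve. all: by end_near. Qed.

End complex_integral.

(** * Integrals of families of test functions *)

Section pettis.
Context {R : realType} d {T : measurableType d} (mu : {measure set T -> \bar R}).
Context (q : T -> R) (q0 : forall x, 0 <= q x)
  (iq : mu.-integrable setT (EFin \o q)).
Context {n : nat}.
Local Notation V := 'rV[R]_n.

Lemma ccvg_rate (u : nat -> R[i]) l (C : R) :
  (forall m, normc (u m - l) <= C / m.+1%:R) -> ccvg u l.
Proof.
move=> h e e0.
have C0 : 0 <= C by have := h 0%N; rewrite divr1; apply: le_trans; exact: normc_ge0.
near=> m; apply: (le_lt_trans (h m)).
rewrite ltr_pdivrMr// mulrC -ltr_pdivrMr//.
rewrite (@lt_le_trans _ _ m%:R)// ?ler_nat//.
near: m; exists (Num.truncn (C / e)).+1 => // m /= Cm.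
by rewrite (lt_le_trans (truncnS_gt _))// ler_nat.
Unshelve. all: by end_near. Qed.

Variables (Phi : T -> V -> R[i]) (KPhi : forall p, K1 (Phi p)).
Hypothesis Phi_bound : forall k, exists C, forall p, kbound k (Phi p) (C * q p).
Variables (I : nat -> finType) (w : forall m, I m -> T -> R[i])
  (chi : forall m, I m -> V -> R[i]).
Hypothesis tame_w : forall m j, tame q (@w m j).
Hypothesis Kchi : forall m j, K1 (@chi m j).
(** Approximation of the family by finite sums of products, at a rate that the
    weight controls, stands for its measurability as a map into K_1. *)
Hypothesis Phi_error : forall k, exists C, forall m p,
  kbound k (fun t => Phi p t - \sum_j @w m j p * @chi m j t) (C * q p / m.+1%:R).

Let cpderiv_approx s m p t :
  cpderiv s (fun t => Phi p t - \sum_j @w m j p * @chi m j t) t =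
  cpderiv s (Phi p) t - \sum_j @w m j p * cpderiv s (@chi m j) t.
Proof.
have H : forall r : seq (I m), smooth (fun t => \sum_(j <- r) @w m j p * @chi m j t) /\
    cpderiv s (fun t => \sum_(j <- r) @w m j p * @chi m j t) =
    fun t => \sum_(j <- r) @w m j p * cpderiv s (@chi m j) t.
  elim=> [|j r [sr IH]].
    under eq_fun do rewrite big_nil; split; first exact: smooth_cst.
    have := cpderivZ s 0 (smooth_cst (n := n) (0 : R[i])); under eq_fun do rewrite mulr0.
    by move=> ->; apply/funext => x; rewrite mul0r big_nil.
  under eq_fun do rewrite big_cons.
  have sj : smooth (fun t => @w m j p * @chi m j t) by exact/smoothZ/K1_smooth.
  split; first exact: smoothD.
  rewrite cpderivD// IH cpderivZ; last exact: K1_smooth.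
  by apply/funext => x; rewrite big_cons.
have [sS DS] := H (index_enum (I m)).
have -> : (fun t => Phi p t - \sum_j @w m j p * @chi m j t) =
    fun t => Phi p t + (-1) * (\sum_j @w m j p * @chi m j t).
  by apply/funext => x; rewrite mulN1r.
rewrite cpderivD; [|exact: K1_smooth|exact: smoothZ].
by rewrite cpderivZ// DS mulN1r.
Qed.

Let error_le s t : exists2 C, 0 <= C & forall m p,
  normc (\sum_j @w m j p * cpderiv s (@chi m j) t - cpderiv s (Phi p) t) <=
  C * q p / m.+1%:R * expR (- ((size s)%:R * `|t|)).
Proof.
have [C HC] := Phi_error (size s); exists `|C| => // m p.
have := HC m p t s (leqnn _); rewrite cpderiv_approx normcBC => /le_trans; apply.
by rewrite !ler_wpM2r ?expR_ge0 ?invr_ge0// ler_norm.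
Qed.

Let cmeas_Phi s t : cmeas (fun p => cpderiv s (Phi p) t).
Proof.
have [C C0 HC] := error_le s t.
apply: (@cmeas_cvg _ _ _ (fun m p => \sum_j @w m j p * cpderiv s (@chi m j) t)).
  move=> m; apply: cmeas_sum => j.
  by have [h _] := tame_w j; apply: cmeasM => //; exact: cmeas_cst.
move=> p; apply: (@ccvg_rate _ _ (C * q p)) => m; rewrite (le_trans (HC m p))//.
rewrite ler_piMr//; first by rewrite divr_ge0// mulr_ge0.
Qed.

Definition pettis t : R[i] := cint mu (fun p => Phi p t).

Let Dpettis s t : R[i] := cint mu (fun p => cpderiv s (Phi p) t).

Let tame_Phi s t : tame q (fun p => cpderiv s (Phi p) t).
Proof.
split; first exact: cmeas_Phi.
have [C HC] := Phi_bound (size s).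
exists (C * expR (- ((size s)%:R * `|t|))) => p.
by rewrite mulrAC; exact: (HC p t s (leqnn _)).
Qed.

Let Dpettis_bound k : exists C, 0 <= C /\ forall s t, (size s <= k)%N ->
  normc (Dpettis s t) <= C * expR (- (k%:R * `|t|)).
Proof.
have [C HC] := Phi_bound k; exists (2 * (`|C| * qmass mu q)); split.
  by rewrite !mulr_ge0 ?qmass_ge0.
move=> s t sk.
have := @normc_cint_le _ _ _ mu q iq (fun p => cpderiv s (Phi p) t)
  (`|C| * expR (- (k%:R * `|t|))) (cmeas_Phi s t).
rewrite (_ : 2 * (`|C| * expR (- (k%:R * `|t|)) * qmass mu q) =
  2 * (`|C| * qmass mu q) * expR (- (k%:R * `|t|))); last by ring.
apply => p; apply: le_trans (HC p t s sk) _.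
by rewrite [leRHS]mulrAC !ler_wpM2r ?expR_ge0 ?ler_norm.
Qed.

Let Dpettis_diff s : cdiff (Dpettis s) /\ forall i, cD i (Dpettis s) = Dpettis (i :: s).
Proof.
have [C HC] := Phi_bound (size s).+2.
suff H t : [/\ differentiable (re (Dpettis s)) t, differentiable (im (Dpettis s)) t &
    forall i, cD i (Dpettis s) t = Dpettis (i :: s) t].
  split=> [t|i]; first by have [] := H t.
  by apply/funext => t; have [_ _] := H t.
pose K := 2 * (2 * (n%:R * (n%:R * `|C|)) * qmass mu q).
apply: (@cdiff_remainder _ _ _ t _ K) => v _.
have tS : tame q (fun p => \sum_i (v 0 i)%:C * cpderiv (i :: s) (Phi p) t).
  by apply: (cint_sum iq _ (fun i => tameZ _ (tame_Phi (i :: s) t))).1.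
have -> : Dpettis s (t + v) - Dpettis s t - \sum_i (v 0 i)%:C * Dpettis (i :: s) t =
    cint mu (fun p => cpderiv s (Phi p) (t + v) - cpderiv s (Phi p) t
      - \sum_i (v 0 i)%:C * cpderiv (i :: s) (Phi p) t).
  rewrite (cintB iq)//; last exact: tameB (tame_Phi _ _) (tame_Phi _ _).
  rewrite (cintB iq)//.
  rewrite (cint_sum iq _ (fun i => tameZ _ (tame_Phi (i :: s) t))).2.
  by congr (_ - _); apply: eq_bigr => i _; rewrite (cintZ iq).
rewrite (_ : K * `|v| ^+ 2 = 2 * (2 * (n%:R * `|v| * (n%:R * `|v| * `|C|)) * qmass mu q)); last first.
  by rewrite /K; ring.
apply: normc_cint_le => //.
  by apply: cmeasB; [apply: cmeasB; exact: cmeas_Phi|exact: tS.1].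
move=> p.
have sP : smooth (cpderiv s (Phi p)) by exact/smooth_cpderiv/K1_smooth.
have := @smooth_taylor2 _ _ (cpderiv s (Phi p)) t v (`|C| * q p) sP.
move=> /(_ _)/le_trans; apply; last by rewrite !mulrA.
move=> r r01 s' s'2.
have -> : cpderiv s' (cpderiv s (Phi p)) = cpderiv (s' ++ s) (Phi p).
  by apply/funext => x; rewrite /cpderiv /pderiv !foldr_cat.
have sz : (size (s' ++ s) <= (size s).+2)%N by rewrite size_cat -addn2 addnC leq_add2l.
apply: le_trans (HC p (t + r *: v) _ sz) _.
rewrite (@le_trans _ _ (C * q p))//; last by rewrite ler_wpM2r// ler_norm.
by rewrite ler_piMr ?(kbound_ge0 (HC p))// -expR0 ler_expR oppr_le0 mulr_ge0.
Qed.

Lemma cpderiv_pettis s t : cpderiv s pettis t = cint mu (fun p => cpderiv s (Phi p) t).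
Proof.
suff -> : cpderiv s pettis = Dpettis s by [].
elim: s => [|i s IH].
  rewrite cpderiv_nil /pettis /Dpettis; apply/funext => x.
  by congr cint; apply/funext => p; rewrite cpderiv_nil.
by rewrite cpderiv_cons IH (Dpettis_diff s).2.
Qed.

Let cpderiv_pettisE s : cpderiv s pettis = Dpettis s.
Proof. by apply/funext => t; exact: cpderiv_pettis. Qed.

Lemma K1_pettis : K1 pettis.
Proof.
apply/K1P; split=> [|k].
  by apply/smoothP => s; rewrite cpderiv_pettisE; exact: (Dpettis_diff s).1.
have [C [_ HC]] := Dpettis_bound k; exists C => t s sk.
by rewrite cpderiv_pettisE; exact: HC.
Qed.

(** A continuous functional commutes with the integral of a family of test
    functions; on simple families this is linearity, and both sides depend
    continuously on the family. *)
Lemma functional_pettis (F : functional R n) : K1_dual F ->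
  tame q (fun p => F (Phi p)) /\ F pettis = cint mu (fun p => F (Phi p)).
Proof.
move=> /dualP[lF [k [CF [CF0 HF]]]].
have [C HC] := Phi_bound k; have [E HE] := Phi_error k.
pose Fm m p := \sum_j @w m j p * F (@chi m j).
have KS m (c : I m -> R[i]) := K1_linear_sum (index_enum (I m)) c lF (Kchi (m := m)).
have FmE m p : F (Phi p) - Fm m p = F (fun t => Phi p t - \sum_j @w m j p * @chi m j t).
  by have [KSm FSm] := KS m (fun j => w j p); rewrite K1_linearB// FSm.
have Fm_err m p : normc (Fm m p - F (Phi p)) <= (CF * E / m.+1%:R) * q p.
  rewrite normcBC FmE (_ : _ * q p = CF * (E * q p / m.+1%:R)); last by ring.
  have [KSm _] := KS m (fun j => w j p).
  by apply: HF; [exact: K1B|exact: HE].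
have mFm m : cmeas (Fm m).
  by apply: cmeas_sum => j; have [h _] := tame_w j; apply: cmeasM => //; exact: cmeas_cst.
have mF : cmeas (fun p => F (Phi p)).
  apply: (cmeas_cvg mFm) => p; apply: (@ccvg_rate _ _ (CF * E * q p)) => m.
  by rewrite mulrAC; exact: Fm_err.
have tF : tame q (fun p => F (Phi p)).
  by split=> //; exists (CF * C) => p; rewrite -mulrA; exact: HF.
split=> //.
have tFm m : tame q (Fm m).
  apply: (cint_sum iq _ _).1 => j; under eq_fun do rewrite mulrC.
  exact: tameZ.
pose M := 2 * (CF * `|E| * qmass mu q).
apply: (@ccvg_unique _ (fun m => cint mu (Fm m))); last first.
  apply: (@ccvg_rate _ _ M) => m; rewrite -(cintB iq)//.
  have := @normc_cint_le _ _ _ mu q iq (fun p => Fm m p - F (Phi p)) (CF * `|E| / m.+1%:R).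
  rewrite (_ : M / _ = 2 * (CF * `|E| / m.+1%:R * qmass mu q)); last by rewrite /M; ring.
  apply; first exact: cmeasB.
  move=> p; rewrite (le_trans (Fm_err m p))// ler_wpM2r// ler_wpM2r ?invr_ge0//.
  by rewrite ler_wpM2l// ler_norm.
have cFm m : cint mu (Fm m) = F (fun t => \sum_j cint mu (@w m j) * @chi m j t).
  have [_ ->] := KS m (fun j => cint mu (w j)).
  have -> : Fm m = fun p => \sum_j F (@chi m j) * @w m j p.
    by apply/funext => p; apply: eq_bigr => j _; rewrite mulrC.
  rewrite (cint_sum iq _ (fun j => tameZ _ (tame_w j))).2.
  by apply: eq_bigr => j _; rewrite (cintZ iq)// mulrC.
apply: (@ccvg_rate _ _ (CF * (2 * (`|E| * qmass mu q)))) => m.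
have [KSm _] := KS m (fun j => cint mu (w j)).
rewrite cFm normcBC -K1_linearB//; last exact: K1_pettis.
rewrite -mulrA; apply: HF; first exact: K1B K1_pettis KSm.
move=> t s sk.
have -> : cpderiv s (fun t => pettis t - \sum_j cint mu (@w m j) * @chi m j t) t =
    cint mu (fun p => cpderiv s (fun t => Phi p t - \sum_j @w m j p * @chi m j t) t).
  have -> : (fun p => cpderiv s (fun t => Phi p t - \sum_j @w m j p * @chi m j t) t) =
      fun p => cpderiv s (Phi p) t - \sum_j cpderiv s (@chi m j) t * @w m j p.
    apply/funext => p; rewrite cpderiv_approx; congr (_ - _).
    by apply: eq_bigr => j _; rewrite mulrC.
  have [tS IS] := cint_sum iq (index_enum (I m))
    (fun j => tameZ (cpderiv s (@chi m j) t) (tame_w j)).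
  rewrite (cintB iq)// IS -cpderiv_pettis.
  have -> : (fun t => pettis t - \sum_j cint mu (@w m j) * @chi m j t) =
      fun t => pettis t + (-1) * (\sum_j cint mu (@w m j) * @chi m j t).
    by apply/funext => x; rewrite mulN1r.
  rewrite cpderivD; [|exact: K1_smooth K1_pettis|exact/smoothZ/K1_smooth].
  rewrite cpderivZ; last exact: K1_smooth.
  rewrite mulN1r; congr (_ - _).
  have D : forall r : seq (I m), K1 (fun t => \sum_(j <- r) cint mu (@w m j) * @chi m j t) /\
     cpderiv s (fun t => \sum_(j <- r) cint mu (@w m j) * @chi m j t) t =
     \sum_(j <- r) cint mu (@w m j) * cpderiv s (@chi m j) t.
    elim=> [|j r [Kr IH]].
      under eq_fun do rewrite big_nil; split; first exact: K1_0.
      have := cpderivZ s 0 (smooth_cst (n := n) (0 : R[i])); under eq_fun do rewrite mulr0.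
      by move=> ->; rewrite mul0r big_nil.
    under eq_fun do rewrite big_cons.
    split; first by apply: K1D => //; exact: K1Z.
    rewrite cpderivD; [|exact/smoothZ/K1_smooth|exact: K1_smooth].
    by rewrite IH cpderivZ ?big_cons//; exact: K1_smooth.
  rewrite (D _).2; apply: eq_bigr => j _; rewrite (cintZ iq)// mulrC.
  done.
have := @normc_cint_le _ _ _ mu q iq
  (fun p => cpderiv s (fun t => Phi p t - \sum_j @w m j p * @chi m j t) t)
  (`|E| / m.+1%:R * expR (- (k%:R * `|t|))).
rewrite (_ : 2 * (`|E| * qmass mu q) / m.+1%:R * expR (- (k%:R * `|t|)) =
  2 * (`|E| / m.+1%:R * expR (- (k%:R * `|t|)) * qmass mu q)); last by ring.
apply.
  have -> : (fun p => cpderiv s (fun t => Phi p t - \sum_j @w m j p * @chi m j t) t) =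
      fun p => cpderiv s (Phi p) t - \sum_j @w m j p * cpderiv s (@chi m j) t.
    by apply/funext => p; rewrite cpderiv_approx.
  apply: cmeasB; first exact: cmeas_Phi.
  by apply: cmeas_sum => j; have [h _] := tame_w j; apply: cmeasM => //; exact: cmeas_cst.
move=> p; apply: le_trans (HE m p t s sk) _.
have -> : `|E| / m.+1%:R * expR (- (k%:R * `|t|)) * q p =
  `|E| * q p / m.+1%:R * expR (- (k%:R * `|t|)) by ring.
by rewrite !ler_wpM2r ?expR_ge0 ?invr_ge0// ler_norm.
Qed.

End pettis.

(** * The principle of uniform boundedness *)

Section counting_series.
Context {R : realType}.

Definition geom (i : nat) : R := 2^-1 ^+ i.

Lemma geom_ge0 i : 0 <= geom i. Proof. by rewrite exprn_ge0// invr_ge0. Qed.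

Lemma geom_le i : geom i * i.+1%:R <= 1.
Proof.
rewrite /geom exprVn mulrC ler_pdivrMr ?exprn_gt0// mul1r -natrX ler_nat.
exact: ltn_expl.
Qed.

Notation count_mu := (@counting nat R).

Lemma count_measurable (f : nat -> R) : measurable_fun setT f.
Proof. by []. Qed.

Lemma count_cmeas (F : nat -> R[i]) : cmeas F.
Proof. by split; exact: count_measurable. Qed.

Lemma geom_integrable : count_mu.-integrable setT (EFin \o geom).
Proof.
apply/integrableP; split; first exact/measurable_EFinP.
rewrite (eq_integral (fun i => (geom i)%:E)); last first.
  by move=> i _ /=; rewrite ger0_norm ?geom_ge0.
rewrite ge0_integral_count; last by move=> i; rewrite lee_fin geom_ge0.
apply: (@le_lt_trans _ _ (2%:E)); last by rewrite ltry.
apply: lime_le.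
  by apply: is_cvg_nneseries => i _ _; rewrite lee_fin geom_ge0.
apply: nearW => m; rewrite sumEFin lee_fin.
suff -> : \sum_(0 <= i < m) geom i = 2 - 2 * geom m by rewrite lerBlDr lerDl mulr_ge0 ?geom_ge0.
elim: m => [|m IH]; first by rewrite big_geq// /geom expr0 mulr1 subrr.
rewrite big_nat_recr//= IH /geom exprS; by field.
Qed.

Lemma cint_count_delta k (c : R[i]) :
  tame geom (fun i => (i == k)%:R * c) /\ cint count_mu (fun i => (i == k)%:R * c) = c.
Proof.
have t1 : tame geom (fun i => c * (i == k)%:R).
  apply: tameZ; split; first exact: count_cmeas.
  exists (2 ^+ k) => i; have [->|_] := eqVneq i k.
    by rewrite normc1 /geom exprVn divff// expf_neq0.
  by rewrite normc0 mulr_ge0 ?geom_ge0// exprn_ge0.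
have t2 : tame geom (fun i => (i == k)%:R : R[i]).
  split; first exact: count_cmeas.
  exists (2 ^+ k) => i; have [->|_] := eqVneq i k.
    by rewrite normc1 /geom exprVn divff// expf_neq0.
  by rewrite normc0 mulr_ge0 ?geom_ge0// exprn_ge0.
have -> : (fun i => (i == k)%:R * c) = (fun i => c * (i == k)%:R).
  by apply/funext => i; rewrite mulrC.
split=> //; rewrite (cintZ geom_integrable)//.
suff -> : cint count_mu (fun i => (i == k)%:R) = 1 by rewrite mulr1.
apply: complexP => /=; rewrite /Rintegral.
- rewrite (eq_integral (EFin \o \1_[set k])).
    rewrite integral_indic// setIT.
    have := erefl (counting [set k] : \bar R).
    rewrite [in RHS]/counting asboolT// fset_set1 finmap.cardfs1 => h.
    by have /(congr1 fine) := h.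
  move=> i _; rewrite /re /= indicE; congr EFin.
  have -> : (i \in [set k]) = (i == k) by apply/idP/eqP => [/set_mem|->]; [|exact/mem_set].
  by case: (i == k).
- rewrite (eq_integral (fun=> 0%E)); first by rewrite integral0.
  by move=> i _; rewrite /im /=; case: (i == k).
Qed.

(** The head of the series is a finite sum, the tail an integral that the
    weight makes small. *)
Lemma cint_count_split (G : nat -> R[i]) m : tame geom G ->
  cint count_mu G = \sum_(i < m) G i + cint count_mu (fun i => (m <= i)%N%:R * G i).
Proof.
move=> tG.
have tr : tame geom (fun i => (m <= i)%N%:R * G i).
  split; first exact: count_cmeas.
  have [_ [C GC]] := tG; exists C => i; rewrite normcM.
  apply: le_trans (GC i); rewrite ler_piMl ?normc_ge0//.
  by case: (_ <= _)%N; rewrite ?normc1 ?normc0.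
have [ts Is] := cint_sum geom_integrable (index_enum 'I_m)
  (fun j : 'I_m => (cint_count_delta j (G j)).1).
have {1}-> : G = fun i => \sum_(j < m) (i == j)%:R * G j + (m <= i)%N%:R * G i.
  apply/funext => i; have [im|mi] := ltnP i m.
    rewrite mul0r addr0 (bigD1 (Ordinal im))//= eqxx mul1r big1 ?addr0// => j ji.
    have -> : (i == j :> nat) = false by apply: contra_neqF ji => /eqP ij; exact/val_inj.
    by rewrite mul0r.
  rewrite mul1r big1 ?add0r// => j _.
  by rewrite gtn_eqF ?mul0r// (leq_trans (ltn_ord j)).
rewrite (cintD geom_integrable)// Is; congr (_ + _).
by apply: eq_bigr => j _; rewrite (cint_count_delta j (G j)).2.
Qed.

End counting_series.

Section uniform_boundedness.
Context {R : realType} {n : nat}.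
Local Notation V := 'rV[R]_n.
Local Notation count_mu := (@counting nat R).
Implicit Types (u : nat -> V -> R[i]).

(** Completeness of K_1: a series of test functions converges as soon as its
    [j]-th term is small with respect to the [j]-th norm. *)
Lemma K1_series u : (forall j, K1 (u j)) ->
  (forall j, kbound j (u j) (geom j ^+ 2)) ->
  exists phi, K1 phi /\ forall F : functional R n, K1_dual F ->
    tame geom (fun j => F (u j)) /\ F phi = cint count_mu (fun j => F (u j)).
Proof.
move=> Ku ub.
have g1 j : (geom j : R) <= 1 by rewrite exprn_ile1 ?invr_ge0// invf_le1// ler1n.
have key k : exists2 C : R, 0 <= C & forall j, kbound k (u j) (C * geom j ^+ 2).
  pose B j := projT1 (cid (K1_kbound k (Ku j))).
  have BP j : kbound k (u j) (B j) by exact: projT2 (cid (K1_kbound k (Ku j))).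
  have B0 j : 0 <= B j by exact: kbound_ge0 (BP j).
  have S0 : 0 <= \sum_(i < k) B i / geom i ^+ 2.
    by apply: sumr_ge0 => i _; rewrite divr_ge0// exprn_ge0// geom_ge0.
  exists (1 + \sum_(i < k) B i / geom i ^+ 2); first by rewrite addr_ge0.
  move=> j; have g0 : 0 < (geom j : R) ^+ 2 by rewrite exprn_gt0// exprn_gt0// invr_gt0.
  have [jk|kj] := ltnP j k; last first.
    apply: (kbound_le kj _ (ub j)); rewrite ler_peMl//; first exact: ltW.
    by rewrite lerDl.
  apply: (kbound_le (leqnn k) _ (BP j)); rewrite -ler_pdivrMr//.
  rewrite (bigD1 (Ordinal jk))//= addrCA lerDl addr_ge0//.
  by apply: sumr_ge0 => i _; rewrite divr_ge0// exprn_ge0// geom_ge0.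
pose w m (j : 'I_m) (i : nat) : R[i] := (i == j)%:R.
pose chi m (j : 'I_m) := u j.
have tw m j : tame geom (@w m j).
  have [h _] := cint_count_delta j (1 : R[i]).
  by move: h; congr tame; apply/funext => i; rewrite mulr1.
have wE m i t : \sum_j @w m j i * chi m j t = (i < m)%N%:R * u i t.
  have [im|mi] := ltnP i m.
    rewrite (bigD1 (Ordinal im))//= /w eqxx big1 ?addr0// => j ji.
    have -> : (i == j :> nat) = false by apply: contra_neqF ji => /eqP ij; exact/val_inj.
    by rewrite mul0r.
  rewrite mul0r big1// => j _.
  by rewrite /w gtn_eqF ?mul0r// (leq_trans (ltn_ord j)).
have bound k : exists C : R, forall j, kbound k (u j) (C * geom j).
  have [C C0 HC] := key k; exists C => j; apply: (kbound_le (leqnn k) _ (HC j)).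
  by rewrite ler_wpM2l// expr2 ler_piMl ?geom_ge0.
have error k : exists C : R, forall m i,
    kbound k (fun t => u i t - \sum_j @w m j i * chi m j t) (C * geom i / m.+1%:R).
  have [C C0 HC] := key k; exists C => m i.
  have -> : (fun t => u i t - \sum_j @w m j i * chi m j t) =
      fun t => (m <= i)%N%:R * u i t.
    apply/funext => t; rewrite wE; have [im|mi] := ltnP i m.
      by rewrite mul1r mul0r subrr.
    by rewrite mul0r mul1r subr0.
  have [im|mi] := ltnP i m.
    have := kboundZ 0 (K1_smooth (Ku i)) (HC i); rewrite normc0 mul0r.
    by apply: kbound_le => //; rewrite divr_ge0// mulr_ge0// geom_ge0.
  have := kboundZ 1 (K1_smooth (Ku i)) (HC i); rewrite normc1 mul1r.
  apply: kbound_le => //; rewrite -[leRHS]mulrA ler_wpM2l//.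
  rewrite ler_pdivlMr// expr2 -mulrA ler_piMr ?geom_ge0//.
  by rewrite (le_trans _ (geom_le i))// ler_wpM2l ?geom_ge0// ler_nat.
exists (pettis count_mu u); split.
  exact: (K1_pettis geom_ge0 geom_integrable Ku bound tw (fun m j => Ku j) error).
move=> F dF.
exact: (functional_pettis geom_ge0 geom_integrable Ku bound tw (fun m j => Ku j) error dF).
Qed.

Variables (T : V -> functional R n) (KT : forall h, K1_dual (T h)).
Hypothesis T0 : forall phi, K1 phi -> forall e : R, 0 < e ->
  exists M : R, forall h, M < enorm h -> normc (T h phi) < e.

(** Gliding hump: were the conclusion false, one could add up test functions
    [u j], each of which is bad for some [T (h j)], yet negligible for the
    earlier functionals, while [T (h j)] is negligible on the previous sum. *)
Lemma uniform_boundedness (e : R) : 0 < e -> exists (k : nat) (del M : R),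
  0 < del /\ forall (v : V -> R[i]) h, K1 v -> kbound k v del -> M < enorm h -> normc (T h v) < e.
Proof.
move=> e0; apply: contrapT => neg.
have {}neg k (del M : R) : 0 < del -> exists (x : (V -> R[i]) * V),
    [/\ K1 x.1, kbound k x.1 del, M < enorm x.2 & e <= normc (T x.2 x.1)].
  move=> del0; apply: contrapT => nx; apply: neg; exists k, del, M; split=> // v h Kv vb Mh.
  by rewrite ltNge; apply/negP => eT; apply: nx; exists (v, h).
have bd h : exists NC : nat * R, K1_bounded (T h) NC.1 NC.2.
  by have /dualP[_ [N [C TC]]] := KT h; exists (N, C).
have /choice[nc ncP] := bd.
pose Q : R := qmass count_mu geom.
have Q0 : 0 <= Q by exact: qmass_ge0 geom_ge0.
pose e1 : R := Num.min 1 (e / (8 * (Q + 1))).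
have e1_gt0 : 0 < e1 by rewrite lt_min ltr01 divr_gt0// mulr_gt0// ltr_wpDl.
(* A functional of norm at most D takes a value at most geom j * e1 on the
   j-th term, and the sum of these values is at most e / 4. *)
pose beta j (D : R) : R := geom j ^+ 2 * e1 / (D + 1).
(* The partial sum, and an order and a constant that bound all functionals
   chosen so far. *)
pose state := ((V -> R[i]) * (nat * R))%type.
pose good (p : nat * state) (x : (V -> R[i]) * V) :=
  K1 p.2.1 -> 0 <= p.2.2.2 ->
  [/\ K1 x.1, kbound (p.2.2.1 + p.1) x.1 (beta p.1 p.2.2.2), p.1%:R < enorm x.2,
   e <= normc (T x.2 x.1) & normc (T x.2 p.2.1) < e / 4].
have /choice[f fP] : forall p, exists x, good p x.
  move=> [j [U [N D]]]; have [KU|nKU] := pselect (K1 U); last by exists (fun=> 0, 0) => /nKU.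
  have [D0|D0] := leP 0 D; last by exists (fun=> 0, 0) => _ /=; rewrite leNgt D0.
  have [|M TM] := T0 KU (e := e / 4); first by rewrite divr_gt0.
  have b0 : 0 < beta j D.
    by rewrite divr_gt0 ?ltr_wpDl// mulr_gt0// exprn_gt0// exprn_gt0// invr_gt0.
  have [x [Kx xb xM ex]] := neg (N + j)%N _ (Num.max M j%:R) b0.
  exists x => _ _; split=> //=; first by move: xM; rewrite gt_max => /andP[].
  by apply: TM; move: xM; rewrite gt_max => /andP[].
pose fix st (j : nat) : state := if j is j'.+1 then
    let s := st j' in let x := f (j', s) in
    (fun t => s.1 t + x.1 t, ((s.2.1 + (nc x.2).1)%N, s.2.2 + (nc x.2).2))
  else (fun=> 0, (0%N, 0)).
pose u j := (f (j, st j)).1; pose h j := (f (j, st j)).2.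
have st_inv j : K1 (st j).1 /\ 0 <= (st j).2.2.
  elim: j => [|j [IH1 IH2]] /=; first by split=> //; exact: K1_0.
  have [Kx _ _ _ _] := fP (j, st j) IH1 IH2; split; first exact: K1D.
  by rewrite addr_ge0//; have [] := ncP (f (j, st j)).2.
have fP' j := fP (j, st j) (st_inv j).1 (st_inv j).2.
have Ku j : K1 (u j) by have [] := fP' j.
have stS i j : (i < j)%N -> ((nc (h i)).1 <= (st j).2.1)%N /\ (nc (h i)).2 <= (st j).2.2.
  elim: j => // j IH; rewrite ltnS leq_eqVlt => /predU1P[->|/IH[h1 h2]] /=.
    by split; [exact: leq_addl|rewrite lerDr; exact: (st_inv j).2].
  split; first exact: leq_trans h1 (leq_addr _ _).
  by rewrite (le_trans h2)// lerDl; have [] := ncP (f (j, st j)).2.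
have stE j : (st j).1 = fun t => \sum_(i < j) u i t.
  elim: j => [|j IH]; first by apply/funext => t; rewrite big_ord0.
  by apply/funext => t; rewrite big_ord_recr/= IH.
have bE j : beta j (st j).2.2 <= geom j ^+ 2 * e1.
  have D0 := (st_inv j).2.
  have X0 : 0 <= geom j ^+ 2 * e1 by rewrite mulr_ge0 ?exprn_ge0 ?geom_ge0// ltW.
  have D1 : 1 <= (st j).2.2 + 1 by rewrite lerDr.
  by rewrite /beta ler_pdivrMr ?(lt_le_trans ltr01 D1)// ler_peMr.
have ub j : kbound j (u j) (geom j ^+ 2).
  have [_ xb _ _ _] := fP' j; apply: (kbound_le _ _ xb) => /=; first exact: leq_addl.
  rewrite (le_trans (bE j))// ler_piMr ?exprn_ge0 ?geom_ge0//.
  by rewrite ge_min lexx.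
have [phi [Kphi phiE]] := K1_series Ku ub.
have [|M TM] := T0 Kphi (e := e / 4); first by rewrite divr_gt0.
pose j := (Num.truncn M).+1.
have Mj : M < enorm (h j).
  have [_ _ jh _ _] := fP' j; apply: lt_trans jh => /=; exact: truncnS_gt.
have := TM _ Mj; rewrite ltNge => /negP; apply.
have [tG ->] := phiE _ (KT (h j)).
have [lT _] := (dualP _).1 (KT (h j)).
rewrite (cint_count_split j.+1 tG) big_ord_recr/=.
set rest := cint _ _.
have rest_le : normc rest <= e / 4.
  have tail i : normc ((j < i)%N%:R * T (h j) (u i)) <= e1 * geom i.
    have [ji|ij] := ltnP j i; last by rewrite mul0r normc0 mulr_ge0 ?geom_ge0// ltW.
    have [_ xb _ _ _] := fP' i; have [h1 h2] := stS _ _ ji.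
    have [C0 HC] := ncP (h j).
    have Nk : ((nc (h j)).1 <= (st i).2.1 + i)%N by exact: leq_trans h1 (leq_addr _ _).
    rewrite mul1r (le_trans (HC _ _ (Ku i) (kbound_le Nk (lexx _) xb)))//=.
    have D0 := (st_inv i).2.
    rewrite (@le_trans _ _ ((st i).2.2 * beta i (st i).2.2))//.
      by rewrite ler_wpM2r// (kbound_ge0 xb).
    rewrite /beta; have g1 : (geom i : R) <= 1.
      by rewrite exprn_ile1 ?invr_ge0// invf_le1// ler1n.
    have gi : 0 <= (geom i : R) by exact: geom_ge0.
    have -> : (st i).2.2 * (geom i ^+ 2 * e1 / ((st i).2.2 + 1)) =
        ((st i).2.2 / ((st i).2.2 + 1)) * (geom i * (e1 * geom i)) by rewrite expr2; ring.
    rewrite -[leRHS]mul1r ler_pM ?mulr_ge0 ?divr_ge0 ?invr_ge0 ?addr_ge0 ?(ltW e1_gt0)//.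
      by rewrite ler_pdivrMr ?mul1r ?ltr_wpDl// lerDl.
    by rewrite ler_piMl// mulr_ge0 ?(ltW e1_gt0).
  have := normc_cint_le geom_integrable (count_cmeas _) tail; move/le_trans; apply.
  rewrite -/Q (@le_trans _ _ (2 * (e / (8 * (Q + 1)) * (Q + 1))))//.
    rewrite ler_wpM2l// ler_pM ?(ltW e1_gt0)//; last by rewrite lerDl.
    by rewrite ge_min lexx orbT.
  have Q1 : Q + 1 != 0 by rewrite gt_eqF// ltr_wpDl.
  have -> : 2 * (e / (8 * (Q + 1)) * (Q + 1)) = e / 4 by field.
  exact: lexx.
have [_ _ _ ex Tst] := fP' j.
have TU : T (h j) (st j).1 = \sum_(i < j) T (h j) (u i).
  have [_] := K1_linear_sum (index_enum 'I_j) (fun=> 1) lT (fun i : 'I_j => Ku i).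
  under eq_fun do under eq_bigr do rewrite mul1r.
  by rewrite stE => ->; apply: eq_bigr => i _; rewrite mul1r.
rewrite -TU; move: Tst ex; rewrite -/(u j) -/(h j) /= -/(u j) -/(h j).
set a := T _ _; set b := T _ (u j) => ha hb.
have : normc b <= normc (a + b + rest) + normc a + normc rest.
  have eb : b = (a + b + rest) - a - rest by ring.
  have := le_normcD ((a + b + rest) - a) (- rest); rewrite -eb normcN.
  by have := le_normcD (a + b + rest) (- a); rewrite normcN; lra.
by move=> h1; rewrite leNgt; apply/negP => h2; move: ha hb h1 h2 rest_le; lra.
Qed.

End uniform_boundedness.

(** * Modulated translates of a window *)

Section modulated_translates.
Context {R : realType} {n : nat}.
Local Notation V := 'rV[R]_n.
Implicit Types (u : V -> R[i]) (a b : 'rV[R[i]]_n) (t x v : V).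

Lemma kbound_chr_mul k m a u (A B : R) : 1 <= A -> (forall i, normc (a 0 i) <= A) ->
  (forall t, normc (chr a t) <= expR (m%:R * `|t|)) -> smooth u ->
  kbound (k + m) u B -> kbound k (fun t => chr a t * u t) (2 ^+ k * (A ^+ k * B)).
Proof.
move=> A1 aA ha su ub; have A0 : 0 <= A by exact: le_trans ler01 A1.
apply: (kbound_mul (smooth_chr a) su ub (leqnn _)); first exact: exprn_ge0.
move=> t; have := @jet_bound_chr R n k a t A A1 aA; apply: jet_bound_le => //.
by rewrite ler_wpM2l ?exprn_ge0.
Qed.

(** The difference factors through the small frequency [a - b]. *)
Lemma kbound_chr_diff k m a b u (A B d : R) : 1 <= A -> (forall i, normc (b 0 i) <= A) ->
  (forall t, normc (chr b t) <= expR (m%:R * `|t|)) ->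
  0 <= d <= 1 -> (forall i, normc (a 0 i - b 0 i) <= d) -> smooth u ->
  kbound (k + (m + n.+1)) u B ->
  kbound k (fun t => (chr a t - chr b t) * u t)
    (2 ^+ k * (2 ^+ k * (A ^+ k * ((2 * n%:R + 1) * d)) * B)).
Proof.
move=> A1 bA hb /andP[d0 d1] abd su ub; have A0 : 0 <= A by exact: le_trans ler01 A1.
have E t : chr a t - chr b t = chr b t * (chr (a - b) t - 1).
  by rewrite mulrBr mulr1 -chrDl (addrC b) subrK.
have sab : smooth (fun t => chr (a - b) t - 1).
  exact: (smoothD (smooth_chr (a - b)) (smooth_cst (-1))).
under eq_fun do rewrite E.
have sb : smooth (fun t => chr b t * (chr (a - b) t - 1)).
  by apply: smoothM => //; exact: smooth_chr.
apply: (kbound_mul sb su ub (leqnn _)).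
  by rewrite !mulr_ge0 ?exprn_ge0// addr_ge0// mulr_ge0.
move=> t.
have abd' i : normc ((a - b) 0 i) <= d by rewrite !mxE.
have := jet_boundM (smooth_chr b) sab (@jet_bound_chr R n k b t A A1 bA)
  (@jet_bound_chr1 R n k (a - b) t d d1 abd' d0).
apply: jet_bound_le => //.
have -> : expR ((m + n.+1)%:R * `|t|) =
    expR (m%:R * `|t|) * expR (n.+1%:R * `|t|) by rewrite natrD mulrDl expRD.
rewrite -[leRHS]mulrA ler_wpM2l ?exprn_ge0//.
rewrite -[leLHS]mulrA -[leRHS]mulrA ler_wpM2l ?exprn_ge0//.
rewrite [leLHS]mulrCA ler_wpM2l ?mulr_ge0 ?addr_ge0 ?mulr_ge0//.
by rewrite ler_wpM2r ?expR_ge0.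
Qed.

(** Translations act on the norms in a Lipschitz way, at the cost of one
    derivative. *)
Lemma kbound_shift_diff N u v (B : R) : smooth u -> kbound N.+1 u B -> `|v| <= 1 ->
  kbound N (fun t => u (t + v) - u t) (2 * (n%:R * `|v| * (B * expR N.+1%:R))).
Proof.
move=> su ub v1 t.
have B0 := kbound_ge0 ub.
rewrite (_ : _ * expR _ = 2 * (n%:R * `|v| * (B * expR N.+1%:R * expR (- (N%:R * `|t|)))));
  last by ring.
apply: jet_bound_increment => // r /andP[r0 r1].
have := ub (t + r *: v); apply: jet_bound_le => //.
rewrite -mulrA ler_wpM2l// (le_trans (expR_shift _ _ _))// ler_pM ?expR_ge0//.
  by rewrite ler_expR ler_piMr// normrZ ger0_norm// mulr_ile1.
by rewrite ler_expR lerN2 ler_wpM2r// ler_nat.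
Qed.

Lemma rate_exists a : exists (m : nat) (A : R), [/\ 1 <= A,
  (forall i, normc (a 0 i) <= A) & forall t, normc (chr a t) <= expR (m%:R * `|t|)].
Proof.
pose A := 1 + \sum_i normc (a 0 i).
have S0 : 0 <= \sum_i normc (a 0 i) by apply: sumr_ge0 => i _; exact: normc_ge0.
have aA i : normc (a 0 i) <= A.
  rewrite /A (bigD1 i)//= addrCA lerDl addr_ge0//.
  by apply: sumr_ge0 => j _; exact: normc_ge0.
exists (Num.truncn (n%:R * A)).+1, A; split=> //; first by rewrite lerDl.
move=> t; rewrite (le_trans (normc_chr_le t aA))// ler_expR ler_wpM2r//.
by rewrite ltW// truncnS_gt.
Qed.

Lemma K1_chr_mul a u : K1 u -> K1 (fun t => chr a t * u t).
Proof.
move=> Ku; have [m [A [A1 aA ha]]] := rate_exists a.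
apply/K1P; split=> [|N]; first exact: smoothM (smooth_chr a) (K1_smooth Ku).
have [B uB] := K1_kbound (N + m) Ku.
by exists (2 ^+ N * (A ^+ N * B)); exact: kbound_chr_mul A1 aA ha (K1_smooth Ku) uB.
Qed.

(** The windows of the short-time Fourier transform depend continuously on
    their two parameters for every norm of K_1. *)
Lemma modulated_translate_continuous a0 x0 u k (e : R) : K1 u -> 0 < e ->
  exists2 r : R, 0 < r & forall a x, (forall i, normc (a 0 i - a0 0 i) <= r) ->
    `|x - x0| <= r ->
    kbound k (fun t => chr a t * u (t - x) - chr a0 t * u (t - x0)) e.
Proof.
move=> Ku e0; have [m [A [A1 aA ha]]] := rate_exists a0.
have A0 : 0 <= A by exact: le_trans ler01 A1.
pose N := (k + (m + n.+1))%N.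
have [B uB] := K1_kbound N.+1 Ku; have B0 := kbound_ge0 uB.
pose Y := B * expR (N.+1%:R * (`|x0| + 1)).
pose C1 : R := 2 ^+ k * (2 ^+ k * (A ^+ k * (2 * n%:R + 1)) * Y).
pose C2 : R := 2 ^+ k * (A ^+ k * (2 * (n%:R * (Y * expR N.+1%:R)))).
have Y0 : 0 <= Y by rewrite mulr_ge0 ?expR_ge0.
have C10 : 0 <= C1.
  by rewrite !mulr_ge0 ?exprn_ge0// addr_ge0// mulr_ge0.
have C20 : 0 <= C2 by rewrite !mulr_ge0 ?exprn_ge0 ?expR_ge0.
pose r : R := Num.min 1 (e / (C1 + C2 + 1)).
have CC : 0 < C1 + C2 + 1 by rewrite ltr_wpDl// addr_ge0.
have r0 : 0 < r by rewrite lt_min ltr01 divr_gt0.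
have r1 : r <= 1 by rewrite ge_min lexx.
have rC : (C1 + C2) * r <= e.
  rewrite (@le_trans _ _ ((C1 + C2 + 1) * (e / (C1 + C2 + 1))))//.
    rewrite ler_pM ?addr_ge0 ?(ltW r0)//; first by rewrite lerDl.
    by rewrite ge_min lexx orbT.
  by rewrite mulrCA divff ?mulr1// gt_eqF.
exists r => // a x aa0 xx0.
have Ysh y : `|y| <= `|x0| + 1 -> kbound N.+1 (fun t => u (t - y)) Y.
  move=> y1; apply: (kbound_le (leqnn _) _ (kbound_shift (- y) uB)).
  by rewrite normrN ler_wpM2l// ler_expR ler_wpM2l.
have x1 : `|x| <= `|x0| + 1.
  by rewrite -[x](subrK x0) addrC (le_trans (ler_normD _ _))// lerD2l (le_trans xx0).
have su := K1_smooth Ku.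
have -> : (fun t => chr a t * u (t - x) - chr a0 t * u (t - x0)) =
  (fun t => (chr a t - chr a0 t) * u (t - x) +
     chr a0 t * (u ((t + (x0 - x)) - x0) - u (t - x0))).
  apply/funext => t; have -> : t + (x0 - x) - x0 = t - x by rewrite addrCA addrAC subrr add0r.
  by ring.
apply: (kbound_le (leqnn _) rC).
rewrite mulrDl.
have sx0 : smooth (fun t => u (t - x0)) by exact: smooth_shift.
have sx : smooth (fun t => u (t - x)) by exact: smooth_shift.
have sd : smooth (fun t => u ((t + (x0 - x)) - x0) - u (t - x0)).
  apply: (K1_smooth (K1B (K1_shift (x0 - x) (K1_shift (- x0) Ku)) (K1_shift (- x0) Ku))).
have h1 : kbound k (fun t => (chr a t - chr a0 t) * u (t - x)) (C1 * r).
  have r01 : 0 <= r <= 1 by rewrite ltW.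
  have := kbound_chr_diff A1 aA ha r01 aa0 sx (kbound_le (leqnSn N) (lexx _) (Ysh x x1)).
  by apply: kbound_le => //; rewrite /C1 le_eqVlt; apply/orP; left; apply/eqP; ring.
have h2 : kbound k (fun t => chr a0 t * (u ((t + (x0 - x)) - x0) - u (t - x0))) (C2 * r).
  have x01 : `|x0| <= `|x0| + 1 by rewrite lerDl.
  have v1 : `|x0 - x| <= 1 by rewrite distrC (le_trans xx0).
  have hd := kbound_shift_diff sx0 (Ysh x0 x01) v1.
  have km : (k + m <= N)%N by rewrite leq_add2l leq_addr.
  have := kbound_chr_mul A1 aA ha sd (kbound_le km (lexx _) hd).
  apply: kbound_le => //; rewrite distrC /C2.
  rewrite (@le_trans _ _ (2 ^+ k * (A ^+ k * (2 * (n%:R * r * (Y * expR N.+1%:R))))))//.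
    rewrite !ler_wpM2l ?exprn_ge0// ler_wpM2r ?mulr_ge0 ?expR_ge0//.
    by rewrite ler_wpM2l.
  by rewrite le_eqVlt; apply/orP; left; apply/eqP; ring.
apply: kboundD => //; [apply: smoothM => //|apply: smoothM => //; exact: smooth_chr].
exact: (K1_smooth (K1B _ _)) || (rewrite (_ : (fun t => chr a t - chr a0 t) =
  fun t => chr a t + (-1) * chr a0 t); [apply: smoothD; [exact: smooth_chr|exact/smoothZ/smooth_chr]|
  by apply/funext => t; rewrite mulN1r]).
Qed.

End modulated_translates.

(** * The Abelian half *)

Section dual_operations.
Context {R : realType} {n : nat}.
Local Notation V := 'rV[R]_n.
Implicit Types (F G : functional R n) (x h : V).

Lemma dual_linear F : K1_dual F -> K1_linear F.
Proof. by move=> /dualP[]. Qed.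

Lemma dual_bounded F : K1_dual F -> exists N (C : R), K1_bounded F N C.
Proof. by move=> /dualP[]. Qed.

Lemma dual_translate h F : K1_dual F -> K1_dual (translate h F).
Proof.
move=> /dualP[lF [N [C [C0 FC]]]]; apply/dualP; split.
  by move=> a u v Ku Kv; rewrite /translate lF//; exact: K1_shift.
exists N, (C * expR (N%:R * `|h|)); split; first by rewrite mulr_ge0 ?expR_ge0.
move=> u B Ku uB; rewrite -mulrA [_ * B]mulrC.
by apply: FC; [exact: K1_shift|rewrite -(normrN h); exact: kbound_shift].
Qed.

Lemma dual_scale c F : K1_dual F -> K1_dual (fun u => c * F u).
Proof.
move=> /dualP[lF [N [C [C0 FC]]]]; apply/dualP; split.
  by move=> a u v Ku Kv; rewrite lF// mulrDr mulrCA.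
exists N, (normc c * C); split; first by rewrite mulr_ge0 ?normc_ge0.
by move=> u B Ku uB; rewrite normcM -mulrA ler_wpM2l ?normc_ge0 ?FC.
Qed.

Lemma dual_add F G : K1_dual F -> K1_dual G -> K1_dual (fun u => F u + G u).
Proof.
move=> /dualP[lF [N [C [C0 FC]]]] /dualP[lG [M [D [D0 GD]]]]; apply/dualP; split.
  by move=> a u v Ku Kv; rewrite lF// lG//; ring.
exists (maxn N M), (C + D); split; first by rewrite addr_ge0.
move=> u B Ku uB; rewrite (le_trans (le_normcD _ _))// mulrDl lerD//.
- by apply: FC => //; apply: kbound_le uB => //; exact: leq_maxl.
- by apply: GD => //; apply: kbound_le uB => //; exact: leq_maxr.
Qed.

Lemma dual_sub F G : K1_dual F -> K1_dual G -> K1_dual (fun u => F u - G u).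
Proof.
move=> dF dG; rewrite (_ : (fun _ => _) = fun u => F u + (-1) * G u).
  by apply: dual_add => //; exact: dual_scale.
by apply/funext => u; rewrite mulN1r.
Qed.

Lemma at_infty_enorm (A : set V) :
  (\forall h \near at_infty, A h) <-> exists M : R, forall h, M < enorm h -> A h.
Proof. by []. Qed.

Lemma at_infty_norm (A : set V) :
  (\forall h \near at_infty, A h) <-> exists M : R, forall h, M < `|h| -> A h.
Proof.
split=> -[M MA]; last first.
  exists (n%:R * `|M|) => h Mh; apply: MA.
  have := lt_le_trans Mh (enorm_le_norm h).
  have [n0|n0] := posnP n.
    have -> : (n%:R : R) = 0 by rewrite n0.
    by rewrite !mul0r ltxx.
  by rewrite ltr_pM2l ?ltr0n//; apply: le_lt_trans; exact: ler_norm.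
by exists M => h Mh; apply: MA; exact: lt_le_trans (norm_le_enorm h).
Qed.

End dual_operations.

Section uniform_limits.
Context {R : realType}.

Lemma uniform_cvg_normc (X : choiceType) (I : Type) (F : set_system I) {FF : Filter F}
    (f : I -> X -> R[i]) (g : X -> R[i]) (A : set X) :
  (forall e : R, 0 < e -> \forall h \near F, forall p, A p -> normc (f h p - g p) < e) ->
  {uniform A, f @ F --> g}.
Proof.
move=> H P /uniform_nbhs[E [entE EP]].
have : entourage_ (@ball _ R[i]) E by rewrite entourage_ballE.
move=> [[a b] /=]; rewrite ltcE/= => /andP[/eqP b0 a0] aE.
apply: filterS (H _ a0) => h hA; apply: EP => p /hA fp.
apply: aE; rewrite /= -ball_normE /= ltcE /=; move: fp; rewrite normcBC.
by case: (g p - f h p) => x y /= ->; rewrite b0 eqxx.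
Qed.

Lemma uniform_cvg_norm (X : choiceType) (I : Type) (F : set_system I) {FF : Filter F}
    (f : I -> X -> R) (g : X -> R) (A : set X) :
  {uniform A, f @ F --> g} ->
  forall e : R, 0 < e -> \forall h \near F, forall p, A p -> `|f h p - g p| < e.
Proof.
move=> H e e0; apply: (H [set k | forall p, A p -> `|k p - g p| < e]).
apply/uniform_nbhs.
exists [set xy | ball xy.1 e xy.2]; split.
  by rewrite -entourage_ballE; exists e.
move=> h hA p Ap; have := hA p Ap.
by rewrite /= -ball_normE /= distrC.
Qed.

End uniform_limits.

Section abelian.
Context {R : realType} {n : nat}.
Local Notation V := 'rV[R]_n.

Definition freq (z : 'rV[R[i]]_n) : 'rV[R[i]]_n := - (two_pi_i *: z).

Lemma normc_two_pi_i : normc (two_pi_i : R[i]) = 2 * pi.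
Proof.
rewrite /two_pi_i normcM normc_real ger0_norm; last by rewrite mulr_ge0// pi_ge0.
by rewrite /= expr0n expr1n add0r sqrtr1 mulr1.
Qed.

Lemma chr_freq z t : chr (freq z) t = cexp (- (two_pi_i * dotv z (cvec t))).
Proof. by rewrite /chr /freq dotvNl dotvZl. Qed.

Lemma STFT_chr psi (f : functional R n) x z :
  STFT psi f x z = f (fun t => chr (freq z) t * (psi (t - x))^*).
Proof.
by rewrite /STFT; congr f; apply/funext => t; rewrite chr_freq.
Qed.

Lemma cexp_freq z (h : V) : cexp (two_pi_i * dotv z (cvec h)) = chr (freq z) (- h).
Proof. by rewrite chr_freq cvecN dotvNr mulrN opprK. Qed.

(** Covariance of the short-time Fourier transform under translations. *)
Lemma STFT_translate psi (f : functional R n) x h z : K1_dual f -> K1 psi ->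
  chr (freq z) (- h) * STFT psi f (x + h) z =
  translate h f (fun t => chr (freq z) t * (psi (t - x))^*).
Proof.
move=> df Kpsi; rewrite STFT_chr /translate -K1_linearZ; last 2 first.
- exact: dual_linear.
- by apply: K1_chr_mul; apply: K1_conj; exact: K1_shift.
congr f; apply/funext => t; rewrite mulrA -chrDr addrC.
by rewrite opprD addrA addrAC.
Qed.

(** By uniform boundedness, smallness of the functionals on one window
    extends to a neighborhood of this window; compactness of the set of
    parameters leaves finitely many windows to consider. *)
Lemma STFT_uniform_limit (f g : functional R n) (c : V -> R) (psi : V -> R[i])
    (K : set 'rV[R[i]]_n) (L : set V) :
  (forall h, 0 < c h) -> K1_dual f -> K1_dual g -> S_asymptotic f c g -> K1 psi ->
  compact K -> compact L ->
  forall e : R, 0 < e -> \forall h \near at_infty, forall p, (K `*` L) p ->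
    normc (cexp (two_pi_i * dotv p.1 (cvec h)) *
      (STFT psi f (p.2 + h) p.1 / (c h)%:C) - STFT psi g p.2 p.1) < e.
Proof.
move=> c0 df dg fg Kpsi cK cL e e0.
pose eta t := (psi t)^*.
have Keta : K1 eta by exact: K1_conj.
pose phi (p : 'rV[R[i]]_n * V) t := chr (freq p.1) t * eta (t - p.2).
have Kphi p : K1 (phi p) by apply: K1_chr_mul; exact: K1_shift.
pose T h : functional R n := fun u => (c h)%:C^-1 * translate h f u - g u.
have dT h : K1_dual (T h) by apply: dual_sub => //; apply: dual_scale; exact: dual_translate.
have T0 u : K1 u -> forall r : R, 0 < r ->
    exists M : R, forall h, M < enorm h -> normc (T h u) < r.
  move=> Ku r r0; have /cvgc_normcP/(_ r r0)/at_infty_enorm[M HM] := fg u Ku.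
  by exists M => h /HM; rewrite /T mulrC.
have e2 : 0 < e / 2 by rewrite divr_gt0.
have [k [del [M [del0 TM]]]] := uniform_boundedness dT T0 e2.
have E p h : cexp (two_pi_i * dotv p.1 (cvec h)) *
      (STFT psi f (p.2 + h) p.1 / (c h)%:C) - STFT psi g p.2 p.1 = T h (phi p).
  by rewrite cexp_freq mulrA STFT_translate// STFT_chr /T mulrC.
have := compact_setX cK cL => /compact_near_coveringP cKL.
apply: (cKL V at_infty (fun h p => normc (cexp (two_pi_i * dotv p.1 (cvec h)) *
      (STFT psi f (p.2 + h) p.1 / (c h)%:C) - STFT psi g p.2 p.1) < e)).
move=> p0 _.
have [r r0 Hr] := modulated_translate_continuous (freq p0.1) p0.2 k Keta del0.
have [M0 HM0] := T0 _ (Kphi p0) _ e2.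
have pi2 : 0 < 2 * pi :> R by rewrite mulr_gt0// pi_gt0.
pose r' := r / (2 * pi).
have r'0 : 0 < r' by rewrite divr_gt0.
pose near_z (z : 'rV[R[i]]_n) := forall i, normc (z 0 i - p0.1 0 i) <= r'.
have n1 : nbhs p0.1 near_z.
  apply/nbhs_ballP; exists r'%:C; first by rewrite /= ltcR.
  move=> z [_ zb] i; have := zb 0 i; rewrite -ball_normE /= ltcE => /andP[_].
  by rewrite normcBC; case: (p0.1 0 i - z 0 i) => x y /= /ltW.
have zfreq z : near_z z -> forall i, normc (freq z 0 i - freq p0.1 0 i) <= r.
  move=> hz i; rewrite !mxE -opprD normcN -mulrBr normcM normc_two_pi_i.
  by rewrite mulrC -ler_pdivlMr.
have n2 : \forall x \near p0.2, `|x - p0.2| <= r.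
  apply/nbhs_ballP; exists r => // x; rewrite mx_norm_ball /= distrC; exact: ltW.
exists ([set p : 'rV[R[i]]_n * V | near_z p.1 /\
    `|p.2 - p0.2| <= r], [set h | Num.max M M0 < enorm h]); last first.
  move=> [p h] /= [[hp1 hp2]]; rewrite gt_max => /andP[Mh M0h].
  rewrite E; have := TM _ _ (K1B (Kphi p) (Kphi p0)) (Hr (freq p.1) p.2 (zfreq _ hp1) hp2) Mh.
  have := HM0 _ M0h.
  rewrite (K1_linearB (dual_linear (dT h)))//.
  have := normc_le_sub (T h (phi p)) (T h (phi p0)).
  by move=> h1 h2 h3; apply: le_lt_trans h1 _; rewrite (splitr e) ltrD.
split; last by exists (Num.max M M0).
by exists (near_z, [set x | `|x - p0.2| <= r]).
Qed.

End abelian.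

(** * Lebesgue measure on R^n *)

Section affine_invariance.
Context {R : realType}.
Local Notation lambda := (@lebesgue_measure R).

Definition pushmeas d1 d2 (T1 : measurableType d1) (T2 : measurableType d2)
    (m : {measure set T1 -> \bar R}) (f : T1 -> T2) (mf : measurable_fun setT f) :
    {measure set T2 -> \bar R} :=
  measure_function_pushforward__canonical__measure_function_Measure m mf.

Lemma measurable_affine1 (s y : R) :
  measurable_fun setT (fun t : measurableTypeR R => (s * t + y : measurableTypeR R)).
Proof. by apply: measurable_funD => //; exact: measurable_funM. Qed.

(** A measure on the line is determined by the half-open intervals. *)
Lemma lebesgue_affine1 (s y : R) (A : set (measurableTypeR R)) : s != 0 -> measurable A ->
  (`|s|%:E * lambda ((fun t => (s * t + y)%R) @^-1` A))%E = lambda A.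
Proof.
move=> s0 mA.
pose m : {measure set (measurableTypeR R) -> \bar R} :=
  mscale (NngNum (normr_ge0 s)) (pushmeas lambda (measurable_affine1 s y)).
rewrite [RHS](@lebesgue_measure_unique _ m)//.
move=> _ [[a b] _ <-] /=; rewrite /m /= /mscale /= /pushmeas /= /pushforward /=.
have [s_gt0|s_lt0|/eqP] := ltgtP s 0; last by rewrite (negbTE s0).
- have -> : (fun t => s * t + y) @^-1` `]a, b] = `[(b - y) / s, (a - y) / s[%classic.
    apply/seteqP; split => t /=; rewrite !in_itv/=.
      by rewrite ler_ndivrMr// ltr_ndivlMr// mulrC; lra.
    by rewrite ler_ndivrMr// ltr_ndivlMr// mulrC; lra.
  rewrite !lebesgue_measure_itv /= !lte_fin ltr_nM2r ?invr_lt0// ltrBlDr subrK.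
  case: ifPn => ab; last by rewrite mule0.
  rewrite ltr0_norm// -!EFinB -EFinM; congr EFin; field.
  by [].
- have -> : (fun t => s * t + y) @^-1` `]a, b] = `](a - y) / s, (b - y) / s]%classic.
    apply/seteqP; split => t /=; rewrite !in_itv/=.
      by rewrite ler_pdivlMr// ltr_pdivrMr// mulrC; lra.
    by rewrite ler_pdivlMr// ltr_pdivrMr// mulrC; lra.
  rewrite !lebesgue_measure_itv /= !lte_fin ltr_pM2r ?invr_gt0// ltrBlDr subrK.
  case: ifPn => ab; last by rewrite mule0.
  rewrite gtr0_norm// -!EFinB -EFinM; congr EFin; field.
  by [].
Qed.

Lemma measurable_affine n (s : R) (x : 'rV[R]_n) :
  measurable_fun setT (fun t : 'rV[R]_n => s *: t + x).
Proof.
apply: measurable_fun_rV => i.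
rewrite (_ : (fun _ => _) = (fun t : 'rV[R]_n => s * t 0 i + x 0 i)).
  by apply: measurable_funD => //; apply: measurable_funM => //; exact: measurable_coord.
by apply/funext => t; rewrite !mxE.
Qed.

(** By induction on the dimension: a product measure is determined by its
    values on rectangles, where the one-dimensional case applies. *)
Lemma lebesgue_affine n (s : R) (x : 'rV[R]_n) (A : set 'rV[R]_n) :
  s != 0 -> measurable A ->
  ((`|s| ^+ n)%:E * lebesgue_rV n ((fun t : 'rV[R]_n => (s *: t + x)%R) @^-1` A))%E = lebesgue_rV n A.
Proof.
move=> s0; elim: n x A => [|n IH] x A mA.
  rewrite expr0 mul1e; congr (lebesgue_rV 0 _).
  by apply/seteqP; split => t /=; rewrite (_ : s *: t + x = t)//; apply/rowP => -[].
have mc : measurable (@rV_cons R n @^-1` A).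
  by rewrite -[X in measurable X]setTI; exact: measurable_rV_cons.
pose x' : 'rV[R]_n := \row_i x 0 (lift ord0 i).
pose g (p : measurableTypeR R * 'rV[R]_n) : measurableTypeR R * 'rV[R]_n :=
  ((s * p.1 + x 0 ord0)%R, s *: p.2 + x').
have mg : measurable_fun setT g.
  apply/measurable_fun_pairP; split.
    exact: (measurableT_comp (measurable_affine1 s (x 0 ord0)) measurable_fst).
  exact: (measurableT_comp (measurable_affine s x') measurable_snd).
have gE : @rV_cons R n @^-1` ((fun t : 'rV[R]_n.+1 => s *: t + x) @^-1` A) = g @^-1` (@rV_cons R n @^-1` A).
  apply/seteqP; split => p /=; rewrite (_ : s *: @rV_cons R n p + x = @rV_cons R n (g p))//;
    apply/rowP => i; rewrite !mxE; case: (unliftP ord0 i) => [j ->|->] //=;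
    rewrite ?liftK ?unlift_none /=; rewrite ?mxE//.
have sn0 : 0 <= `|s| ^+ n.+1 by rewrite exprn_ge0.
pose P : {measure set (measurableTypeR R * 'rV[R]_n) -> \bar R} :=
  (lambda \x lebesgue_rV n)%E.
pose m : {measure set (measurableTypeR R * 'rV[R]_n) -> \bar R} :=
  mscale (NngNum sn0) (pushmeas P mg).
rewrite /= /lebesgue_rVS /pushforward gE.
rewrite [RHS](@product_measure_unique _ _ _ _ _ lambda (lebesgue_rV n) m)//.
move=> B C mB mC; rewrite /m /= /mscale /= /pushforward.
have -> : g @^-1` (B `*` C) =
  ((fun t => (s * t + x 0 ord0)%R) @^-1` B) `*` ((fun t : 'rV[R]_n => s *: t + x') @^-1` C) by [].
have mB' : measurable ((fun t => (s * t + x 0 ord0)%R) @^-1` B : set (measurableTypeR R)).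
  by rewrite -[X in measurable X]setTI; exact: measurable_affine1.
have mC' : measurable ((fun t : 'rV[R]_n => s *: t + x') @^-1` C).
  by rewrite -[X in measurable X]setTI; exact: measurable_affine.
rewrite /P /= product_measure1E// -(IH x' C mC) -(@lebesgue_affine1 s (x 0 ord0) B s0 mB).
by rewrite exprS EFinM !muleA; congr (_ * _)%E; rewrite muleAC.
Qed.

End affine_invariance.

Section change_of_variables.
Context {R : realType} d {T : measurableType d} (mu : {measure set T -> \bar R}).
Context (phi : T -> T) (mphi : measurable_fun setT phi) (k : R) (k0 : 0 < k).
Hypothesis mu_phi : forall A, measurable A -> (k%:E * mu (phi @^-1` A))%E = mu A.

Lemma ge0_integral_cov (f : T -> \bar R) : measurable_fun setT f ->
  (forall x, 0 <= f x)%E -> (k%:E * \int[mu]_x f (phi x) = \int[mu]_x f x)%E.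
Proof.
move=> mf f0.
pose m : {measure set T -> \bar R} := mscale (NngNum (ltW k0)) (pushmeas mu mphi).
rewrite [RHS](@eq_measure_integral _ _ _ setT m).
  rewrite [RHS]ge0_integral_mscale//=; congr (_ * _)%E.
  by rewrite [RHS](@ge0_integral_pushforward _ _ _ _ _ _ mphi).
by move=> A mA _; rewrite -mu_phi.
Qed.

Lemma integrable_cov (f : T -> R) : mu.-integrable setT (EFin \o f) ->
  mu.-integrable setT (EFin \o (f \o phi)).
Proof.
move=> /integrableP[mf fi]; apply/integrableP; split.
  exact: (measurableT_comp mf mphi).
have mab : measurable_fun setT (fun x => `|(f x)%:E|%E) by exact: measurableT_comp.
have cov := ge0_integral_cov mab (fun x => abse_ge0 _).
rewrite -[X in (X < +oo)%E]/(\int[mu]_x `|(f (phi x))%:E|)%E.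
rewrite -(@lte_pmul2l _ k%:E)// ?lte_fin// gt0_muley ?lte_fin//.
by rewrite cov.
Qed.

Lemma Rintegral_cov (f : T -> R) : mu.-integrable setT (EFin \o f) ->
  k * (\int[mu]_x f (phi x))%R = (\int[mu]_x f x)%R.
Proof.
move=> fi; have fi' := integrable_cov fi.
have mf : measurable_fun setT (EFin \o f) by case/integrableP : fi.
rewrite /Rintegral.
have h1 : (\int[mu]_x (f x)%:E)%E \is a fin_num by exact: (integrable_fin_num measurableT fi).
have h2 : (\int[mu]_x (f (phi x))%:E)%E \is a fin_num by exact: (integrable_fin_num measurableT fi').
have -> : k * fine (\int[mu]_x (f (phi x))%:E)%E =
    fine (k%:E * \int[mu]_x (f (phi x))%:E)%E by rewrite fineM.
congr fine; rewrite [RHS]integralE [X in (k%:E * X)%E]integralE.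
have p1 := ge0_integral_cov (measurable_funepos mf) (fun x => funepos_ge0 _ x).
have p2 := ge0_integral_cov (measurable_funeneg mf) (fun x => funeneg_ge0 _ x).
rewrite -[X in (_ = X - _)%E]p1 -[X in (_ = _ - X)%E]p2.
rewrite muleBr//; first last.
  by rewrite fin_num_adde_defl// fin_numN; exact: (integrable_neg_fin_num measurableT fi').
have ep : (fun x => (f (phi x))%:E)^\+%E = fun x => ((EFin \o f)^\+%E (phi x)).
  by apply/funext => x; rewrite !funeposE.
have en : (fun x => (f (phi x))%:E)^\-%E = fun x => ((EFin \o f)^\-%E (phi x)).
  by apply/funext => x; rewrite !funenegE.
by rewrite ep en.
Qed.

Lemma cint_cov (F : T -> R[i]) (q : T -> R) : mu.-integrable setT (EFin \o q) ->
  tame q F -> k%:C * cint mu (fun x => F (phi x)) = cint mu F.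
Proof.
move=> iq tF; apply: complexP; rewrite ?cReM ?cImM /= mul0r ?subr0 ?addr0.
- exact: Rintegral_cov (tame_re iq tF).
- exact: Rintegral_cov (tame_im iq tF).
Qed.

End change_of_variables.

Section weight.
Context {R : realType}.
Local Notation lambda := (@lebesgue_measure R).

Let w1 (x : R) : R := (1 + x ^+ 2)^-1.

Let w1_ge0 x : 0 <= w1 x.
Proof. by rewrite invr_ge0 addr_ge0// sqr_ge0. Qed.

Let mw1 : measurable_fun setT w1.
Proof.
apply: continuous_measurable_fun => x.
apply: (@continuousV _ _ (fun x : R => 1 + x ^+ 2)).
  by rewrite gt_eqF// ltr_pwDl// sqr_ge0.
exact: (@continuous_oneDsqr R x).
Qed.

(** The half line contributes [pi / 2], by the arctangent, and the other
    half is its reflection. *)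
Lemma w1_lty : (\int[lambda]_x (w1 x)%:E < +oo)%E.
Proof.
have m1 : measurable_fun setT (fun x : measurableTypeR R => (w1 x)%:E) by exact/measurable_EFinP.
pose I : set (measurableTypeR R) := `[0%R, +oo[%classic.
have mI : measurable I by exact: measurable_itv.
have hI : (\int[lambda]_x (((w1 x)%:E) * (\1_I x)%:E) = (pi / 2)%:E)%E.
  rewrite -integral0y_oneDsqr [RHS]integral_mkcond; apply: eq_integral => x _.
  rewrite patchE indicE /I; case: ifPn => xI; first by rewrite mule1.
  by rewrite mule0.
have mg : measurable_fun setT (fun x : measurableTypeR R => ((w1 x)%:E * (\1_I x)%:E)%E).
  by apply: emeasurable_funM => //; apply/measurable_EFinP; exact: measurable_indic.
have g0 x : (0 <= (w1 x)%:E * (\1_I x)%:E)%E by rewrite mule_ge0// lee_fin.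
have N1 : (-1 : R) != 0 by rewrite oppr_eq0 oner_eq0.
have maff := measurable_affine1 (-1) (0 : R).
have k0 : 0 < `|-1 : R| by rewrite normr_gt0.
have hN := ge0_integral_cov maff k0 (fun A mA => lebesgue_affine1 0 N1 mA) mg g0.
rewrite normrN1 mul1e hI in hN.
have : (\int[lambda]_x (w1 x)%:E <= \int[lambda]_x
   ((w1 x)%:E * (\1_I x)%:E + (w1 (-1 * x + 0)%R)%:E * (\1_I (-1 * x + 0)%R)%:E))%E.
  apply: ge0_le_integral => //.
  - by move=> x _; rewrite lee_fin.
  - apply: emeasurable_funD => //.
    exact: (measurableT_comp mg maff).
  - move=> x _; rewrite !indicE !addr0 mulN1r.
    have -> : w1 (- x) = w1 x by rewrite /w1 sqrrN.
    rewrite -!EFinM -EFinD lee_fin -mulrDr ler_peMr//.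
    have [x0|x0] := leP 0 x.
      have -> : x \in I by rewrite inE /I /= in_itv/= x0.
      by rewrite lerDl.
    have -> : - x \in I by rewrite inE /I /= in_itv/= andbT oppr_ge0 ltW.
    by rewrite lerDr.
move=> /le_lt_trans; apply.
rewrite ge0_integralD//; last exact: (measurableT_comp mg maff).
by rewrite hI hN lte_add_pinfty// ltry.
Qed.

(** A weight in product form, so that its integral reduces to the line. *)
Definition qweight n (x : 'rV[R]_n) : R := \prod_(i < n) w1 (x 0 i).

Lemma qweight_ge0 n (x : 'rV[R]_n) : 0 <= qweight x.
Proof. by apply: prodr_ge0. Qed.

Lemma measurable_qweight n : measurable_fun setT (@qweight n).
Proof.
apply: measurable_prod => i _.
exact: (measurableT_comp mw1 (measurable_coord i)).
Qed.

Lemma qweight_cons n (p : measurableTypeR R * 'rV[R]_n) :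
  qweight (rV_cons p) = w1 p.1 * qweight p.2.
Proof.
rewrite /qweight big_ord_recl mxE unlift_none/=; congr (_ * _).
by apply: eq_bigr => i _; rewrite mxE liftK.
Qed.

Lemma integral_lebesgue_rVS n (f : 'rV[R]_n.+1 -> \bar R) : measurable_fun setT f ->
  (forall x, 0 <= f x)%E ->
  (\int[lebesgue_rV n.+1]_x f x =
   \int[lambda]_a \int[lebesgue_rV n]_v f (rV_cons (a, v)))%E.
Proof.
move=> mf f0.
pose P : {measure set (measurableTypeR R * 'rV[R]_n) -> \bar R} :=
  (lambda \x lebesgue_rV n)%E.
rewrite (@eq_measure_integral _ _ _ setT (pushmeas P (@measurable_rV_cons R n)))//.
rewrite (@ge0_integral_pushforward _ _ _ _ _ _ (@measurable_rV_cons R n))//.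
rewrite [LHS](@fubini_tonelli1 _ _ _ _ _ lambda (lebesgue_rV n) (f \o @rV_cons R n))//.
  exact: (measurableT_comp mf (@measurable_rV_cons R n)).
by move=> x; exact: f0.
Qed.

Lemma qweight_integrable n : (lebesgue_rV n).-integrable setT (EFin \o @qweight n).
Proof.
apply/integrableP; split; first by apply/measurable_EFinP; exact: measurable_qweight.
rewrite (eq_integral (fun x => (qweight x)%:E)); last first.
  by move=> x _ /=; rewrite ger0_norm ?qweight_ge0.
elim: n => [|n IH].
  rewrite (eq_integral (cst 1%E)); last first.
    by move=> x _; rewrite /qweight big_ord0.
  by rewrite integral_cst//= mul1e /lebesgue_rV0 diracT ltry.
rewrite integral_lebesgue_rVS; last 2 first.
- by apply/measurable_EFinP; exact: measurable_qweight.
- by move=> x; rewrite lee_fin qweight_ge0.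
pose K := (\int[lebesgue_rV n]_x (qweight x)%:E)%E.
have K0 : (0 <= K)%E by apply: integral_ge0 => x _; rewrite lee_fin qweight_ge0.
rewrite (eq_integral (fun a : measurableTypeR R => (w1 a)%:E * K)%E); last first.
  move=> a _; rewrite -ge0_integralZl//; last 3 first.
  - by apply/measurable_EFinP; exact: measurable_qweight.
  - by move=> x _; rewrite lee_fin qweight_ge0.
  - by rewrite lee_fin.
  by apply: eq_integral => v _; rewrite qweight_cons EFinM.
have KE : K = (fine K)%:E by rewrite fineK// ge0_fin_numE.
rewrite ge0_integralZr//; last 2 first.
- exact/measurable_EFinP.
- by move=> x _; rewrite lee_fin.
have I0 : (0 <= \int[lambda]_x (w1 x)%:E)%E by apply: integral_ge0 => x _; rewrite lee_fin.
have Ifin : (\int[lambda]_x (w1 x)%:E)%E \is a fin_num.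
  by rewrite ge0_fin_numE//; exact: w1_lty.
exact: (lte_mul_pinfty I0 Ifin IH).
Qed.

(** Decay of order [2 * n] is domination by the weight. *)
Lemma qweight_ge n (x : 'rV[R]_n) : ((1 + `|x|) ^+ (2 * n))^-1 <= qweight x.
Proof.
have -> : ((1 + `|x|) ^+ (2 * n))^-1 = \prod_(i < n) ((1 + `|x|) ^+ 2)^-1.
  by rewrite prodr_const card_ord exprM exprVn.
apply: ler_prod => i _; rewrite invr_ge0 exprn_ge0 ?addr_ge0//=.
rewrite lef_pV2 ?posrE ?exprn_gt0 ?ltr_pwDl ?sqr_ge0//.
have := coord_le_norm x i; rewrite -[x 0 i ^+ 2]real_normK ?num_real// => h.
rewrite sqrrD expr1n mul1r -addrA lerD2l ler_wpDl ?mulrn_wge0//.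
by rewrite ler_sqr ?nnegrE.
Qed.

Lemma lebesgue_rV_setT_gt0 n : (0 < lebesgue_rV n [set: 'rV[R]_n])%E.
Proof.
elim: n => [|n IH]; first by rewrite /= /lebesgue_rV0 diracT lte_fin.
rewrite /= /lebesgue_rVS /pushforward preimage_setT -setXTT.
have pos : (0 < (@lebesgue_measure R) [set: R])%E.
  by rewrite -(set_itvNyy R) lebesgue_measure_itv ltry.
by rewrite product_measure1E// mule_gt0.
Qed.

End weight.

(** * Grids and families of test functions indexed by R^n *)

Section grid.
Context {R : realType} {n : nat}.
Local Notation V := 'rV[R]_n.
Implicit Types (m : nat) (x : V).

(** The cells have side [1 / (m + 1)] and cover the cube of radius [m + 1]. *)
Definition grid m : finType := {ffun 'I_n -> 'I_(2 * m.+1 ^ 2).+1}.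

Let scaled m x i : R := m.+1%:R * x 0 i + (m.+1 ^ 2)%:R.

Definition cell m (j : grid m) : set V :=
  [set x | forall i, (j i)%:R <= scaled m x i < (j i).+1%:R].

Definition corner m (j : grid m) : V :=
  \row_i (((j i)%:R - (m.+1 ^ 2)%:R) / m.+1%:R).

Lemma cell_corner m (j : grid m) x : cell j x -> `|corner j - x| <= m.+1%:R^-1.
Proof.
move=> jx; apply: norm_le_coord; first by rewrite invr_ge0.
move=> i; have /andP[h1 h2] := jx i; rewrite !mxE.
have m0 : (0 : R) < m.+1%:R by rewrite ltr0n.
rewrite -(ler_pM2l m0) divff ?gt_eqF// -[X in X * `|_|]gtr0_norm// -normrM mulrBr.
rewrite mulrCA divff ?gt_eqF// mulr1 ler_norml.
by move: h1 h2; rewrite /scaled -[(j i).+1]addn1 natrD; lra.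
Qed.

Lemma cell_inj m (j j' : grid m) x : cell j x -> cell j' x -> j = j'.
Proof.
move=> jx j'x; apply/ffunP => i; apply/val_inj => /=.
have /andP[h1 h2] := jx i; have /andP[h3 h4] := j'x i.
have := le_lt_trans h1 h4; have := le_lt_trans h3 h2.
by rewrite !ltr_nat !ltnS => a b; apply/eqP; rewrite eqn_leq a b.
Qed.

Lemma cell_cover m x : `|x| <= m.+1%:R -> exists j : grid m, cell j x.
Proof.
move=> xm; have m0 : (0 : R) < m.+1%:R by rewrite ltr0n.
have xi i : - (m.+1 ^ 2)%:R <= m.+1%:R * x 0 i <= (m.+1 ^ 2)%:R.
  rewrite -ler_norml normrM gtr0_norm// natrX expr2 ler_wpM2l ?(ltW m0)//.
  exact: le_trans (coord_le_norm x i) xm.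
have s0 i : 0 <= scaled m x i by have /andP[] := xi i; rewrite /scaled; lra.
have sK i : (Num.truncn (scaled m x i) < (2 * m.+1 ^ 2).+1)%N.
  have h : (Num.truncn (scaled m x i))%:R <= scaled m x i by rewrite truncn_le.
  rewrite ltnS -(ler_nat R) (le_trans h)// natrM.
  by have /andP[] := xi i; rewrite /scaled; lra.
exists [ffun i => Ordinal (sK i)] => i; rewrite ffunE /=.
by rewrite truncn_le s0 truncnS_gt.
Qed.

Lemma measurable_cell m (j : grid m) : measurable (cell j).
Proof.
have -> : cell j = \bigcap_(i in [set: 'I_n])
    ((fun x : V => scaled m x i) @^-1` `[(j i)%:R, (j i).+1%:R[%classic).
  apply/seteqP; split => x /= h i; first by move=> _; rewrite /= in_itv; exact: (h i).
  by have := h i Logic.I; rewrite /= in_itv.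
apply: fin_bigcap_measurable => // i _.
rewrite -[X in measurable X]setTI.
have ms : measurable_fun setT (fun x : V => scaled m x i).
  by apply: measurable_funD => //; apply: measurable_funM => //; exact: measurable_coord.
exact: ms.
Qed.

Definition cell_ind m (j : grid m) x : R[i] := (\1_(cell j) x : R)%:C.

Lemma cmeas_cell_ind m (j : grid m) : cmeas (@cell_ind m j).
Proof.
split; last exact: measurable_cst.
by apply: measurable_indic; exact: measurable_cell.
Qed.

Lemma grid_case m x :
  (exists j : grid m, cell j x /\
     forall v : grid m -> R[i], \sum_j cell_ind j x * v j = v j) \/
  (m.+1%:R < `|x| /\ forall v : grid m -> R[i], \sum_j cell_ind j x * v j = 0).
Proof.
have [[j jx]|nj] := pselect (exists j : grid m, cell j x).
  left; exists j; split=> // v; rewrite (bigD1 j)//= big1 ?addr0.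
    by rewrite /cell_ind indicE mem_set// mul1r.
  move=> j' j'j; rewrite /cell_ind indicE memNset ?mul0r// => j'x.
  by move: j'j; rewrite (cell_inj jx j'x) eqxx.
right; split.
  by rewrite ltNge; apply/negP => xm; apply: nj; exact: cell_cover.
move=> v; rewrite big1// => j _; rewrite /cell_ind indicE memNset ?mul0r// => jx.
by apply: nj; exists j.
Qed.

(** A continuous function is the limit of its step functions on the grids. *)
Lemma continuous_cmeas (F : V -> R[i]) :
  (forall x (e : R), 0 < e -> exists2 r : R, 0 < r &
     forall y, `|y - x| <= r -> normc (F y - F x) < e) -> cmeas F.
Proof.
move=> cF; apply: (@cmeas_cvg _ _ _ (fun m x => \sum_(j : grid m) cell_ind j x * F (corner j))).
  move=> m; apply: cmeas_sum => j; apply: cmeasM; first exact: cmeas_cell_ind.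
  exact: cmeas_cst.
move=> x e e0; have [r r0 rF] := cF x e e0.
near=> m; have [[j [jx ->]]|[mx _]] := grid_case m x.
  apply: rF; rewrite (le_trans (cell_corner jx))//.
  rewrite -[r]invrK lef_pV2 ?posrE ?invr_gt0//.
  rewrite (@le_trans _ _ m%:R)// ?ler_nat//.
  near: m; exists (Num.truncn r^-1).+1 => // m /= rm.
  by rewrite ltW// (lt_le_trans (truncnS_gt _))// ler_nat.
exfalso; move: mx; apply/negP; rewrite -leNgt (@le_trans _ _ m%:R)// ?ler_nat//.
near: m; exists (Num.truncn `|x|).+1 => // m /= rm.
by rewrite ltW// (lt_le_trans (truncnS_gt _))// ler_nat.
Unshelve. all: by end_near. Qed.

End grid.

Section null_continuous.
Context {R : realType} {n : nat}.
Local Notation V := 'rV[R]_n.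

Lemma measurable_ball0 (r : R) : measurable [set x : V | `|x| <= r].
Proof.
have [m0 _] : cmeas (fun x : V => (`|x|)%:C).
  apply: continuous_cmeas => x e e0; exists (e / 2); first by rewrite divr_gt0.
  move=> y yx; rewrite -rmorphB normc_real (le_lt_trans (ler_dist_dist _ _))//.
  by rewrite (le_lt_trans yx)// ltr_pdivrMr// ltr_pMr// ltr1n.
have -> : [set x : V | `|x| <= r] = [set: V] `&` (fun x : V => `|x|) @^-1` `]-oo, r]%classic.
  by rewrite setTI; apply/seteqP; split => x /=; rewrite in_itv.
exact: m0.
Qed.

(** Were one ball null, its affine images would be null too, and they
    exhaust the space. *)
Lemma ball_not_null (x0 : V) (r : R) : 0 < r ->
  lebesgue_rV n [set x | `|x - x0| <= r] <> 0%E.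
Proof.
move=> r0 null.
have null0 (m : nat) : lebesgue_rV n [set x : V | `|x| <= m.+1%:R] = 0%E.
  have s0 : r / m.+1%:R != 0 by rewrite gt_eqF// divr_gt0.
  have mA : measurable [set x : V | `|x - x0| <= r].
    have := @measurable_affine R n 1 (- x0) measurableT _ (measurable_ball0 r).
    rewrite setTI; congr measurable; apply/seteqP; split => x /=; by rewrite scale1r.
  have := lebesgue_affine x0 s0 mA; rewrite null => /eqP.
  rewrite mule_eq0 eqe expf_eq0 normr_eq0 (negbTE s0) andbF /= => /eqP h.
  rewrite -[RHS]h.
  congr (lebesgue_rV n _); apply/seteqP; split => x /=.
    rewrite addrK normrZ gtr0_norm ?divr_gt0// mulrAC ler_pdivrMr//.
    by rewrite ler_pM2l.
  by rewrite addrK normrZ gtr0_norm ?divr_gt0// mulrAC ler_pdivrMr// ler_pM2l.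
have := lebesgue_rV_setT_gt0 (R := R) n.
have -> : [set: V] = \bigcup_m [set x : V | `|x| <= m.+1%:R].
  apply/seteqP; split => // x _; exists (Num.truncn `|x|) => //=.
  by rewrite ltW// truncnS_gt.
have : (lebesgue_rV n).-negligible (\bigcup_m [set x : V | `|x| <= m.+1%:R]).
  apply: negligible_bigcup => m; apply/negligibleP; last exact: null0.
  exact: measurable_ball0.
move=> /negligibleP -> //; first by rewrite ltxx.
by apply: bigcup_measurable => m _; exact: measurable_ball0.
Qed.

Lemma ae_zero_continuous (F : V -> R[i]) :
  (forall x (e : R), 0 < e -> exists2 r : R, 0 < r &
     forall y, `|y - x| <= r -> normc (F y - F x) < e) ->
  {ae lebesgue_rV n, forall x, F x = 0} -> forall x, F x = 0.
Proof.
move=> cF [N [mN N0 sN]] x; apply/eqP; apply: contrapT => /negP Fx.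
have e0 : 0 < normc (F x) by rewrite normc_gt0.
have [r r0 rF] := cF x _ e0.
apply: (@ball_not_null x r r0); apply/eqP; rewrite eq_le measure_ge0 andbT.
have mB : measurable [set y : V | `|y - x| <= r].
  have := @measurable_affine R n 1 (- x) measurableT _ (measurable_ball0 r).
  rewrite setTI; congr measurable; apply/seteqP; split => y /=; by rewrite scale1r.
rewrite -N0; apply: le_measure; rewrite ?inE//.
move=> y /= yx; apply: sN => /= Fy; have := rF y yx.
by rewrite Fy sub0r normcN ltxx.
Qed.

End null_continuous.

Section pettis_rV.
Context {R : realType} {n : nat}.
Local Notation V := 'rV[R]_n.
Local Notation mu := (lebesgue_rV n).
Local Notation iq := (@qweight_integrable R n).
Local Notation q0 := (@qweight_ge0 R n).

Variables (b : V -> R[i]) (Psi : V -> V -> R[i]).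
Hypotheses (mb : cmeas b) (KPsi : forall x, K1 (Psi x)).
Hypothesis b_poly : exists (D : R) (N : nat), forall x, normc (b x) <= D * (1 + `|x|) ^+ N.
Hypothesis Psi_decay : forall k, exists C : R, forall x,
  kbound k (fun t => b x * Psi x t) (C / (1 + `|x|) ^+ (2 * n).+1).
(** Step functions on a grid approximate the family: this bound controls the
    error inside the cube covered by the grid, and the excess of decay over
    the weight controls it outside. *)
Hypothesis Psi_lipschitz : forall k, exists C : R, forall x y, `|y - x| <= 1 ->
  kbound k (fun t => b x * (Psi y t - Psi x t)) (C * `|y - x| / (1 + `|x|) ^+ (2 * n)).

Let Phi x t := b x * Psi x t.
Let w m (j : grid m) (x : V) : R[i] := cell_ind j x * b x.
Arguments w : clear implicits.
Let chi m (j : grid m) := Psi (corner j).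
Arguments chi : clear implicits.

Let den_gt0 (x : V) k : 0 < (1 + `|x|) ^+ k.
Proof. by rewrite exprn_gt0// ltr_pwDl. Qed.

Let tame_w m j : tame (@qweight R n) (w m j).
Proof.
split; first by apply: cmeasM => //; exact: cmeas_cell_ind.
have [D [N bD]] := b_poly.
pose rho : R := 1 + (`|corner j| + 1).
have rho0 : 0 < rho by rewrite ltr_pwDl// addr_ge0.
exists (`|D| * rho ^+ N * rho ^+ (2 * n)) => x; rewrite /w normcM /cell_ind indicE.
have [xj|xj] := boolP (x \in cell j); last first.
  by rewrite normc0 mul0r !mulr_ge0 ?exprn_ge0 ?qweight_ge0// ltW.
rewrite normc1 mul1r.
have x1 : 1 + `|x| <= rho.
  rewrite lerD2l; have := cell_corner (set_mem xj).
  have := ler_normD (corner j) (x - corner j); rewrite addrC subrK distrC => h1 h2.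
  rewrite (le_trans h1)// lerD2l (le_trans h2)// invf_le1// ler1n//.
have r0 : 0 <= 1 + `|x| by rewrite addr_ge0.
rewrite (le_trans (bD x))// (@le_trans _ _ (`|D| * rho ^+ N))//.
  rewrite ler_pM ?exprn_ge0 ?ler_norm//; last by rewrite lerXn2r ?nnegrE// ltW.
  by have := le_trans (normc_ge0 _) (bD x); rewrite pmulr_lge0.
have hq : 1 <= rho ^+ (2 * n) * qweight x.
  rewrite (@le_trans _ _ ((1 + `|x|) ^+ (2 * n) * ((1 + `|x|) ^+ (2 * n))^-1))//.
    by rewrite divff ?gt_eqF// den_gt0.
  rewrite ler_pM ?invr_ge0 ?(ltW (den_gt0 _ _)) ?qweight_ge//.
  by rewrite lerXn2r ?nnegrE// ltW.
rewrite -[leLHS]mulr1 -[leRHS]mulrA ler_wpM2l// mulr_ge0// exprn_ge0//.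
exact: ltW.
Qed.

Let Phi_bound k : exists C : R, forall x, kbound k (Phi x) (C * qweight x).
Proof.
have [C HC] := Psi_decay k; exists `|C| => x.
apply: (kbound_le (leqnn k) _ (HC x)).
rewrite (@le_trans _ _ (`|C| / (1 + `|x|) ^+ (2 * n).+1))//.
  by rewrite ler_wpM2r ?invr_ge0 ?ler_norm// ltW.
rewrite ler_wpM2l// (le_trans _ (qweight_ge x))// lef_pV2 ?posrE//.
by rewrite exprS ler_peMl ?lerDl// ltW.
Qed.

Let Phi_error k : exists C : R, forall m x,
  kbound k (fun t => Phi x t - \sum_j w m j x * chi m j t) (C * qweight x / m.+1%:R).
Proof.
have [C HC] := Psi_decay k; have [D HD] := Psi_lipschitz k.
exists (`|C| + `|D|) => m x; have m0 : (0 : R) < m.+1%:R by rewrite ltr0n.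
have q0x := q0 x.
have sE (t : V) (v : grid m -> R[i]) : \sum_j w m j x * v j = b x * \sum_j cell_ind j x * v j.
  by rewrite mulr_sumr; apply: eq_bigr => j _; rewrite /w mulrAC mulrC mulrA.
have [[j [jx jE]]|[mx E0]] := grid_case m x.
  have -> : (fun t => Phi x t - \sum_j w m j x * chi m j t) =
      fun t => (-1) * (b x * (Psi (corner j) t - Psi x t)).
    by apply/funext => t; rewrite sE// jE /Phi /chi; ring.
  have dj := cell_corner jx.
  have dj1 : `|corner j - x| <= 1 by rewrite (le_trans dj)// invf_le1// ler1n.
  have sm : smooth (fun t => b x * (Psi (corner j) t - Psi x t)).
    by apply: (K1_smooth (K1Z _ _)); exact: K1B.
  have := kboundZ (-1) sm (HD x _ dj1); rewrite normcN normc1 mul1r.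
  apply: kbound_le => //.
  rewrite (@le_trans _ _ (`|D| * m.+1%:R^-1 * qweight x))//.
    rewrite ler_pM ?invr_ge0 ?(ltW (den_gt0 _ _)) ?qweight_ge//.
      by have := kbound_ge0 (HD x _ dj1); rewrite pmulr_lge0// invr_gt0.
    rewrite (@le_trans _ _ (`|D| * `|corner j - x|))//.
      by rewrite ler_wpM2r// ler_norm.
    by rewrite ler_wpM2l.
  by rewrite mulrAC ler_wpM2r ?invr_ge0 ?(ltW m0)// ler_wpM2r// lerDr.
have -> : (fun t => Phi x t - \sum_j w m j x * chi m j t) = Phi x.
  by apply/funext => t; rewrite sE// E0 mulr0 subr0.
apply: (kbound_le (leqnn k) _ (HC x)).
rewrite (@le_trans _ _ (`|C| / (1 + `|x|) ^+ (2 * n).+1))//.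
  by rewrite ler_wpM2r ?invr_ge0 ?ler_norm// ltW.
rewrite -[leRHS]mulrA ler_pM ?invr_ge0 ?(ltW (den_gt0 _ _))//; first by rewrite lerDl.
rewrite exprSr invfM ler_pM ?invr_ge0 ?(ltW (den_gt0 _ _)) ?qweight_ge ?addr_ge0//.
by rewrite lef_pV2 ?posrE ?ltr_pwDl// (le_trans (ltW mx))// lerDr.
Qed.

Lemma functional_pettis_rV (F : functional R n) : K1_dual F ->
  tame (@qweight R n) (fun x => b x * F (Psi x)) /\
  F (fun t => cintegral (fun x => b x * Psi x t)) = cintegral (fun x => b x * F (Psi x)).
Proof.
move=> dF; have KPhi x : K1 (Phi x) by exact: K1Z.
have Kc m j : K1 (chi m j) by exact: KPsi.
have E : (fun x => F (Phi x)) = fun x => b x * F (Psi x).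
  by apply/funext => x; rewrite /Phi (K1_linearZ _ (dual_linear dF)).
have [h1 h2] := functional_pettis q0 iq KPhi Phi_bound tame_w Kc Phi_error dF.
by rewrite E in h1 h2.
Qed.

End pettis_rV.

(** * Integration and the Fourier transform on K_1 *)

Section integration.
Context {R : realType} {n : nat}.
Local Notation V := 'rV[R]_n.
Local Notation q := (@qweight R n).
Local Notation iq := (@qweight_integrable R n).
Local Notation Q := (qmass (lebesgue_rV n) q).
Implicit Types (u v : V -> R[i]) (t x y xi : V) (k N : nat).

Lemma Q_ge0 : 0 <= Q. Proof. exact/qmass_ge0/qweight_ge0. Qed.

Lemma den_gt0 x k : 0 < (1 + `|x|) ^+ k.
Proof. by rewrite exprn_gt0// ltr_pwDl. Qed.

Lemma expRN_le_den N x : expR (- (N%:R * `|x|)) <= ((1 + `|x|) ^+ N)^-1.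
Proof.
rewrite expRN lef_pV2 ?posrE ?expR_gt0 ?den_gt0// expRM_natl.
by rewrite lerXn2r ?nnegrE ?expR_ge0 ?addr_ge0// expR_ge1Dx.
Qed.

Lemma expRN_le_qweight N x : (2 * n <= N)%N -> expR (- (N%:R * `|x|)) <= q x.
Proof.
move=> nN; rewrite (le_trans _ (qweight_ge x))// (le_trans _ (expRN_le_den (2 * n) x))//.
by rewrite ler_expR lerN2 ler_wpM2r// ler_nat.
Qed.

Lemma kbound_normc N u B t : kbound N u B -> normc (u t) <= B * expR (- (N%:R * `|t|)).
Proof. by move=> h; exact: jet_bound_normc (h t). Qed.

Lemma K1_lipschitz u : K1 u -> exists2 C : R, 0 <= C & forall x y,
  normc (u y - u x) <= C * `|y - x|.
Proof.
move=> Ku; have [B uB] := K1_kbound 1 Ku; have B0 := kbound_ge0 uB.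
exists (2 * (n%:R * B)) => [|x y]; first by rewrite !mulr_ge0.
have := @smooth_mean_value _ _ u x (y - x) B (K1_smooth Ku).
rewrite (addrC x) subrK => h; apply: le_trans (h _) _.
  move=> r i _; have := uB (x + r *: (y - x)) [:: i] isT.
  rewrite cpderiv_cons cpderiv_nil => /le_trans; apply; rewrite ler_piMr//.
by rewrite le_eqVlt; apply/orP; left; apply/eqP; ring.
Qed.

Lemma lipschitz_continuous (F : V -> R[i]) (C : R) : 0 <= C ->
  (forall x y, normc (F y - F x) <= C * `|y - x|) ->
  forall x (e : R), 0 < e -> exists2 r : R, 0 < r &
     forall y, `|y - x| <= r -> normc (F y - F x) < e.
Proof.
move=> C0 FC x e e0; have C1 : 0 < C + 1 by rewrite ltr_wpDl.
exists (e / (C + 1)); first by rewrite divr_gt0.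
move=> y yx; rewrite (le_lt_trans (FC x y))// (le_lt_trans (ler_wpM2l C0 yx))//.
by rewrite mulrCA gtr_pMr// ltr_pdivrMr// mul1r ltrDl.
Qed.

Lemma K1_continuous u : K1 u -> forall x (e : R), 0 < e -> exists2 r : R, 0 < r &
     forall y, `|y - x| <= r -> normc (u y - u x) < e.
Proof. by move=> Ku; have [C C0 HC] := K1_lipschitz Ku; exact: lipschitz_continuous HC. Qed.

Lemma K1_cmeas u : K1 u -> cmeas u.
Proof. by move=> Ku; apply: continuous_cmeas; exact: K1_continuous. Qed.

Lemma kbound_le_qweight u (B : R) x : kbound (2 * n) u B -> normc (u x) <= B * q x.
Proof.
move=> uB; rewrite (le_trans (kbound_normc x uB))// ler_wpM2l ?(kbound_ge0 uB)//.
exact: expRN_le_qweight.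
Qed.

Lemma K1_tame u : K1 u -> tame q u.
Proof.
move=> Ku; split; first exact: K1_cmeas.
by have [B uB] := K1_kbound (2 * n) Ku; exists B => x; exact: kbound_le_qweight.
Qed.

Lemma normc_cintegral_le u (C : R) : cmeas u -> (forall x, normc (u x) <= C * q x) ->
  normc (cintegral u) <= 2 * (C * Q).
Proof. exact: (@normc_cint_le _ _ _ _ _ iq u C). Qed.

Lemma cintegral_bound u (B : R) : K1 u -> kbound (2 * n) u B ->
  normc (cintegral u) <= 2 * Q * B.
Proof.
move=> Ku uB.
have := normc_cintegral_le (K1_cmeas Ku) (fun x => kbound_le_qweight x uB).
by rewrite (mulrC B) mulrA.
Qed.

(** With the integral as the functional, the exchange of functionals and
    integrals of test functions is the theorem of Fubini. *)
Lemma dual_integral : K1_dual (@cintegral R n).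
Proof.
apply/dualP; split.
  move=> a u v Ku Kv.
  transitivity (cintegral (fun t => a * u t) + cintegral v).
    exact: (cintD iq (tameZ a (K1_tame Ku)) (K1_tame Kv)).
  by congr (_ + _); exact: (cintZ iq a (K1_tame Ku)).
exists (2 * n)%N, (2 * Q); split; first by rewrite mulr_ge0 ?Q_ge0.
by move=> u B Ku uB; exact: cintegral_bound.
Qed.

Lemma cintegral_affine (s : R) x u : s != 0 -> tame q u ->
  (`|s| ^+ n)%:C * cintegral (fun t => u (s *: t + x)) = cintegral u.
Proof.
move=> s0 tu; have k0 : 0 < `|s| ^+ n by rewrite exprn_gt0// normr_gt0.
exact: (cint_cov (measurable_affine s x) k0 (fun A => lebesgue_affine x s0) iq tu).
Qed.

Lemma cintegral_shift x u : tame q u -> cintegral (fun t => u (t + x)) = cintegral u.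
Proof.
move=> tu; rewrite -[RHS](cintegral_affine x (oner_neq0 R) tu) normr1 expr1n mul1r.
by congr cintegral; apply/funext => t; rewrite scale1r.
Qed.

Lemma cintegral_reflect x u : tame q u -> cintegral (fun t => u (x - t)) = cintegral u.
Proof.
move=> tu; have N1 : (-1 : R) != 0 by rewrite oppr_eq0 oner_eq0.
rewrite -[RHS](cintegral_affine x N1 tu) normrN1 expr1n mul1r.
by congr cintegral; apply/funext => t; rewrite scaleN1r addrC.
Qed.

Lemma jet_bound_along N u B x y (r : R) k : kbound N u B -> (k <= N)%N ->
  `|y| <= 1 -> 0 <= r <= 1 ->
  jet_bound k u (x + r *: y) (B * expR N%:R * expR (- (N%:R * `|x|))).
Proof.
move=> uB kN y1 /andP[r0 r1]; have B0 := kbound_ge0 uB.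
have := kbound_jet (x + r *: y) uB kN (leqnn N); apply: jet_bound_le => //.
rewrite -mulrA ler_wpM2l// (le_trans (expR_shift _ _ _))// ler_wpM2r ?expR_ge0//.
by rewrite ler_expR ler_piMr// normrZ ger0_norm// mulr_ile1.
Qed.

Lemma K1_cD i u : K1 u -> K1 (cD i u).
Proof.
move=> Ku; apply/K1P; split=> [|N]; first exact/smooth_cD/K1_smooth.
have [B uB] := K1_kbound N.+1 Ku; exists B => t.
have [_ h] := (jet_boundS _ _ _ _).1 (uB t).
apply: jet_bound_le (leqnn N) _ (h i); rewrite ler_wpM2l ?(kbound_ge0 uB)//.
by rewrite ler_expR lerN2 ler_wpM2r// ler_nat.
Qed.

(** The translates of [u] have the same integral, and differentiating them
    under the integral sign costs only a second order remainder. *)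
Lemma cintegral_cD i u : K1 u -> cintegral (cD i u) = 0.
Proof.
move=> Ku; pose N := (2 * n).+2.
have [B uB] := K1_kbound N Ku; have B0 := kbound_ge0 uB.
pose C := 2 * (2 * (n%:R * (n%:R * (B * expR N%:R))) * Q).
have C0 : 0 <= C by rewrite !mulr_ge0 ?expR_ge0 ?Q_ge0.
have main (e : R) : 0 < e <= 1 -> normc (cintegral (cD i u)) <= C * e.
  move=> /andP[e0 e1].
  pose w : V := e *: delta_mx 0 i.
  have w1 : `|w| <= e.
    apply: norm_le_coord; first exact: ltW.
    move=> j; rewrite !mxE eqxx /= normrM gtr0_norm// ler_piMr ?(ltW e0)//.
    by case: (j == i); rewrite ?normr1 ?normr0.
  have tu := K1_tame Ku; have tD := K1_tame (K1_cD i Ku).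
  have ts := K1_tame (K1_shift w Ku).
  have E : e%:C * cintegral (cD i u) =
      - cintegral (fun t => u (t + w) - u t - e%:C * cD i u t).
    have -> : cintegral (fun t => u (t + w) - u t - e%:C * cD i u t) =
        cintegral (fun t => u (t + w)) - cintegral u - e%:C * cintegral (cD i u).
      transitivity (cintegral (fun t => u (t + w) - u t) - cintegral (fun t => e%:C * cD i u t)).
        exact: (cintB iq (tameB ts tu) (tameZ e%:C tD)).
      by congr (_ - _); [exact: (cintB iq ts tu)|exact: (cintZ iq e%:C tD)].
    by rewrite (cintegral_shift w tu) subrr sub0r opprK.
  have h : normc (cintegral (fun t => u (t + w) - u t - e%:C * cD i u t)) <=
      2 * (2 * (n%:R * e * (n%:R * e * (B * expR N%:R))) * Q).
    apply: normc_cintegral_le.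
      by have [] := tameB (tameB ts tu) (tameZ e%:C tD).
    move=> t.
    have -> : e%:C * cD i u t = \sum_j (w 0 j)%:C * cD j u t.
      rewrite (bigD1 i)//= big1 ?addr0; first by rewrite !mxE !eqxx mulr1.
      by move=> j ji; rewrite !mxE (negbTE ji) andbF mulr0 mul0r.
    have w1' : `|w| <= 1 by exact: le_trans w1 e1.
    have tb r : 0 <= r <= 1 -> jet_bound 2 u (t + r *: w)
        (B * expR N%:R * expR (- (N%:R * `|t|))) by exact: jet_bound_along.
    apply: le_trans (smooth_taylor2 (K1_smooth Ku) tb) _.
    have qt : expR (- (N%:R * `|t|)) <= q t by apply: expRN_le_qweight; rewrite /N !leqW.
    rewrite -!mulrA ler_wpM2l//.
    rewrite (_ : n%:R * (`|w| * (n%:R * (`|w| * (B * (expR N%:R * expR (- (N%:R * `|t|))))))) =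
      (n%:R * (`|w| * (n%:R * (`|w| * (B * expR N%:R))))) * expR (- (N%:R * `|t|))); last by ring.
    rewrite (_ : n%:R * (e * (n%:R * (e * (B * (expR N%:R * q t))))) =
      (n%:R * (e * (n%:R * (e * (B * expR N%:R))))) * q t); last by ring.
    rewrite ler_pM ?mulr_ge0 ?expR_ge0//.
    rewrite ler_wpM2l// ler_pM ?mulr_ge0 ?expR_ge0//.
    by rewrite ler_wpM2l// ler_wpM2r ?mulr_ge0 ?expR_ge0.
  have := congr1 (@normc R) E; rewrite normcN normcM normc_real gtr0_norm// => E'.
  rewrite -(ler_pM2l e0) E' (le_trans h)// /C.
  by rewrite le_eqVlt; apply/orP; left; apply/eqP; ring.
apply: eq0_normc; apply/eqP; rewrite eq_le normc_ge0 andbT.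
apply/ler_addgt0Pr => e e0; rewrite add0r.
pose r := Num.min 1 (e / (C + 1)); have C1 : 0 < C + 1 by rewrite ltr_wpDl.
have r0 : 0 < r by rewrite lt_min ltr01 divr_gt0.
have r1 : 0 < r <= 1 by rewrite r0 ge_min lexx.
rewrite (le_trans (main r r1))// (@le_trans _ _ (C * (e / (C + 1))))//.
  by rewrite ler_wpM2l// ge_min lexx orbT.
by rewrite mulrCA ler_piMr ?(ltW e0)// ler_pdivrMr// mul1r lerDl.
Qed.

End integration.

(** * Waves and superpositions of test functions *)

Section waves.
Context {R : realType} {n : nat}.
Local Notation V := 'rV[R]_n.
Implicit Types (u v : V -> R[i]) (t x y xi : V) (k N : nat) (F : functional R n).

Definition wave xi t : R[i] := chr (freq (cvec xi)) t.

Lemma waveE xi t : wave xi t = cexp (- (two_pi_i * (dotv xi t)%:C)).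
Proof. by rewrite /wave chr_freq dotv_cvec. Qed.

Lemma waveC xi t : wave xi t = wave t xi.
Proof. by rewrite !waveE dotvC. Qed.

Lemma waveDr xi t x : wave xi (t + x) = wave xi t * wave xi x.
Proof. exact: chrDr. Qed.

Lemma wave0l t : wave 0 t = 1.
Proof. by rewrite waveC /wave chr0r. Qed.

Lemma waveZ (s : R) xi t : wave (s *: xi) t = wave xi (s *: t).
Proof. by rewrite !waveE dotvZl dotvZr. Qed.

Lemma waveNl xi t : wave (- xi) t = wave xi (- t).
Proof. by rewrite !waveE dotvNl dotvNr. Qed.

Lemma waveN_conj xi t : wave (- xi) t = (wave xi t)^*.
Proof.
rewrite !waveE cexp_conj dotvNl; congr cexp.
by apply: complexP; rewrite /two_pi_i /=; ring.
Qed.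

Lemma normc_wave xi t : normc (wave xi t) = 1.
Proof.
rewrite waveE normc_cexp (_ : complex.Re _ = 0) ?expR0//.
by rewrite /two_pi_i /=; ring.
Qed.

Lemma wave_grows xi t : normc (wave xi t) <= expR (0%:R * `|t|).
Proof. by rewrite normc_wave mul0r expR0. Qed.

Lemma freq_sub xi x i : freq (cvec xi) 0 i - freq (cvec x) 0 i = freq (cvec (xi - x)) 0 i.
Proof.
rewrite /freq !mxE (rmorphB (real_complex R)) mulrBr.
by rewrite opprK opprB addrC.
Qed.

Lemma normc_freq xi i : normc (freq (cvec xi) 0 i) = 2 * pi * `|xi 0 i|.
Proof. by rewrite /freq /cvec !mxE normcN normcM normc_two_pi_i normc_real. Qed.

Lemma normc_freq_le xi i : normc (freq (cvec xi) 0 i) <= 2 * pi * `|xi|.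
Proof. by rewrite normc_freq ler_wpM2l ?mulr_ge0 ?pi_ge0// coord_le_norm. Qed.

Lemma cD_wave xi i : cD i (wave xi) = fun t => freq (cvec xi) 0 i * wave xi t.
Proof. exact: cD_chr. Qed.

Lemma K1_wave xi u : K1 u -> K1 (fun t => wave xi t * u t).
Proof. exact: K1_chr_mul. Qed.

Lemma dual_wave_continuous F u : K1_dual F -> K1 u -> forall xi (e : R), 0 < e ->
  exists2 r : R, 0 < r & forall x, `|x - xi| <= r ->
    normc (F (fun t => wave x t * u t) - F (fun t => wave xi t * u t)) < e.
Proof.
move=> dF Ku xi e e0; have [N [C [C0 FC]]] := dual_bounded dF.
have C1 : 0 < C + 1 by rewrite ltr_wpDl.
have e1 : 0 < e / (C + 1) by rewrite divr_gt0.
have [r r0 rP] := modulated_translate_continuous (freq (cvec xi)) 0 N Ku e1.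
have P0 : 0 < 2 * pi :> R by rewrite mulr_gt0 ?pi_gt0.
exists (r / (2 * pi)); first by rewrite divr_gt0.
move=> x xxi; rewrite -(K1_linearB (dual_linear dF)) //; try exact: K1_wave.
have h i : normc (freq (cvec x) 0 i - freq (cvec xi) 0 i) <= r.
  by rewrite freq_sub (le_trans (normc_freq_le _ _))// mulrC -ler_pdivlMr.
have r1 : `|0 - 0 : V| <= r by rewrite subrr normr0 ltW.
have := rP (freq (cvec x)) 0 h r1; under eq_fun do rewrite !subr0.
move=> /FC FB; apply: le_lt_trans (FB _) _; first exact: K1B (K1_wave _ Ku) (K1_wave _ Ku).
by rewrite mulrCA gtr_pMr// ltr_pdivrMr// mul1r ltrDl.
Qed.

Lemma cmeas_dual_wave F u : K1_dual F -> K1 u -> cmeas (fun xi => F (fun t => wave xi t * u t)).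
Proof. by move=> dF Ku; apply: continuous_cmeas; exact: dual_wave_continuous. Qed.

Lemma kbound_freq_mul k xi u (A B : R) : K1 u -> kbound k u B -> 1 <= A ->
  2 * pi * `|xi| <= A -> kbound k (fun t => wave xi t * u t) (2 ^+ k * (A ^+ k * B)).
Proof.
move=> Ku uB A1 xA.
apply: (kbound_chr_mul (m := 0) A1 _ (wave_grows xi) (K1_smooth Ku)); last by rewrite addn0.
by move=> i; exact: le_trans (normc_freq_le _ _) xA.
Qed.

(** When the frequencies are far apart, the bounds of the two terms are
    already linear in their distance. *)
Lemma kbound_freq_diff k xi x u (A B : R) : K1 u -> kbound (k + n.+1) u B -> 1 <= A ->
  2 * pi * `|xi| <= A -> 2 * pi * `|x| <= A ->
  kbound k (fun t => (wave xi t - wave x t) * u t)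
    (2 ^+ k * (2 ^+ k * (A ^+ k * ((2 * n%:R + 2) * (2 * pi * `|xi - x|))) * B)).
Proof.
move=> Ku uB A1 xiA xA; have A0 : 0 <= A by exact: le_trans ler01 A1.
have B0 := kbound_ge0 uB; set d := 2 * pi * _.
have d0 : 0 <= d by rewrite !mulr_ge0 ?pi_ge0.
have nu i : normc (freq (cvec x) 0 i) <= A by exact: le_trans (normc_freq_le _ _) xA.
have [d1|/ltW d1] := leP d 1.
  have d01 : 0 <= d <= 1 by rewrite d0.
  have hd i : normc (freq (cvec xi) 0 i - freq (cvec x) 0 i) <= d.
    by rewrite freq_sub normc_freq_le.
  apply: kbound_le (leqnn k) _
    (@kbound_chr_diff R n k 0 _ _ u A B d A1 nu (wave_grows x) d01 hd (K1_smooth Ku) _).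
    rewrite ler_wpM2l ?exprn_ge0// ler_wpM2r// ler_wpM2l ?exprn_ge0// ler_wpM2l ?exprn_ge0//.
    by rewrite ler_wpM2r// lerD2l ler1n.
  by rewrite add0n.
under eq_fun do rewrite mulrBl.
have uB' : kbound k u B by apply: kbound_le uB; rewrite ?leq_addr.
apply: kbound_le (leqnn k) _ (kboundB (K1_smooth (K1_wave xi Ku)) (K1_smooth (K1_wave x Ku))
  (kbound_freq_mul Ku uB' A1 xiA) (kbound_freq_mul Ku uB' A1 xA)).
rewrite -mulrDr ler_wpM2l ?exprn_ge0//.
rewrite (_ : A ^+ k * B + A ^+ k * B = 1 * (A ^+ k * (2 * 1)) * B); last by ring.
rewrite ler_wpM2r// ler_pM ?mulr_ge0 ?exprn_ge0 ?exprn_ege1 ?ler1n//.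
rewrite ler_wpM2l ?exprn_ge0// ler_pM//.
by rewrite lerDr mulr_ge0.
Qed.

End waves.

Section wave_superposition.
Context {R : realType} {n : nat}.
Local Notation V := 'rV[R]_n.
Variables (b : V -> R[i]) (u : V -> R[i]) (s : R).
Hypotheses (mb : cmeas b) (Ku : K1 u) (s1 : `|s| <= 1).
Hypothesis b_decay : forall N, exists B : R, forall x : V,
  normc (b x) <= B / (1 + `|x|) ^+ N.

Let W : R := 2 * (1 + 2 * pi).
Let W1 : 1 <= W.
Proof. by have := pi_ge0 R; rewrite /W; lra. Qed.

Let freq_le (x y : V) : `|y - x| <= 1 -> 2 * pi * `|s *: y| <= W * (1 + `|x|).
Proof.
move=> yx; have y2 : `|s *: y| <= 1 + `|x|.
  rewrite normrZ (le_trans (ler_piMl _ s1))//.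
  by rewrite -[y in leLHS](subrK x) (le_trans (ler_normD _ _))// lerD2r.
have h : 2 * pi <= W by have := pi_ge0 R; rewrite /W; lra.
by rewrite ler_pM ?mulr_ge0 ?pi_ge0.
Qed.

Let A1 (x : V) : 1 <= W * (1 + `|x|).
Proof. by rewrite mulr_ege1// lerDl. Qed.

Let superposition_decay k : exists C : R, forall x,
  kbound k (fun t => b x * (wave (s *: x) t * u t)) (C / (1 + `|x|) ^+ (2 * n).+1).
Proof.
have [B uB] := K1_kbound k Ku; have [D bD] := b_decay (k + (2 * n).+1).
exists (D * (2 ^+ k * (W ^+ k * B))) => x.
have xx : `|x - x| <= 1 by rewrite subrr normr0.
have h := kbound_freq_mul Ku uB (A1 x) (freq_le xx).
apply: kbound_le (leqnn k) _ (kboundZ (b x) (K1_smooth (K1_wave _ Ku)) h).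
apply: (@le_trans _ _ (D / (1 + `|x|) ^+ (k + (2 * n).+1) *
    (2 ^+ k * ((W * (1 + `|x|)) ^+ k * B)))).
  by rewrite ler_wpM2r ?bD// (kbound_ge0 h).
have d0 := den_gt0 x; rewrite exprD exprMn.
rewrite le_eqVlt; apply/orP; left; apply/eqP.
move: (gt_eqF (d0 k)) (gt_eqF (d0 (2 * n).+1)) => /negbT + /negbT.
move: ((1 + `|x|) ^+ k) ((1 + `|x|) ^+ (2 * n).+1) (W ^+ k) => X Y Z X0 Y0.
by field; rewrite ?X0 ?Y0.
Qed.

Let superposition_lipschitz k : exists C : R, forall x y, `|y - x| <= 1 ->
  kbound k (fun t => b x * (wave (s *: y) t * u t - wave (s *: x) t * u t))
    (C * `|y - x| / (1 + `|x|) ^+ (2 * n)).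
Proof.
have [B uB] := K1_kbound (k + n.+1) Ku; have [D bD] := b_decay (k + 2 * n).
exists (D * (2 ^+ k * (2 ^+ k * (W ^+ k * ((2 * n%:R + 2) * (2 * pi))) * B))) => x y yx.
have xx : `|x - x| <= 1 by rewrite subrr normr0.
have h := kbound_freq_diff Ku uB (A1 x) (freq_le yx) (freq_le xx).
have E : (fun t => b x * (wave (s *: y) t * u t - wave (s *: x) t * u t)) =
    fun t => b x * ((wave (s *: y) t - wave (s *: x) t) * u t).
  by apply/funext => t; rewrite mulrBl.
have su : smooth (fun t => (wave (s *: y) t - wave (s *: x) t) * u t).
  apply: K1_smooth; rewrite (_ : (fun t => _) = fun t =>
    wave (s *: y) t * u t - wave (s *: x) t * u t); first exact: K1B (K1_wave _ Ku) (K1_wave _ Ku).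
  by apply/funext => t; rewrite mulrBl.
rewrite E; apply: kbound_le (leqnn k) _ (kboundZ (b x) su h).
rewrite -scalerBr normrZ.
apply: (@le_trans _ _ (D / (1 + `|x|) ^+ (k + 2 * n) *
    (2 ^+ k * (2 ^+ k * ((W * (1 + `|x|)) ^+ k * ((2 * n%:R + 2) * (2 * pi * `|y - x|))) * B)))).
  apply: ler_pM (normc_ge0 _) _ (bD x) _.
    by rewrite -normrZ scalerBr (kbound_ge0 h).
  rewrite ler_wpM2l ?exprn_ge0// ler_wpM2r ?(kbound_ge0 uB)// ler_wpM2l ?exprn_ge0//.
  rewrite ler_wpM2l ?exprn_ge0 ?(le_trans ler01 (A1 x))// ler_wpM2l ?addr_ge0 ?mulr_ge0//.
  by rewrite ler_wpM2l ?mulr_ge0 ?pi_ge0// ler_piMl.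
have d0 := den_gt0 x; rewrite exprD exprMn.
rewrite le_eqVlt; apply/orP; left; apply/eqP.
move: (gt_eqF (d0 k)) (gt_eqF (d0 (2 * n)%N)) => /negbT + /negbT.
move: ((1 + `|x|) ^+ k) ((1 + `|x|) ^+ (2 * n)) `|y - x| => X Y Z X0 Y0.
by field; rewrite ?X0 ?Y0.
Qed.

Let b_poly : exists (D : R) (N : nat), forall x, normc (b x) <= D * (1 + `|x|) ^+ N.
Proof.
by have [D bD] := b_decay 0; exists D, 0 => x; have := bD x; rewrite !expr0 divr1 mulr1.
Qed.

Let Kwave (x : V) : K1 (fun t => wave (s *: x) t * u t).
Proof. exact: K1_wave. Qed.

(** The norms of [wave xi * u] grow polynomially in [xi], which the decay
    of [b] absorbs. *)
Lemma functional_pettis_wave (F : functional R n) : K1_dual F ->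
  tame (@qweight R n) (fun x => b x * F (fun t => wave (s *: x) t * u t)) /\
  F (fun t => cintegral (fun x => b x * (wave (s *: x) t * u t))) =
  cintegral (fun x => b x * F (fun t => wave (s *: x) t * u t)).
Proof.
exact: (functional_pettis_rV mb Kwave b_poly superposition_decay superposition_lipschitz).
Qed.

End wave_superposition.

Section localization.
Context {R : realType} {n : nat}.
Local Notation V := 'rV[R]_n.
Local Notation q := (@qweight R n).
Implicit Types (z u v phi theta : V -> R[i]) (t x y : V) (k N : nat) (F : functional R n).

(** Where [t] is close to the translated factor, [phi] is small:
    [|x| <= |t - x| + |t|]. *)
Lemma kbound_localize k N z phi (A B : R) x : smooth z -> smooth phi ->
  kbound N z B -> kbound (k + N) phi A -> (k <= N)%N ->
  kbound k (fun t => z (t - x) * phi t) (2 ^+ k * (B * expR (- (N%:R * `|x|)) * A)).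
Proof.
move=> sz sp zB pA kN; have B0 := kbound_ge0 zB.
apply: (kbound_mul (smooth_shift (- x) sz) sp pA (leqnn _)).
  by rewrite mulr_ge0 ?expR_ge0.
move=> t; apply/jet_bound_shift.
have := kbound_jet (t - x) zB kN (leqnn N); apply: jet_bound_le => //.
have := expR_shift N (- x) t; rewrite normrN (addrC (- x)) => h.
by rewrite -mulrA ler_wpM2l// [leRHS]mulrC.
Qed.

Section instance.
Variables (z phi : V -> R[i]).
Hypotheses (Kz : K1 z) (Kphi : K1 phi).

Let Psi x t := z (t - x) * phi t.

Let KPsi x : K1 (Psi x).
Proof. by apply: K1M => //; exact: K1_shift. Qed.

Let expR_den N m x (B C : R) : 0 <= B -> 0 <= C -> (m <= N)%N ->
  B * expR (- (N%:R * `|x|)) * C <= B * C / (1 + `|x|) ^+ m.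
Proof.
move=> B0 C0 mN; rewrite -mulrA (mulrC (expR _)) mulrA ler_wpM2l ?mulr_ge0//.
rewrite (le_trans _ (expRN_le_den m x))// ler_expR lerN2 ler_wpM2r//.
by rewrite ler_nat.
Qed.

Let decay k : exists C : R, forall x,
  kbound k (fun t => 1 * Psi x t) (C / (1 + `|x|) ^+ (2 * n).+1).
Proof.
have [B zB] := K1_kbound (k + (2 * n).+1) Kz.
have [A pA] := K1_kbound (k + (k + (2 * n).+1)) Kphi.
exists (2 ^+ k * (B * A)) => x; under eq_fun do rewrite mul1r.
apply: kbound_le (leqnn k) _
  (kbound_localize x (K1_smooth Kz) (K1_smooth Kphi) zB pA (leq_addr _ _)).
rewrite -[leRHS]mulrA ler_wpM2l ?exprn_ge0//.
by apply: expR_den (kbound_ge0 zB) (kbound_ge0 pA) _; rewrite leq_addl.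
Qed.

Let lipschitz k : exists C : R, forall x y, `|y - x| <= 1 ->
  kbound k (fun t => 1 * (Psi y t - Psi x t)) (C * `|y - x| / (1 + `|x|) ^+ (2 * n)).
Proof.
have [B zB] := K1_kbound (k + 2 * n).+1 Kz; have B0 := kbound_ge0 zB.
have [A pA] := K1_kbound (k + (k + 2 * n)) Kphi; have A0 := kbound_ge0 pA.
exists (2 ^+ k * (2 * (n%:R * (B * expR (k + 2 * n).+1%:R)) * A)) => x y yx.
have v1 : `|x - y| <= 1 by rewrite distrC.
have := kbound_shift_diff (K1_smooth Kz) zB v1.
have sd : smooth (fun t => z (t + (x - y)) - z t).
  exact/K1_smooth/K1B/Kz/K1_shift.
move=> /(kbound_localize x sd (K1_smooth Kphi)) /(_ pA (leq_addr _ _)).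
have -> : (fun t => (z (t - x + (x - y)) - z (t - x)) * phi t) =
    fun t => 1 * (Psi y t - Psi x t).
  by apply/funext => t; rewrite mul1r /Psi addrA subrK mulrBl.
apply: kbound_le => //; rewrite -!(mulrA (2 ^+ k)) ler_wpM2l ?exprn_ge0//.
rewrite (distrC x) (_ : 2 * (n%:R * `|y - x| * (B * expR (k + 2 * n).+1%:R)) =
  2 * (n%:R * (B * expR (k + 2 * n).+1%:R)) * `|y - x|); last by ring.
set E := 2 * (n%:R * _).
have E0 : 0 <= E by rewrite !mulr_ge0 ?expR_ge0.
rewrite (le_trans (expR_den _ _ _ (leq_addl k (2 * n))))// ?mulr_ge0//.
by rewrite (mulrAC E).
Qed.

Let one_poly : exists (D : R) (N : nat), forall x : V,
  normc (1 : R[i]) <= D * (1 + `|x|) ^+ N.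
Proof. by exists 1, 0%N => x; rewrite expr0 mulr1 normc1. Qed.

(** The translates of one function form a continuous partition of unity. *)
Lemma dual_localize F : K1_dual F ->
  tame q (fun x => F (fun t => z (t - x) * phi t)) /\
  cintegral z * F phi = cintegral (fun x => F (fun t => z (t - x) * phi t)).
Proof.
move=> dF.
have [h1 h2] := functional_pettis_rV (cmeas_cst (1 : R[i])) KPsi one_poly decay lipschitz dF.
have E : (fun x => 1 * F (Psi x)) = fun x => F (fun t => z (t - x) * phi t).
  by apply/funext => x; rewrite mul1r.
rewrite E in h1 h2; split=> //; rewrite -h2 -(K1_linearZ _ (dual_linear dF))//.
congr F; apply/funext => t; rewrite mulrC.
have tz : tame q (fun x => z (t - x)).
  split; last first.
    have [B zB] := K1_kbound (2 * n) Kz; have B0 := kbound_ge0 zB.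
    exists (B * expR ((2 * n)%:R * `|t|)) => x.
    rewrite (le_trans (kbound_normc (t - x) zB))// -mulrA ler_wpM2l//.
    rewrite addrC (le_trans (expR_shift _ _ _))// ler_wpM2l ?expR_ge0//.
    by rewrite normrN expRN_le_qweight.
  apply: continuous_cmeas; have [C C0 zC] := K1_lipschitz Kz.
  apply: (lipschitz_continuous C0) => x y; rewrite (le_trans (zC _ _))//.
  by rewrite opprB addrC addrA subrK distrC.
rewrite -(cintegral_reflect t (K1_tame Kz)).
transitivity (cintegral (fun x => phi t * z (t - x))).
  by apply/esym; exact: (@cintZ _ _ _ _ _ (@qweight_integrable R n) (phi t) _ tz).
by congr cintegral; apply/funext => x; rewrite mul1r mulrC.
Qed.

End instance.

Section convolution.
Variables (theta phi : V -> R[i]).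
Hypotheses (Ktheta : K1 theta) (Kphi : K1 phi).

Let Psi x t := phi (t - x).

Let KPsi x : K1 (Psi x).
Proof. exact: K1_shift. Qed.

Let theta_den k m x (A B : R) : kbound (k + m) theta B -> 0 <= A ->
  normc (theta x) * (A * expR (k%:R * `|x|)) <= B * A / (1 + `|x|) ^+ m.
Proof.
move=> tB A0; have B0 := kbound_ge0 tB.
apply: (@le_trans _ _ (B * expR (- ((k + m)%:R * `|x|)) * (A * expR (k%:R * `|x|)))).
  by rewrite ler_wpM2r ?(kbound_normc x tB)// mulr_ge0 ?expR_ge0.
rewrite mulrACA ler_wpM2l ?mulr_ge0// -expRD natrD mulrDl opprD addrAC addNr add0r.
exact: expRN_le_den.
Qed.

Let decay k : exists C : R, forall x,
  kbound k (fun t => theta x * Psi x t) (C / (1 + `|x|) ^+ (2 * n).+1).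
Proof.
have [B tB] := K1_kbound (k + (2 * n).+1) Ktheta; have [A pA] := K1_kbound k Kphi.
exists (B * A) => x.
apply: kbound_le (leqnn k) _ (kboundZ (theta x) (K1_smooth (KPsi x)) (kbound_shift (- x) pA)).
by rewrite normrN; apply: theta_den => //; exact: kbound_ge0 pA.
Qed.

Let lipschitz k : exists C : R, forall x y, `|y - x| <= 1 ->
  kbound k (fun t => theta x * (Psi y t - Psi x t)) (C * `|y - x| / (1 + `|x|) ^+ (2 * n)).
Proof.
have [B tB] := K1_kbound (k + 2 * n) Ktheta; have [A pA] := K1_kbound k.+1 Kphi.
have A0 := kbound_ge0 pA.
exists (B * (2 * (n%:R * (A * expR k.+1%:R)))) => x y yx.
have v1 : `|x - y| <= 1 by rewrite distrC.
have := kbound_shift (- x) (kbound_shift_diff (K1_smooth Kphi) pA v1).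
have E : (fun t => phi (t - x + (x - y)) - phi (t - x)) = fun t => Psi y t - Psi x t.
  by apply/funext => t; rewrite /Psi addrA subrK.
rewrite E => h; apply: kbound_le (leqnn k) _ (kboundZ (theta x) _ h).
  rewrite normrN (le_trans (theta_den x tB _))//.
    by rewrite !mulr_ge0 ?expR_ge0.
  rewrite (distrC x) le_eqVlt; apply/orP; left; apply/eqP.
  by ring.
exact/K1_smooth/K1B/KPsi/KPsi.
Qed.

Let theta_poly : exists (D : R) (N : nat), forall x, normc (theta x) <= D * (1 + `|x|) ^+ N.
Proof.
have [B tB] := K1_kbound 0 Ktheta; exists B, 0%N => x.
by rewrite expr0 (le_trans (kbound_normc x tB))// mul0r oppr0 expR0.
Qed.

Definition convolution t : R[i] := cintegral (fun x => theta x * phi (t - x)).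

Lemma dual_convolution F : K1_dual F ->
  tame q (fun x => theta x * F (fun t => phi (t - x))) /\
  F convolution = cintegral (fun x => theta x * F (fun t => phi (t - x))).
Proof. exact: functional_pettis_rV (K1_cmeas Ktheta) KPsi theta_poly decay lipschitz F. Qed.

Lemma tame_convolution t : tame q (fun x => theta x * phi (t - x)).
Proof.
split.
  apply: cmeasM; first exact: K1_cmeas.
  apply: continuous_cmeas; have [C C0 pC] := K1_lipschitz Kphi.
  apply: (lipschitz_continuous C0) => x y; rewrite (le_trans (pC _ _))//.
  by rewrite opprB addrC addrA subrK distrC.
have [B tB] := K1_kbound (2 * n) Ktheta; have [A pA] := K1_kbound 0 Kphi.
exists (B * A) => x; rewrite normcM mulrAC ler_pM ?normc_ge0//.
  exact: kbound_le_qweight.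
by rewrite (le_trans (kbound_normc _ pA))// mul0r oppr0 expR0 mulr1.
Qed.

End convolution.

Lemma convolutionC theta phi : K1 theta -> K1 phi ->
  convolution theta phi = convolution phi theta.
Proof.
move=> Kt Kp; apply/funext => t.
rewrite /convolution -(cintegral_reflect t (tame_convolution Kt Kp t)).
by congr cintegral; apply/funext => x; rewrite subKr mulrC.
Qed.

End localization.

(** * Fourier inversion up to a constant *)

Section ift.
Context {R : realType} {n : nat}.
Local Notation V := 'rV[R]_n.
Local Notation q := (@qweight R n).
Local Notation iq := (@qweight_integrable R n).
Local Notation Q := (qmass (lebesgue_rV n) q).
Implicit Types (a u v rho : V -> R[i]) (t x y xi : V) (k N : nat).

Lemma eq_cintegral u v : (forall x, u x = v x) -> cintegral u = cintegral v.
Proof. by move=> uv; congr cintegral; exact/funext. Qed.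

Lemma cintegral_dilate (s : R) u : s != 0 -> tame q u ->
  (`|s| ^+ n)%:C * cintegral (fun t => u (s *: t)) = cintegral u.
Proof.
move=> s0 tu; rewrite -[RHS](cintegral_affine 0 s0 tu).
have -> // : cintegral (fun t => u (s *: t)) = cintegral (fun t => u (s *: t + 0)).
by apply: eq_cintegral => t; rewrite addr0.
Qed.

Lemma cmeas_wave xi : cmeas (wave xi).
Proof.
apply: continuous_cmeas.
pose B := 2 * pi * `|xi|; have B0 : 0 <= B by rewrite mulr_ge0// mulr_ge0 ?pi_ge0.
apply: (@lipschitz_continuous _ _ _ (2 * (n%:R * B))) => [|x y].
  by rewrite mulr_ge0// mulr_ge0.
have := @smooth_mean_value _ _ (wave xi) x (y - x) B (@smooth_chr R n _).
rewrite (addrC x) subrK => h; apply: le_trans (h _) _.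
  by move=> r i _; rewrite cD_wave normcM normc_wave mulr1 normc_freq_le.
by rewrite le_eqVlt; apply/orP; left; apply/eqP; ring.
Qed.

Definition ift a xi : R[i] := cintegral (fun t => wave (- xi) t * a t).

Lemma kbound_cD N i u (B : R) : kbound N.+1 u B -> kbound N (cD i u) B.
Proof.
move=> uB t; have [_ h] := (jet_boundS _ _ _ _).1 (uB t).
apply: jet_bound_le (leqnn N) _ (h i); rewrite ler_wpM2l ?(kbound_ge0 uB)//.
by rewrite ler_expR lerN2 ler_wpM2r// ler_nat.
Qed.

Lemma normc_ift_le a (B : R) xi : K1 a -> kbound (2 * n) a B -> normc (ift a xi) <= 2 * (B * Q).
Proof.
move=> Ka aB; apply: normc_cintegral_le; first exact/K1_cmeas/K1_wave.
by move=> t; rewrite normcM normc_wave mul1r kbound_le_qweight.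
Qed.

(** Integration by parts: the integral of a derivative vanishes. *)
Lemma ift_cD a i xi : K1 a -> ift (cD i a) xi = - freq (cvec (- xi)) 0 i * ift a xi.
Proof.
move=> Ka; have sw := @smooth_chr R n (freq (cvec (- xi))).
have Kw := K1_wave (- xi) Ka; have KD := K1_wave (- xi) (K1_cD i Ka).
have := cintegral_cD i Kw.
rewrite (cD_mul i (smooth_cdiff sw) (smooth_cdiff (K1_smooth Ka))) cD_wave.
set z := freq _ 0 i.
rewrite (_ : (fun t => _) = fun t => z * (wave (- xi) t * a t) + wave (- xi) t * cD i a t); last first.
  by apply/funext => t; rewrite mulrA.
move=> h; have : z * ift a xi + ift (cD i a) xi = 0.
  rewrite -[RHS]h; transitivity (cintegral (fun t => z * (wave (- xi) t * a t)) + ift (cD i a) xi).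
    by congr (_ + _); apply/esym; exact: (cintZ iq z (K1_tame Kw)).
  by apply/esym; exact: (cintD iq (tameZ z (K1_tame Kw)) (K1_tame KD)).
by move/eqP; rewrite addr_eq0 mulNr => /eqP ->; rewrite opprK.
Qed.

Lemma ift_coord_decay N i a (B : R) xi : K1 a -> kbound (N + 2 * n) a B ->
  `|xi 0 i| ^+ N * normc (ift a xi) <= 2 * (B * Q).
Proof.
elim: N a => [|N IH] a Ka aB; first by rewrite mul1r normc_ift_le.
have := IH _ (K1_cD i Ka) (kbound_cD i aB); apply: le_trans.
rewrite ift_cD// normcM normcN normc_freq mxE normrN exprSr -mulrA.
rewrite ler_wpM2l ?exprn_ge0// ler_wpM2r ?normc_ge0// ler_peMl//.
by have := pi_ge2 R; lra.
Qed.

(** The coordinate of [xi] of largest modulus is gained as a factor with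
    every derivative in its direction. *)
Lemma ift_decay N a (B : R) xi : K1 a -> kbound (N + 2 * n) a B ->
  normc (ift a xi) <= 2 ^+ N * (2 * (B * Q)) / (1 + `|xi|) ^+ N.
Proof.
move=> Ka aB; rewrite ler_pdivlMr ?den_gt0// mulrC.
have B0 := kbound_ge0 aB; have BQ : 0 <= 2 * (B * Q) by rewrite !mulr_ge0 ?Q_ge0.
have [x1|/ltW x1] := leP `|xi| 1.
  rewrite ler_pM ?normc_ge0 ?exprn_ge0 ?addr_ge0//.
    by rewrite lerXn2r ?nnegrE ?addr_ge0// -[leRHS]natr1 lerD2l.
  by apply: normc_ift_le => //; apply: kbound_le aB; rewrite ?leq_addl.
have x0 : `|xi| != 0 by rewrite gt_eqF// (lt_le_trans ltr01).
have [[i0 j] /= xj] := mx_norm_neq0 x0; rewrite ord1 in xj.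
have {}xj : `|xi| = `|xi 0 j| by [].
apply: (@le_trans _ _ (2 ^+ N * (`|xi 0 j| ^+ N * normc (ift a xi)))).
  rewrite mulrA -exprMn -xj ler_wpM2r ?normc_ge0//.
  by rewrite lerXn2r ?nnegrE ?addr_ge0 ?mulr_ge0// mulr2n mulrDl mul1r lerD2r.
by rewrite ler_wpM2l ?exprn_ge0// ift_coord_decay.
Qed.

Lemma ift_rapid a : K1 a -> forall N, exists B : R, forall xi,
  normc (ift a xi) <= B / (1 + `|xi|) ^+ N.
Proof.
move=> Ka N; have [B aB] := K1_kbound (N + 2 * n) Ka.
by exists (2 ^+ N * (2 * (B * Q))) => xi; exact: ift_decay.
Qed.

Lemma ift_continuous a : K1 a -> forall xi (e : R), 0 < e -> exists2 r : R, 0 < r &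
  forall x, `|x - xi| <= r -> normc (ift a x - ift a xi) < e.
Proof.
move=> Ka xi e e0.
have [r r0 h] := dual_wave_continuous (@dual_integral R n) Ka (- xi) e0.
by exists r => // x xxi; apply: h; rewrite -opprD normrN.
Qed.

Lemma rapid_tame a : cmeas a ->
  (forall N, exists B : R, forall xi, normc (a xi) <= B / (1 + `|xi|) ^+ N) -> tame q a.
Proof.
move=> ma ha; split=> //; have [B aB] := ha (2 * n)%N; exists B => x.
apply: le_trans (aB x) _; rewrite ler_wpM2l ?qweight_ge//.
by have := le_trans (normc_ge0 _) (aB 0); rewrite normr0 addr0 expr1n divr1.
Qed.

Lemma cmeas_ift a : K1 a -> cmeas (ift a).
Proof. by move=> Ka; apply: continuous_cmeas; exact: ift_continuous. Qed.

Lemma ift_tame a : K1 a -> tame q (ift a).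
Proof. by move=> Ka; apply: rapid_tame; [exact: cmeas_ift|exact: ift_rapid]. Qed.

(** Up to a change of variables, both sides are the double integral of
    [rho (e * xi) * wave (- xi) t * a t];
    the dilation will shrink one of the factors to a constant. *)
Lemma ift_dilate a rho (e : R) : 0 < e <= 1 -> K1 a -> K1 rho ->
  cintegral (fun xi => rho (e *: xi) * ift a xi) =
  cintegral (fun t => a (e *: t) * ift rho t).
Proof.
move=> /andP[e0 e1] Ka Kr; have en0 : e != 0 by rewrite gt_eqF.
have cdil u : K1 u -> cmeas (fun x => u (e *: x)).
  move=> Ku; apply: continuous_cmeas; have [C C0 uC] := K1_lipschitz Ku.
  apply: (lipschitz_continuous C0) => x y; rewrite (le_trans (uC _ _))//.
  by rewrite ler_wpM2l// -scalerBr normrZ gtr0_norm// ler_piMl// ltW.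
have rapid N : exists B : R, forall xi, normc (rho (e *: xi)) <= B / (1 + `|xi|) ^+ N.
  have [B rB] := K1_kbound N Kr; have B0 := kbound_ge0 rB.
  exists (B / e ^+ N) => xi; apply: le_trans (kbound_normc _ rB) _.
  rewrite -mulrA ler_wpM2l// (le_trans (expRN_le_den _ _))// -invfM -exprMn.
  rewrite lef_pV2 ?posrE ?den_gt0 ?exprn_gt0 ?mulr_gt0 ?ltr_pwDl//.
  rewrite lerXn2r ?nnegrE ?mulr_ge0 ?addr_ge0 ?(ltW e0)//.
  by rewrite normrZ gtr0_norm// mulrDr mulr1 lerD2r.
have N1 : `|-1 : R| <= 1 by rewrite normrN1.
have [_ E] := functional_pettis_wave (cdil rho Kr) Ka N1 rapid (@dual_integral R n).
transitivity (cintegral (fun x => rho (e *: x) * cintegral (fun t => wave (-1 *: x) t * a t))).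
  by apply: eq_cintegral => x; rewrite (_ : -1 *: x = - x)//; exact: scaleN1r.
rewrite -{}E.
have tdil t : tame q (fun x => wave (- (e^-1 *: t)) (e *: x) * rho (e *: x)).
  apply: rapid_tame => [|N].
    apply: cmeasM; last exact: cdil.
    by under eq_fun do rewrite -waveZ; exact: cmeas_wave.
  by have [B rB] := rapid N; exists B => x; rewrite normcM normc_wave mul1r.
have inner t : cintegral (fun x => rho (e *: x) * (wave (-1 *: x) t * a t)) =
    (`|e^-1| ^+ n)%:C * (a (e *: (e^-1 *: t)) * ift rho (e^-1 *: t)).
  transitivity (a t * cintegral (fun x => wave (- (e^-1 *: t)) (e *: x) * rho (e *: x))).
    transitivity (cintegral (fun x => a t * (wave (- (e^-1 *: t)) (e *: x) * rho (e *: x)))).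
      apply: eq_cintegral => x.
      have -> : wave (-1 *: x) t = wave (- (e^-1 *: t)) (e *: x).
        rewrite !waveE dotvNl !dotvZl dotvZr mulN1r (dotvC t) mulrA mulVf//.
        by rewrite mul1r.
      by rewrite mulrA [LHS]mulrC (mulrC (rho _)).
    exact: (cintZ iq (a t) (tdil t)).
  rewrite scalerA divff// scale1r.
  have tr : tame q (fun y => wave (- (e^-1 *: t)) y * rho y) by exact/K1_tame/K1_wave.
  have h : ift rho (e^-1 *: t) = (`|e| ^+ n)%:C *
      cintegral (fun x => wave (- (e^-1 *: t)) (e *: x) * rho (e *: x)).
    exact: (esym (cintegral_dilate en0 tr)).
  rewrite h.
  have K : (`|e^-1| ^+ n)%:C * (`|e| ^+ n)%:C = 1 :> R[i].
    by rewrite -(rmorphM (real_complex R)) -exprMn -normrM mulVf// normr1 expr1n.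
  by rewrite (mulrCA (a t)) [RHS]mulrA K mul1r.
have tU : tame q (fun t => a (e *: t) * ift rho t).
  apply: rapid_tame => [|N]; first by apply: cmeasM; [exact: cdil|exact: cmeas_ift].
  have [A aA] := K1_kbound 0 Ka; have [B rB] := ift_rapid Kr N; exists (A * B) => x.
  rewrite normcM -mulrA ler_pM ?normc_ge0//.
  by rewrite (le_trans (kbound_normc _ aA))// mul0r oppr0 expR0 mulr1.
have ie0 : e^-1 != 0 by rewrite invr_eq0.
have tU' : tame q (fun t => a (e *: (e^-1 *: t)) * ift rho (e^-1 *: t)).
  apply: rapid_tame => [|N].
    apply: cmeasM; first by under eq_fun do rewrite scalerA mulfV// scale1r; exact: K1_cmeas.
    apply: continuous_cmeas => x r r0.
    have [s s0 sP] := ift_continuous Kr (e^-1 *: x) r0.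
    exists (e * s) => [|y yx]; first exact: mulr_gt0.
    apply: sP; rewrite -scalerBr normrZ ger0_norm ?invr_ge0 ?(ltW e0)//.
    by rewrite mulrC ler_pdivrMr// mulrC.
  have [A aA] := K1_kbound N Ka; have [B rB] := ift_rapid Kr 0; exists (A * B) => x.
  rewrite scalerA mulfV// scale1r normcM mulrAC ler_pM ?normc_ge0//.
    apply: le_trans (kbound_normc x aA) _.
    by rewrite ler_wpM2l ?(kbound_ge0 aA)// expRN_le_den.
  by have := rB (e^-1 *: x); rewrite expr0 divr1.
transitivity (cintegral (fun t => (`|e^-1| ^+ n)%:C *
    (a (e *: (e^-1 *: t)) * ift rho (e^-1 *: t)))); first exact: eq_cintegral inner.
transitivity ((`|e^-1| ^+ n)%:C * cintegral (fun t => a (e *: (e^-1 *: t)) * ift rho (e^-1 *: t))).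
  exact: (cintZ iq _ tU').
exact: cintegral_dilate ie0 tU.
Qed.

End ift.

Section inversion.
Local Opaque wave ift.
Context {R : realType} {n : nat}.
Local Notation V := 'rV[R]_n.
Local Notation q := (@qweight R n).
Local Notation iq := (@qweight_integrable R n).
Implicit Types (a u v w rho eta : V -> R[i]) (t x y xi : V) (k N : nat).

Lemma cintegral_dct (f : nat -> V -> R[i]) (g : V -> R[i]) (C : R) :
  (forall k, cmeas (f k)) -> cmeas g -> (forall k x, normc (f k x) <= C * q x) ->
  {ae lebesgue_rV n, forall x, ccvg (f ^~ x) (g x)} ->
  ccvg (fun k => cintegral (f k)) (cintegral g).
Proof. exact: (cint_dominated_cvg iq). Qed.

Lemma cintegralZ (c : R[i]) u : tame q u -> cintegral (fun t => c * u t) = c * cintegral u.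
Proof. exact: (cintZ iq). Qed.

Lemma cintegral_conj u : tame q u -> cintegral (fun t => (u t)^*) = (cintegral u)^*.
Proof.
move=> tu; rewrite /cintegral /=; congr (_ +i* _).
  by congr Rintegral; apply/funext => t; case: (u t).
rewrite -mulN1r -RintegralZl//; last exact: (tame_im iq tu).
by congr Rintegral; apply/funext => t; case: (u t) => ? ? /=; rewrite mulN1r.
Qed.

Lemma cmeas_dilate (e : R) u : K1 u -> cmeas (fun x => u (e *: x)).
Proof.
move=> Ku; apply: continuous_cmeas; have [C C0 uC] := K1_lipschitz Ku.
apply: (@lipschitz_continuous _ _ _ (C * `|e|)); first by rewrite mulr_ge0.
by move=> x y; rewrite (le_trans (uC _ _))// -scalerBr normrZ mulrA.
Qed.

(** The dilated function spreads out its value at the origin. *)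
Lemma concentrate u w : K1 u -> tame q w ->
  ccvg (fun k => cintegral (fun t => u (k.+1%:R^-1 *: t) * w t)) (u 0 * cintegral w).
Proof.
move=> Ku tw; have [mw [C wC]] := tw; have [B uB] := K1_kbound 0 Ku.
have B0 := kbound_ge0 uB.
rewrite -(cintegralZ _ tw).
apply: (@cintegral_dct _ _ (B * C)) => [k||k x|].
- by apply: cmeasM mw; exact: cmeas_dilate.
- exact: cmeasZ.
- rewrite normcM -mulrA ler_pM ?normc_ge0//.
  by rewrite (le_trans (kbound_normc _ uB))// mul0r oppr0 expR0 mulr1.
apply: aeW => x; have [D D0 uD] := K1_lipschitz Ku.
apply: (@ccvg_rate _ _ _ (D * `|x| * normc (w x))) => m.
rewrite -mulrBl normcM (mulrAC _ _ (_^-1)) ler_wpM2r ?normc_ge0//.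
rewrite (le_trans (uD _ _))// subr0 normrZ ger0_norm ?invr_ge0//.
by rewrite mulrA mulrAC.
Qed.

(** The inversion formula at the origin with a constant that is left
    implicit, from letting the dilation in [ift_dilate] tend to zero. *)
Lemma ift_exchange a rho : K1 a -> K1 rho ->
  rho 0 * cintegral (ift a) = a 0 * cintegral (ift rho).
Proof.
move=> Ka Kr.
have h1 := concentrate Kr (ift_tame Ka); have h2 := concentrate Ka (ift_tame Kr).
apply: ccvg_unique h1 _ => e e0; apply: filterS (h2 e e0) => k.
by rewrite (@ift_dilate R n a rho)// invr_gt0 ltr0n invf_le1// ler1n.
Qed.

Lemma ift_shift a x xi : K1 a -> ift (fun t => a (t + x)) xi = wave xi x * ift a xi.
Proof.
move=> Ka; have Kw := K1_wave (- xi) Ka.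
rewrite -(cintegralZ _ (K1_tame Kw)) -(cintegral_shift x (tameZ _ (K1_tame Kw))).
apply: eq_cintegral => t; rewrite waveDr.
have E : wave xi x * wave (- xi) x = 1.
  by rewrite waveNl -waveDr subrr waveC wave0l.
move: E; move: (wave xi x) (wave (- xi) x) (wave (- xi) t) (a (t + x)) => p r s b E.
have -> : p * (s * r * b) = (p * r) * (s * b) by ring.
by rewrite E mul1r.
Qed.

Lemma normsq_null v : (forall x (e : R), 0 < e -> exists2 r : R, 0 < r &
     forall y, `|y - x| <= r -> normc (v y - v x) < e) ->
  tame q (fun t => v t * (v t)^*) -> cintegral (fun t => v t * (v t)^*) = 0 ->
  forall t, v t = 0.
Proof.
move=> cv tv v0; apply: ae_zero_continuous => //.
pose g : V -> R := re (fun t => v t * (v t)^*).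
have E t : g t = normc (v t) ^+ 2.
  rewrite /g /re /=; case: (v t) => x y /=.
  by rewrite sqr_sqrtr ?addr_ge0 ?sqr_ge0//; ring.
have ir : (lebesgue_rV n).-integrable setT (EFin \o g) := tame_re iq tv.
have I0 : (\int[lebesgue_rV n]_t (g t)%:E = 0)%E.
  have fi := integrable_fin_num measurableT ir.
  rewrite -(fineK fi); congr EFin.
  by have := congr1 (@complex.Re R) v0.
have mr : measurable_fun setT (EFin \o g) := measurable_int _ ir.
have := (ae_eq_integral_abs (lebesgue_rV n) measurableT mr).1.
have -> : (\int[lebesgue_rV n]_x `|(EFin \o g) x| = 0)%E.
  rewrite -[RHS]I0; apply: eq_integral => x _; rewrite /comp gee0_abs//.
  by rewrite lee_fin E exprn_ge0 ?normc_ge0.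
move=> /(_ erefl); apply: filterS => x /(_ I) /=; rewrite E => -[] /eqP.
by rewrite sqrf_eq0 => /eqP /eq0_normc.
Qed.

(** Translations extend the formula from the origin to all points. Were the
    constant zero, pairing the formula with the conjugate of [a] would give
    [\int |ift a|^2 = 0], so that [ift a] and in particular [\int a] vanish for
    all [a]; this is absurd for [a = |eta|^2]. *)
Lemma ift_inversion : (exists eta : V -> R[i], K1 eta /\ exists t, eta t != 0) ->
  exists2 kappa : R[i], kappa != 0 & forall a t, K1 a ->
    cintegral (fun xi => ift a xi * wave xi t) = kappa * a t.
Proof.
move=> [eta [Ke [t0 et0]]].
pose rho t := eta (t + t0); have Kr : K1 rho by exact: K1_shift.
have r0 : rho 0 != 0 by rewrite /rho add0r.
pose kappa := cintegral (ift rho) / rho 0.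
have main a t : K1 a -> cintegral (fun xi => ift a xi * wave xi t) = kappa * a t.
  move=> Ka; have := ift_exchange (K1_shift t Ka) Kr.
  rewrite /= add0r => h.
  have <- : cintegral (ift (fun s => a (s + t))) = cintegral (fun xi => ift a xi * wave xi t).
    by apply: eq_cintegral => xi; rewrite ift_shift// mulrC.
  apply: (mulfI r0); rewrite h /kappa.
  by move: (cintegral (ift rho)) (rho 0) r0 => I r r0'; field.
exists kappa => //; apply/eqP => kappa0.
have ift0 a : K1 a -> forall xi, ift a xi = 0.
  move=> Ka; have Kc := K1_conj Ka.
  have s1 : `|1 : R| <= 1 by rewrite normr1.
  have [_] := functional_pettis_wave (cmeas_ift Ka) Kc s1 (ift_rapid Ka) (@dual_integral R n).
  have -> : (fun t => cintegral (fun x => ift a x * (wave (1 *: x) t * (a t)^*))) = fun=> 0.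
    apply/funext => t.
    have tw : tame q (fun xi => ift a xi * wave xi t).
      have [m [C hC]] := ift_tame Ka; split.
        by apply: cmeasM => //; under eq_fun do rewrite waveC; exact: cmeas_wave.
      by exists C => x; rewrite normcM normc_wave mulr1.
    transitivity (cintegral (fun xi => (a t)^* * (ift a xi * wave xi t))).
      by apply: eq_cintegral => x; rewrite scale1r mulrA [LHS]mulrC.
    by rewrite cintegralZ// main// kappa0 mul0r mulr0.
  have conjE xi : cintegral (fun t => wave xi t * (a t)^*) = (ift a xi)^*.
    have tw := K1_tame (K1_wave (- xi) Ka).
    have <- : cintegral (fun t => (wave (- xi) t * a t)^*) = cintegral (fun t => wave xi t * (a t)^*).
      by apply: eq_cintegral => t; rewrite rmorphM /= waveN_conj conjcK.
    exact: cintegral_conj.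
  have -> : cintegral (fun x => ift a x * cintegral (fun t => wave (1 *: x) t * (a t)^*)) =
      cintegral (fun x => ift a x * (ift a x)^*).
    by apply: eq_cintegral => x; rewrite scale1r conjE.
  rewrite (_ : cintegral (fun=> 0) = 0); last exact: (cint0 (lebesgue_rV n)).
  move=> /esym h; apply: normsq_null h; first exact: ift_continuous.
  have [B aB] := ift_rapid Ka 0.
  have [m [C hC]] := ift_tame Ka; split; first by apply: cmeasM => //; exact: cmeas_conj.
  exists (B * C) => x; rewrite normcM normc_conj -mulrA ler_pM ?normc_ge0//.
  by have := aB x; rewrite expr0 divr1.
have Kz : K1 (fun t => eta t * (eta t)^*) by apply: K1M => //; exact: K1_conj.
have z0 : cintegral (fun t => eta t * (eta t)^*) = 0.
  rewrite -(ift0 _ Kz 0); apply: eq_cintegral => t.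
  by rewrite oppr0 wave0l mul1r.
have := normsq_null (K1_continuous Ke) (K1_tame Kz) z0 t0.
by apply/eqP.
Qed.

End inversion.

(** * Comparison functions of exponential type *)

Section slow_variation.
Context {R : realType} {n : nat}.
Local Notation V := 'rV[R]_n.
Implicit Types (h t x y : V).

Lemma compact_norm_ball (r : R) : 0 <= r -> compact [set t : V | `|t| <= r].
Proof.
move=> r0; have := @rV_compact R n (fun=> `[- r, r]%classic) (fun=> @segment_compact _ _ _).
rewrite (_ : [set v | _] = [set t : V | `|t| <= r])//.
apply/seteqP; split=> v /=.
  by move=> h; apply: norm_le_coord => // i; have := h i; rewrite /= in_itv /= ler_norml.
move=> vr i; rewrite /= in_itv /= -ler_norml; exact: le_trans (coord_le_norm _ _) vr.
Qed.

(** A vector of norm at most [m] is the sum of [m] vectors of norm at most 1. *)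
Lemma unit_steps (ct : V -> R) (D : R) : 1 <= D -> (forall h, 0 < ct h) ->
  (forall h t, `|t| <= 1 -> ct (h + t) <= D * ct h) ->
  exists (A : nat) (K : R), 0 < K /\
    forall h x, ct (h + x) <= K * expR (A%:R * `|x|) * ct h.
Proof.
move=> D1 ct0 step; have D0 : 0 < D by exact: lt_le_trans D1.
have chain m h x : `|x| <= m%:R -> ct (h + x) <= D ^+ m * ct h.
  elim: m x => [|m IH] x xm.
    have -> : x = 0 by apply/eqP; rewrite -normr_le0.
    by rewrite addr0 mul1r.
  have m1 : 0 < m.+1%:R :> R by rewrite ltr0n.
  pose y := (m.+1%:R^-1 : R) *: x.
  have y1 : `|y| <= 1.
    by rewrite normrZ ger0_norm ?invr_ge0 ?(ltW m1)// ler_pdivrMl// mulr1.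
  have xy : `|x - y| <= m%:R.
    have -> : x - y = (m%:R / m.+1%:R : R) *: x.
      rewrite /y -[X in X - _]scale1r -scalerBl; congr (_ *: _).
      rewrite -natr1 in m1 *; move: (m%:R : R) m1 => r r0.
      by field; rewrite gt_eqF.
    rewrite normrZ ger0_norm ?divr_ge0// mulrAC ler_pdivrMr//.
    by rewrite ler_wpM2l.
  rewrite -[x in ct (h + x)](subrK y) addrA exprS -mulrA.
  rewrite (le_trans (step _ _ y1))// ler_wpM2l ?(ltW D0)//.
  exact: IH.
have [A AD] : exists A : nat, D <= expR A%:R.
  exists (Num.truncn D).+1; rewrite (le_trans _ (expR_ge1Dx _))//.
  by rewrite (le_trans (ltW (truncnS_gt D)))// lerDr.
exists A, (expR A%:R); split=> [|h x]; first exact: expR_gt0.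
pose m := (Num.truncn `|x|).+1.
have xm : `|x| <= m%:R by exact/ltW/truncnS_gt.
rewrite (le_trans (chain m h x xm))// ler_wpM2r ?(ltW (ct0 h))//.
apply: (@le_trans _ _ (expR A%:R ^+ m)); first by rewrite lerXn2r ?nnegrE ?expR_ge0 ?(ltW D0).
rewrite -expRM_natl -expRD ler_expR /m -natr1 mulrDl mul1r addrC lerD2l mulrC.
by rewrite ler_wpM2l// truncn_le.
Qed.

Variables (beta : V) (c : V -> R).
Hypotheses (c_gt0 : forall h, 0 < c h)
  (c_locb : [locally [bounded c x | x in [set: V]]])
  (c_lim : forall L : set V, compact L ->
    {uniform L, (fun h t => c (t + h) / c h) @ at_infty
                --> (fun t => expR (dotv beta t))}).

Lemma outer_steps : exists (M D : R), [/\ 0 <= M, 1 <= D &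
  forall h t, M < `|h| -> `|t| <= 1 -> c (h + t) <= D * c h].
Proof.
have near1 := uniform_cvg_norm (FF := at_infty_filter) (c_lim (compact_norm_ball ler01)) ltr01.
have [M MP] := (at_infty_norm _).1 near1.
exists (Num.max 0 M), (expR (n%:R * `|beta|) + 1); split=> [||h t].
- by rewrite le_max lexx.
- by rewrite lerDr expR_ge0.
rewrite gt_max => /andP[_ /MP H] t1; rewrite -ler_pdivrMr// (addrC h).
have := H t t1; rewrite ltr_norml => /andP[_]; rewrite ltrBlDl => /ltW h1.
rewrite (le_trans h1)// lerD2r ler_expR.
have := dotv_le beta t; rewrite ler_norml => /andP[_ /le_trans]; apply.
by rewrite ler_wpM2l// ler_piMr.
Qed.

(** By compactness. The lower bound at a point close to [x] comes from the
    step from this point back to [x]. *)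
Lemma inner_bounds (M D r : R) : 1 <= D -> 0 <= r ->
  (forall h t, M < `|h| -> `|t| <= 1 -> c (h + t) <= D * c h) ->
  exists2 B : R, 1 <= B & forall h, `|h| <= r ->
    c h <= B /\ (M + 1 <= `|h| -> 1 <= B * c h).
Proof.
move=> D1 r0 step; have D0 : 0 < D by exact: lt_le_trans D1.
have /compact_near_coveringP cov := compact_norm_ball r0.
have ball1 h : \forall y \near h, `|y - h| < 1.
  by apply/nbhs_ballP; exists 1 => //= y; rewrite mx_norm_ball /= distrC.
have h0 : \forall B \near +oo, [set t : V | `|t| <= r] `<=`
    (fun y => c y <= B /\ (M + 1 <= `|y| -> 1 <= B * c y)).
  apply: (cov R +oo (fun B y => c y <= B /\ (M + 1 <= `|y| -> 1 <= B * c y))) => x _.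
  have lb : \forall B0 \near +oo, \forall y \near x, c y <= B0.
    have := c_locb (I : [set: V] x); rewrite /bounded_near; apply: filterS => B0.
    rewrite /within /=; apply: filterS => y /(_ I) /=; apply: le_trans.
    exact: ler_norm.
  have [B0 [B0x B0r]] : exists B0, (\forall y \near x, c y <= B0) /\ (B0 \is Num.real).
    by have [B0 hB0] := filter_ex lb; exists B0; split=> //; rewrite num_real.
  exists ([set y : V | c y <= B0 /\ `|y - x| < 1], [set B : R | Num.max B0 (D / c x) <= B]).
    split=> /=; first by apply: filterI => //; exact: ball1.
    exact: nbhs_pinfty_ge (num_real _).
  move=> [y B] /= [[yB0 yx]]; rewrite ge_max => /andP[B0B DB]; split; first exact: le_trans B0B.
  move=> My; have Mx : M < `|y|.
    by apply: lt_le_trans My; rewrite ltrDl.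
  have h : c x <= D * c y.
    have := step y (x - y) Mx; rewrite (addrC y) subrK; apply.
    by rewrite distrC ltW.
  have B0' : 0 < B by apply: lt_le_trans DB; rewrite divr_gt0.
  move: DB; rewrite ler_pdivrMr// => DB.
  rewrite -(ler_pM2l D0) mulr1 (le_trans DB)//.
  by rewrite mulrCA ler_pM2l.
have h1 : \forall B \near +oo, 1 <= B :> R by exact: nbhs_pinfty_ge (num_real _).
by have [B [hB B1]] := filter_ex (filterI h0 h1); exists B => // h hr; exact: hB.
Qed.

(** The hypotheses control the quotients of [c] only far from the origin;
    replacing [c] by 1 on a large ball yields a function whose quotients over
    steps of length 1 are bounded everywhere. *)
Lemma slow_majorant : exists (ct : V -> R) (A : nat) (K : R), [/\ 0 < K,
  forall h, 0 < ct h, forall h, c h <= K * ct h,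
  forall h x, ct (h + x) <= K * expR (A%:R * `|x|) * ct h &
  \forall h \near at_infty, ct h = c h].
Proof.
have [M [D [M0 D1 step]]] := outer_steps; have D0 : 0 < D by exact: lt_le_trans D1.
have r0 : 0 <= M + 2 by rewrite addr_ge0.
have [B B1 hB] := inner_bounds D1 r0 step; have B0 : 0 < B by exact: lt_le_trans B1.
pose ct h := if `|h| < M + 1 then 1 else c h.
have ct0 h : 0 < ct h by rewrite /ct; case: ifP.
have DB1 : 1 <= D * B by rewrite mulr_ege1.
have BDB : B <= D * B by rewrite ler_peMl ?(ltW B0).
have DDB : D <= D * B by rewrite ler_peMr ?(ltW D0).
have tri h t : `|t| <= 1 -> `|h + t| <= `|h| + 1.
  by move=> t1; rewrite (le_trans (ler_normD _ _))// lerD2l.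
have ct_step h t : `|t| <= 1 -> ct (h + t) <= D * B * ct h.
  move=> t1; rewrite /ct; case: ltP => ht; case: ltP => hh.
  - by rewrite mulr1.
  - have hr : `|h| <= M + 2.
      have : `|(h + t) + - t| <= `|h + t| + 1 by apply: tri; rewrite normrN.
      by rewrite addrK; lra.
    have [_ /(_ hh)] := hB h hr; move=> /le_trans; apply.
    by rewrite ler_wpM2r ?(ltW (c_gt0 h)).
  - have hr : `|h + t| <= M + 2 by have := tri h t t1; lra.
    have [+ _] := hB _ hr; move=> /le_trans; apply.
    by rewrite mulr1.
  - have Mh : M < `|h| by lra.
    rewrite (le_trans (step h t Mh t1))// ler_wpM2r ?(ltW (c_gt0 h))//.
have [A [K [K0 HK]]] := unit_steps DB1 ct0 ct_step.
exists ct, A, (Num.max K B); split=> //.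
- by rewrite lt_max K0.
- move=> h; rewrite /ct; case: ltP => hh.
    have hr : `|h| <= M + 2 by lra.
    have [+ _] := hB _ hr; move=> /le_trans; apply.
    by rewrite mulr1 le_max lexx orbT.
  by rewrite ler_peMl ?(ltW (c_gt0 h))// le_max B1 orbT.
- move=> h x; rewrite (le_trans (HK h x))// ler_wpM2r ?(ltW (ct0 h))//.
  by rewrite ler_wpM2r ?expR_ge0// le_max lexx.
apply/at_infty_norm; exists (M + 1) => h hM.
by rewrite /ct ltNge (ltW hM).
Qed.

End slow_variation.

(** * From transforms to S-asymptotics *)

Section sequences_to_infinity.
Context {R : realType} {n : nat}.
Local Notation V := 'rV[R]_n.
Implicit Types (h : nat -> V) (x : V) (u : V -> R[i]) (l : R[i]).

Lemma sequence_near h (P : V -> Prop) : h @ \oo --> at_infty ->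
  (\forall y \near at_infty, P y) -> \forall k \near \oo, P (h k).
Proof. by move=> hoo HP; exact: hoo HP. Qed.

Lemma cvg_sequence u l h : u @ at_infty --> l -> h @ \oo --> at_infty ->
  ccvg (fun k => u (h k)) l.
Proof.
move=> /cvgc_normcP ul hoo e e0; exact: (hoo _ (ul e e0)).
Qed.

Lemma sequences_cvg u l :
  (forall h, h @ \oo --> at_infty -> ccvg (fun k => u (h k)) l) -> u @ at_infty --> l.
Proof.
move=> H; apply/cvgc_normcP => e e0; apply: contrapT => no.
have far (k : nat) : exists h : V, k%:R < enorm h /\ ~ normc (u h - l) < e.
  apply: contrapT => nex; apply: no; exists k%:R => h kh.
  by apply: contrapT => hn; apply: nex; exists h.
have [h hP] := choice far.
have hoo : h @ \oo --> at_infty.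
  move=> A [M MA].
  have : \forall k \near \oo, M <= k%:R by exact: nbhs_infty_ger.
  by apply: filterS => k Mk; apply: MA; apply: le_lt_trans Mk _; have [] := hP k.
have [k] := filter_ex (H h hoo e e0).
by have [_] := hP k.
Qed.

Lemma sequence_shift h x : h @ \oo --> at_infty -> (fun k => h k + x) @ \oo --> at_infty.
Proof.
move=> hoo A /(at_infty_norm A).1 [M MA].
apply: (hoo (fun y => A (y + x))).
apply/(at_infty_norm (fun y => A (y + x))); exists (M + `|x|) => y My; apply: MA.
rewrite -(ltrD2r `|x|) (lt_le_trans My)//.
rewrite -[y in leLHS](addrK x) -(normrN x); exact: ler_normD.
Qed.

Lemma sequence_exists : (0 < n)%N -> exists h, h @ \oo --> at_infty.
Proof.
move=> n0; exists (fun k => const_mx k%:R) => A /(at_infty_norm A).1 [M MA].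
have : \forall k \near \oo, M < k%:R by exact: nbhs_infty_gtr.
apply: filterS => k Mk; apply: MA; apply: lt_le_trans Mk _.
have := coord_le_norm (const_mx k%:R : V) (Ordinal n0).
by rewrite mxE ger0_norm.
Qed.

Lemma ccvgM (v w : nat -> R[i]) l m : ccvg v l -> ccvg w m ->
  ccvg (fun k => v k * w k) (l * m).
Proof.
move=> vl wm e e0.
have m0 := normc_ge0 m; have l0 := normc_ge0 l.
pose D := 1 + normc m + normc l.
have D0 : 0 < D by rewrite /D -addrA ltr_pwDl// addr_ge0.
pose d := Num.min 1 (e / (2 * D)).
have d0 : 0 < d by rewrite lt_min ltr01 divr_gt0// mulr_gt0.
apply: filterS (filterI (vl d d0) (wm d d0)) => k [/ltW vk /ltW wk].
have -> : v k * w k - l * m = (v k - l) * (w k - m) + (v k - l) * m + l * (w k - m).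
  by ring.
have d1 : d <= 1 by rewrite ge_min lexx.
have de : d <= e / (2 * D) by rewrite ge_min lexx orbT.
apply: (@le_lt_trans _ _ (d * D)).
  rewrite (le_trans (le_normcD _ _))// (_ : d * D = d * 1 + d * normc m + normc l * d); last first.
    by rewrite /D; ring.
  rewrite lerD//; last by rewrite normcM ler_wpM2l.
  rewrite (le_trans (le_normcD _ _))// lerD//; last by rewrite normcM ler_wpM2r.
  by rewrite normcM ler_pM ?normc_ge0// (le_trans wk).
apply: (@le_lt_trans _ _ (e / (2 * D) * D)); first by rewrite ler_wpM2r// ltW.
rewrite (_ : e / (2 * D) * D = e / 2); last by field; rewrite gt_eqF.
by rewrite ltr_pdivrMr// ltr_pMr// ltr1n.
Qed.

Lemma ccvg_cst l : ccvg (fun=> l) l.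
Proof. by move=> e e0; apply: nearW => _; rewrite subrr normc0.
Qed.

End sequences_to_infinity.

Section tauberian.
Context {R : realType} {n : nat}.
Local Notation V := 'rV[R]_n.
Local Notation q := (@qweight R n).
Local Notation Q := (qmass (lebesgue_rV n) q).
Variables (f : functional R n) (ct : V -> R) (beta : V) (A : nat) (K : R) (eta : V -> R[i]).
Hypotheses (df : K1_dual f) (ct_gt0 : forall h, 0 < ct h) (K0 : 0 < K)
  (ct_shift : forall h x, ct (h + x) <= K * expR (A%:R * `|x|) * ct h)
  (ct_lim : forall (h : nat -> V) x, h @ \oo --> at_infty ->
    ccvg (fun k => (ct (h k + x) / ct (h k))%:C) (expR (dotv beta x))%:C)
  (Keta : K1 eta) (t0 : V) (eta_t0 : eta t0 != 0).
Variables (S : nat) (M : R) (J : V -> R[i]) (h0 : nat -> V).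
Hypotheses (M0 : 0 <= M)
  (growth : forall h xi, normc (translate h f (fun t => wave xi t * eta t)) <=
    M * (1 + `|xi|) ^+ S * ct h)
  (mJ : cmeas J)
  (J_lim : {ae lebesgue_rV n, forall xi, forall h : nat -> V, h @ \oo --> at_infty ->
    ccvg (fun k => translate (h k) f (fun t => wave xi t * eta t) / (ct (h k))%:C) (J xi)})
  (h0oo : h0 @ \oo --> at_infty).
Implicit Types (h x xi t : V) (a phi theta u : V -> R[i]).
Local Opaque wave ift.

Definition rescaled h u : R[i] := translate h f u / (ct h)%:C.

Let dual_t h : K1_dual (translate h f) := dual_translate h df.

Let normc_rescaled h u (X : R) : normc (translate h f u) <= X * ct h ->
  normc (rescaled h u) <= X.
Proof.
move=> H; rewrite /rescaled normcM normcV normc_real gtr0_norm//.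
by rewrite ler_pdivrMr.
Qed.

Let rescaled_shift h x u : rescaled h (fun t => u (t - x)) =
  rescaled (h + x) u * (ct (h + x) / ct h)%:C.
Proof.
rewrite /rescaled /translate.
have -> : (fun t => u (t - h - x)) = (fun t => u (t - (h + x))).
  by apply/funext => t; rewrite opprD addrA.
have : (ct (h + x))%:C != 0 :> R[i] by rewrite -normc_gt0 normc_real normr_gt0 gt_eqF.
have : (ct h)%:C != 0 :> R[i] by rewrite -normc_gt0 normc_real normr_gt0 gt_eqF.
rewrite rmorphM fmorphV /=; move: (f _) (ct h)%:C (ct (h + x))%:C => F p r p0 r0.
by field; rewrite p0.
Qed.

(** ** Products with the window *)

Let kappa_exists : exists2 kappa : R[i], kappa != 0 & forall a t, K1 a ->
  cintegral (fun xi => ift a xi * wave xi t) = kappa * a t.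
Proof. by apply: ift_inversion; exists eta; split=> //; exists t0. Qed.

(** Inversion exhibits [eta * a] as a superposition of the modulated windows
    [wave xi * eta], on which the functional is controlled by hypothesis. *)
Lemma windowed_fourier : exists2 kappa : R[i], kappa != 0 & forall h a, K1 a ->
  kappa * rescaled h (fun t => eta t * a t) =
  cintegral (fun xi => ift a xi * rescaled h (fun t => wave xi t * eta t)).
Proof.
have [kappa k0 inv] := kappa_exists; exists kappa => // h a Ka.
have s1 : `|1 : R| <= 1 by rewrite normr1.
have [tf] := functional_pettis_wave (cmeas_ift Ka) Keta s1 (ift_rapid Ka) (dual_t h).
have -> : (fun t => cintegral (fun x => ift a x * (wave (1 *: x) t * eta t))) =
    fun t => kappa * (eta t * a t).
  apply/funext => t.
  have tw : tame q (fun xi => ift a xi * wave xi t).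
    have [m [C hC]] := ift_tame Ka; split.
      by apply: cmeasM => //; under eq_fun do rewrite waveC; exact: cmeas_wave.
    by exists C => x; rewrite normcM normc_wave mulr1.
  transitivity (cintegral (fun xi => eta t * (ift a xi * wave xi t))).
    by apply: eq_cintegral => x; rewrite scale1r mulrA [LHS]mulrC.
  by rewrite cintegralZ// inv// mulrCA.
rewrite (K1_linearZ _ (dual_linear (dual_t h))); last exact: K1M.
have E x : ift a x * translate h f (fun t => wave (1 *: x) t * eta t) =
    ift a x * translate h f (fun t => wave x t * eta t) by rewrite scale1r.
move=> H; rewrite /rescaled mulrA H mulrC -cintegralZ//.
by apply: eq_cintegral => x; rewrite E [LHS]mulrC -[LHS]mulrA.
Qed.

Let growth_rescaled h xi : normc (rescaled h (fun t => wave xi t * eta t)) <=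
  M * (1 + `|xi|) ^+ S.
Proof. exact: normc_rescaled. Qed.

Let product_bound a (B : R) : K1 a -> kbound (S + 2 * n + 2 * n) a B -> forall h xi,
  normc (ift a xi * rescaled h (fun t => wave xi t * eta t)) <=
  2 ^+ (S + 2 * n) * (2 * (B * Q)) * M * q xi.
Proof.
move=> Ka aB h xi; have B0 := kbound_ge0 aB.
have X0 : 0 <= 2 ^+ (S + 2 * n) * (2 * (B * Q)).
  by rewrite mulr_ge0 ?exprn_ge0// mulr_ge0// mulr_ge0// Q_ge0.
rewrite normcM.
apply: (@le_trans _ _ (2 ^+ (S + 2 * n) * (2 * (B * Q)) / (1 + `|xi|) ^+ (S + 2 * n) *
    (M * (1 + `|xi|) ^+ S))).
  by rewrite ler_pM ?normc_ge0// ift_decay.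
have d0 := den_gt0 xi.
move: (2 ^+ (S + 2 * n) * (2 * (B * Q))) X0 => X X0; rewrite exprD.
have -> : X / ((1 + `|xi|) ^+ S * (1 + `|xi|) ^+ (2 * n)) * (M * (1 + `|xi|) ^+ S) =
    X * M / (1 + `|xi|) ^+ (2 * n).
  move: (gt_eqF (d0 S)) (gt_eqF (d0 (2 * n)%N)) => /negbT + /negbT.
  move: ((1 + `|xi|) ^+ S) ((1 + `|xi|) ^+ (2 * n)) => Y Z Y0 Z0.
  by field; rewrite ?Y0 ?Z0.
by rewrite ler_wpM2l ?qweight_ge// mulr_ge0.
Qed.

Lemma windowed_bound : exists (N : nat) (C : R), 0 <= C /\
  forall a B h, K1 a -> kbound N a B ->
    normc (rescaled h (fun t => eta t * a t)) <= C * B.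
Proof.
have [kappa k0 H] := windowed_fourier.
have nk : 0 < normc kappa by rewrite normc_gt0.
pose C := 2 * (2 ^+ (S + 2 * n) * (2 * Q) * M * Q) / normc kappa.
exists (S + 2 * n + 2 * n)%N, C; split.
  by rewrite divr_ge0 ?normc_ge0// !mulr_ge0 ?exprn_ge0 ?Q_ge0// mulr_ge0// Q_ge0.
move=> a B h Ka aB.
rewrite -(ler_pM2l nk) -normcM H//.
have m : cmeas (fun xi => ift a xi * rescaled h (fun t => wave xi t * eta t)).
  apply: cmeasM (cmeas_ift Ka) _; apply: cmeasM (cmeas_cst _).
  exact: cmeas_dual_wave (dual_t h) Keta.
rewrite (le_trans (normc_cintegral_le m (product_bound Ka aB h)))// /C.
rewrite le_eqVlt; apply/orP; left; apply/eqP.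
by move: (normc kappa) nk => y y0; field; rewrite gt_eqF.
Qed.

Lemma windowed_limit a : K1 a -> exists l : R[i], forall h : nat -> V,
  h @ \oo --> at_infty -> ccvg (fun k => rescaled (h k) (fun t => eta t * a t)) l.
Proof.
move=> Ka; have [kappa k0 H] := windowed_fourier.
exists (kappa^-1 * cintegral (fun xi => ift a xi * J xi)) => h hoo.
have [B aB] := K1_kbound (S + 2 * n + 2 * n) Ka.
have m k : cmeas (fun xi => ift a xi * rescaled (h k) (fun t => wave xi t * eta t)).
  apply: cmeasM (cmeas_ift Ka) _; apply: cmeasM (cmeas_cst _).
  exact: cmeas_dual_wave (dual_t (h k)) Keta.
have lim : ccvg (fun k => cintegral (fun xi => ift a xi *
    rescaled (h k) (fun t => wave xi t * eta t))) (cintegral (fun xi => ift a xi * J xi)).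
  apply: (cintegral_dct m (cmeasM (cmeas_ift Ka) mJ)) => [k x|].
    exact: product_bound.
  apply: filterS J_lim => xi Jxi; apply: ccvgM; last exact: Jxi.
  exact: ccvg_cst.
have := ccvgM (ccvg_cst kappa^-1) lim; set L := _ * _ => limL e e0.
apply: filterS (limL e e0) => k.
by rewrite -H// mulKf.
Qed.

(** ** Localization by translates of the window *)

Let zeta t : R[i] := eta t * (eta t)^*.

Let Kzeta : K1 zeta.
Proof. by apply: K1M => //; exact: K1_conj. Qed.

Let mass_neq0 : cintegral zeta != 0.
Proof.
apply/eqP => z0; have := normsq_null (K1_continuous Keta) (K1_tame Kzeta) z0 t0.
by apply/eqP.
Qed.

Let shifted phi x t : R[i] := phi (t - - x) * (eta t)^*.

Let Kshifted phi x : K1 phi -> K1 (shifted phi x).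
Proof. by move=> Kp; apply: K1M; [exact: K1_shift|exact: K1_conj]. Qed.

Let rescaled_localize h x phi : rescaled h (fun t => zeta (t - x) * phi t) =
  rescaled (h + x) (fun t => eta t * shifted phi x t) * (ct (h + x) / ct h)%:C.
Proof.
rewrite -(rescaled_shift h x (fun t => eta t * shifted phi x t)).
congr (rescaled h _); apply/funext => t.
by rewrite /shifted opprK subrK /zeta -mulrA (mulrC (phi t)).
Qed.

Let ratio_le h x : normc (ct (h + x) / ct h)%:C <= K * expR (A%:R * `|x|).
Proof.
rewrite normc_real gtr0_norm ?divr_gt0//.
by rewrite ler_pdivrMr// ct_shift.
Qed.

(** A localized piece [zeta (. - x) * phi] is the translate of a product
    [eta * a], so that the previous results apply to it with [h + x] in place
    of [h]. *)
Let localized_bound phi : K1 phi -> exists C : R, forall h x,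
  normc (rescaled h (fun t => zeta (t - x) * phi t)) <= C * q x.
Proof.
move=> Kp; have [N [C [C0 HC]]] := windowed_bound.
pose m := (N + (A + 2 * n))%N.
have [B pB] := K1_kbound m Kp; have B0 := kbound_ge0 pB.
have [D eD] := K1_kbound (N + m) (K1_conj Keta); have D0 := kbound_ge0 eD.
exists (C * (2 ^+ N * (B * D)) * K) => h x.
have sb := kbound_localize (- x) (K1_smooth Kp) (K1_smooth (K1_conj Keta)) pB eD (leq_addr _ _).
have hb := HC _ _ (h + x) (Kshifted x Kp) sb.
rewrite rescaled_localize normcM.
apply: le_trans (ler_pM (normc_ge0 _) (normc_ge0 _) hb (ratio_le h x)) _.
rewrite normrN.
have -> : C * (2 ^+ N * (B * expR (- (m%:R * `|x|)) * D)) * (K * expR (A%:R * `|x|)) =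
    C * (2 ^+ N * (B * D)) * K * (expR (- (m%:R * `|x|)) * expR (A%:R * `|x|)) by ring.
rewrite ler_wpM2l ?mulr_ge0 ?exprn_ge0 ?(ltW K0)//.
rewrite -expRD (le_trans _ (expRN_le_qweight x (leqnn _)))// ler_expR.
rewrite -lerBrDr -opprD lerN2 -mulrDl ler_wpM2r//.
by rewrite -natrD ler_nat addnC leq_addl.
Qed.

Lemma localized_integral h phi : K1 phi ->
  cmeas (fun x => rescaled h (fun t => zeta (t - x) * phi t)) /\
  cintegral zeta * rescaled h phi =
  cintegral (fun x => rescaled h (fun t => zeta (t - x) * phi t)).
Proof.
move=> Kp; have [tF EF] := dual_localize Kzeta Kp (dual_t h).
split; first by apply: cmeasM (cmeas_cst _); case: tF.
rewrite /rescaled mulrA EF mulrC -cintegralZ//.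
by apply: eq_cintegral => x; rewrite mulrC.
Qed.

Lemma rescaled_bound phi : K1 phi -> exists B : R, forall h, normc (rescaled h phi) <= B.
Proof.
move=> Kp; have [C HC] := localized_bound Kp.
have nz : 0 < normc (cintegral zeta) by rewrite normc_gt0.
exists (2 * (C * Q) / normc (cintegral zeta)) => h.
have [m E] := localized_integral h Kp.
by rewrite ler_pdivlMr// mulrC -normcM E normc_cintegral_le.
Qed.

(** The comparison function grows exponentially in the translation [x],
    while the pieces decay faster than every exponential: convergence is
    dominated. *)
Lemma rescaled_limit phi : K1 phi -> exists l : R[i], forall h : nat -> V,
  h @ \oo --> at_infty -> ccvg (fun k => rescaled (h k) phi) l.
Proof.
move=> Kp; have [C HC] := localized_bound Kp.
have [l lP] := choice (fun x => windowed_limit (Kshifted x Kp)).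
pose g x := l x * (expR (dotv beta x))%:C.
have lim (h : nat -> V) x : h @ \oo --> at_infty ->
    ccvg (fun k => rescaled (h k) (fun t => zeta (t - x) * phi t)) (g x).
  move=> hoo e e0.
  apply: filterS (ccvgM (lP x _ (@sequence_shift R n _ x hoo)) (ct_lim x hoo) e0) => k.
  by rewrite rescaled_localize.
have mg : cmeas g.
  apply: (@cmeas_cvg _ _ _ (fun k x => rescaled (h0 k) (fun t => zeta (t - x) * phi t))).
    by move=> k; have [] := localized_integral (h0 k) Kp.
  by move=> x; exact: lim.
exists ((cintegral zeta)^-1 * cintegral g) => h hoo e e0.
have m k := (localized_integral (h k) Kp).1.
have := cintegral_dct m mg (fun k x => HC (h k) x) (aeW _ (fun x => lim h x hoo)).
move=> /(ccvgM (ccvg_cst (cintegral zeta)^-1)) /(_ e e0); apply: filterS => k.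
by rewrite -(localized_integral (h k) Kp).2 mulKf.
Qed.

(** ** Exponentials as the only limits *)

Let Kbeta theta : K1 theta -> K1 (fun t => (expR (dotv beta t))%:C * theta t).
Proof.
move=> Kt; rewrite (_ : (fun t => _) = fun t => chr (cvec beta) t * theta t).
  exact: K1_chr_mul.
by apply/funext => t; rewrite /chr dotv_cvec cexp_real.
Qed.

Let convolution_limit theta phi l : K1 theta -> K1 phi ->
  (forall h : nat -> V, h @ \oo --> at_infty -> ccvg (fun k => rescaled (h k) phi) l) ->
  ccvg (fun k => rescaled (h0 k) (convolution theta phi))
    (l * cintegral (fun t => (expR (dotv beta t))%:C * theta t)).
Proof.
move=> Kt Kp lP; have [B HB] := rescaled_bound Kp.
have B0 : 0 <= B by exact: le_trans (normc_ge0 _) (HB 0).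
have [D tD] := K1_kbound (A + 2 * n) Kt; have D0 := kbound_ge0 tD.
pose G h x := theta x * rescaled h (fun t => phi (t - x)).
have EG h : rescaled h (convolution theta phi) = cintegral (G h) /\ cmeas (G h).
  have [tF EF] := dual_convolution Kt Kp (dual_t h); split.
    rewrite /rescaled EF mulrC -cintegralZ//.
    by apply: eq_cintegral => x; rewrite /G /rescaled mulrC -mulrA.
  rewrite (_ : G h = fun x => (theta x * translate h f (fun t => phi (t - x))) * (ct h)%:C^-1).
    by apply: cmeasM (cmeas_cst _); case: tF.
  by apply/funext => x; rewrite /G /rescaled mulrA.
have Gb k x : normc (G (h0 k) x) <= B * K * D * q x.
  rewrite /G rescaled_shift normcM normcM.
  apply: (@le_trans _ _ (D * expR (- ((A + 2 * n)%:R * `|x|)) * (B * (K * expR (A%:R * `|x|))))).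
    rewrite ler_pM ?normc_ge0 ?mulr_ge0 ?normc_ge0 ?kbound_normc//.
    by rewrite ler_pM ?normc_ge0.
  rewrite (_ : D * _ * _ = B * K * D * (expR (- ((A + 2 * n)%:R * `|x|)) * expR (A%:R * `|x|)));
    last by ring.
  rewrite ler_wpM2l ?mulr_ge0 ?(ltW K0)//.
  rewrite -expRD (le_trans _ (expRN_le_qweight x (leqnn _)))// ler_expR.
  by rewrite -lerBrDr -opprD lerN2 -mulrDl ler_wpM2r// -natrD ler_nat addnC.
have lim x : ccvg (fun k => G (h0 k) x) (l * ((expR (dotv beta x))%:C * theta x)).
  rewrite mulrA mulrC => e e0.
  apply: filterS (ccvgM (ccvg_cst (theta x))
    (ccvgM (lP _ (@sequence_shift R n _ x h0oo)) (ct_lim x h0oo)) e0) => k.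
  by rewrite /G rescaled_shift.
have := cintegral_dct (fun k => (EG (h0 k)).2)
  (cmeasZ l (K1_cmeas (Kbeta Kt))) Gb (aeW _ lim).
rewrite cintegralZ; last exact/K1_tame/Kbeta.
by move=> H e e0; apply: filterS (H e e0) => k; rewrite (EG (h0 k)).1.
Qed.

(** For the limit functional [L] and the exponential moment [E],
    convolutions satisfy [L (theta * phi) = E theta * L phi], because a
    translation of the test function is one of the functional. Convolution
    commutes, hence [E theta * L phi = E phi * L theta], and it remains to choose
    [theta] with [E theta <> 0]. *)
Lemma exponential_limit : exists C : R[i], forall phi, K1 phi ->
  forall h : nat -> V, h @ \oo --> at_infty -> ccvg (fun k => rescaled (h k) phi)
    (C * cintegral (fun t => (expR (dotv beta t))%:C * phi t)).
Proof.
(* Its exponential moment is the mass of zeta. *)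
pose theta t := chr (cvec (- beta)) t * zeta t.
have Kt : K1 theta by exact: K1_chr_mul.
have Et : cintegral (fun t => (expR (dotv beta t))%:C * theta t) = cintegral zeta.
  apply: eq_cintegral => t; rewrite /theta /chr dotv_cvec cexp_real mulrA.
  by rewrite -(rmorphM (real_complex R)) -expRD dotvNl addrN expR0 mul1r.
have [lt ltP] := rescaled_limit Kt.
exists (lt / cintegral zeta) => phi Kp h hoo.
have [l lP] := rescaled_limit Kp.
have h1 := convolution_limit Kt Kp lP.
have := convolution_limit Kp Kt ltP; rewrite (convolutionC Kp Kt) => h2.
have := ccvg_unique h1 h2; rewrite Et => El.
suff -> : lt / cintegral zeta * cintegral (fun t => (expR (dotv beta t))%:C * phi t) = l.
  exact: lP.
by rewrite mulrAC -El mulfK.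
Qed.

End tauberian.

(** * The Tauberian half *)

Section tauberian_theorem.
Context {R : realType} {n : nat}.
Local Notation V := 'rV[R]_n.
Local Notation q := (@qweight R n).
Implicit Types (u v phi psi : V -> R[i]) (h x xi t beta : V) (F : functional R n).

Lemma dual_ext F (G : functional R n) : (forall phi, K1 phi -> F phi = G phi) ->
  K1_dual G -> K1_dual F.
Proof.
move=> FG /dualP[lG [N [C [C0 bG]]]]; apply/dualP; split.
  move=> a u v Ku Kv; rewrite !FG ?lG//.
  by apply: K1D => //; exact: K1Z.
by exists N, C; split=> // u B Ku uB; rewrite FG//; exact: bG.
Qed.

Lemma dual_chr_mul a F : K1_dual F -> K1_dual (fun u => F (fun t => chr a t * u t)).
Proof.
move=> dF; have [N [C [C0 bF]]] := dual_bounded dF.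
have [m [A [A1 aA ha]]] := rate_exists a; have A0 : 0 <= A by exact: le_trans A1.
apply/dualP; split.
  move=> b u v Ku Kv; rewrite -(dual_linear dF); try exact: K1_chr_mul.
  by congr F; apply/funext => t; rewrite mulrDr mulrCA.
exists (N + m)%N, (C * (2 ^+ N * A ^+ N)); split; first by rewrite !mulr_ge0 ?exprn_ge0.
move=> u B Ku uB.
have := bF _ _ (K1_chr_mul a Ku) (kbound_chr_mul A1 aA ha (K1_smooth Ku) uB).
by move=> /le_trans; apply; rewrite !mulrA.
Qed.

Lemma K1_exp_mul beta u : K1 u -> K1 (fun t => (expR (dotv beta t))%:C * u t).
Proof.
move=> Ku; rewrite (_ : (fun t => _) = fun t => chr (cvec beta) t * u t).
  exact: K1_chr_mul.
by apply/funext => t; rewrite /chr dotv_cvec cexp_real.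
Qed.

Lemma regular_exp (C : R[i]) beta phi : K1 phi ->
  regular (fun t => C * (expR (dotv beta t))%:C) phi =
  C * cintegral (fun t => (expR (dotv beta t))%:C * phi t).
Proof.
move=> Kp; rewrite -cintegralZ; last exact/K1_tame/K1_exp_mul.
by apply: eq_cintegral => t; rewrite mulrA.
Qed.

Lemma dual_exp (C : R[i]) beta : K1_dual (regular (fun t => C * (expR (dotv beta t))%:C)).
Proof.
apply: (@dual_ext _ (fun u => C * cintegral (fun t => chr (cvec beta) t * u t))).
  move=> phi Kp; rewrite regular_exp//; congr (C * _).
  by apply: eq_cintegral => t; rewrite /chr dotv_cvec cexp_real.
exact: dual_scale (dual_chr_mul _ (@dual_integral R n)).
Qed.

Lemma STFT_wave F psi x xi : K1_dual F -> K1 psi ->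
  cexp (two_pi_i * (dotv xi x)%:C) * STFT psi F x (cvec xi) =
  translate x F (fun t => wave xi t * (psi t)^*).
Proof.
move=> dF Kp; have := @STFT_translate R n psi F 0 x (cvec xi) dF Kp.
rewrite add0r -cexp_freq dotv_cvec => ->; congr (translate x F _).
by apply/funext => t; rewrite subr0.
Qed.

Lemma normc_STFT F psi x xi : K1_dual F -> K1 psi ->
  normc (translate x F (fun t => wave xi t * (psi t)^*)) = normc (STFT psi F x (cvec xi)).
Proof.
move=> dF Kp; rewrite -STFT_wave// normcM.
have -> : cexp (two_pi_i * (dotv xi x)%:C) = wave xi (- x).
  by rewrite waveE dotvNr (rmorphN (real_complex R)) mulrN opprK.
by rewrite normc_wave mul1r.
Qed.

(** The conjugate transform of [psi] at the complex frequency is the limit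
    functional on the modulated window. *)
Lemma fourier_conj psi beta xi : K1 psi ->
  (fourier psi (- cvec xi + ('i%C / (2 * pi)%:C) *: cvec beta))^* =
  cintegral (fun t => (expR (dotv beta t))%:C * (wave xi t * (psi t)^*)).
Proof.
move=> Kp; rewrite /fourier.
set z := _ + _.
have tu : tame q (fun t => chr (freq z) t * psi t) by exact/K1_tame/K1_chr_mul.
have -> : cintegral (fun t => cexp (- (two_pi_i * dotv z (cvec t))) * psi t) =
    cintegral (fun t => chr (freq z) t * psi t).
  by apply: eq_cintegral => t; rewrite chr_freq.
rewrite -cintegral_conj//; apply: eq_cintegral => t.
have cM (a b : R[i]) : conjc (a * b) = conjc a * conjc b by exact: rmorphM.
rewrite cM mulrA; congr (_ * _).
rewrite chr_freq cexp_conj waveE -cexp_real -cexpD; congr cexp.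
rewrite /z dotvDl dotvNl dotvZl !dotv_cvec.
have p0 : 2 * pi != 0 :> R by rewrite gt_eqF// mulr_gt0// pi_gt0.
have -> : - (two_pi_i * (- (dotv xi t)%:C + 'i / (2 * pi)%:C * (dotv beta t)%:C)) =
    two_pi_i * (dotv xi t)%:C + (dotv beta t)%:C.
  rewrite mulrDr opprD mulrN opprK; congr (_ + _).
  have c0 : (2 * pi)%:C != 0 :> R[i] by rewrite -normc_gt0 normc_real normr_gt0.
  rewrite /two_pi_i.
  have i2 : 'i * 'i = -1 :> R[i] by rewrite -expr2 sqr_i.
  move: ((2 * pi)%:C : R[i]) c0 => p c0.
  rewrite (_ : p * 'i * ('i / p * (dotv beta t)%:C) = 'i * 'i * (p / p) * (dotv beta t)%:C).
    by rewrite i2 divff// mulr1 mulN1r opprK.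
  by move: p^-1 => r; ring.
by rewrite addrC; apply: complexP; rewrite /two_pi_i /=; ring.
Qed.

Lemma growth_power (s : R) : exists (S : nat) (D : R), 0 <= D /\ forall xi,
  (1 + enorm xi) `^ s <= D * (1 + `|xi|) ^+ S.
Proof.
pose S := (Num.truncn `|s|).+1; exists S, (n.+1%:R ^+ S); split=> [|xi].
  by rewrite exprn_ge0.
have e0 : 0 <= enorm xi by exact: sqrtr_ge0.
have e1 : 1 <= 1 + enorm xi by rewrite lerDl.
apply: (@le_trans _ _ ((1 + enorm xi) `^ S%:R)).
  apply: ler_powR => //; apply: le_trans (ler_norm s) _.
  exact/ltW/truncnS_gt.
rewrite powR_mulrn ?addr_ge0// -exprMn lerXn2r ?nnegrE ?mulr_ge0 ?addr_ge0//.
rewrite mulrDr mulr1 lerD ?ler1n// (le_trans (enorm_le_norm xi))//.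
by rewrite ler_wpM2r// ler_nat.
Qed.

End tauberian_theorem.

Section converse.
Context {R : realType} {n : nat}.
Local Notation V := 'rV[R]_n.
Variables (hn : (0 < n)%N) (beta : V) (c : V -> R).
Hypotheses (c_gt0 : forall h, 0 < c h)
  (c_locb : [locally [bounded c x | x in [set: V]]])
  (c_lim : forall L : set V, compact L ->
    {uniform L, (fun h t => c (t + h) / c h) @ at_infty
                --> (fun t => expR (dotv beta t))}).
Variables (f : functional R n) (psi : V -> R[i]).
Hypotheses (hf : K1_dual f) (hpsi : K1 psi) (psi0 : psi <> (fun=> 0)).
Variable J : V -> R[i].
Hypothesis J_lim : {ae lebesgue_rV n, forall xi : V,
  (fun x : V => cexp (two_pi_i * (dotv xi x)%:C) *
     (STFT psi f x (cvec xi) / (c x)%:C)) @ at_infty --> J xi}.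
Hypothesis J_growth : exists s M : R, forall x xi : V,
  (1 + enorm xi) `^ (- s) * (normc (STFT psi f x (cvec xi)) / c x) <= M.

Let eta t : R[i] := (psi t)^*.
Let Keta : K1 eta. Proof. exact: K1_conj. Qed.

Let eta_neq0 : exists t, eta t != 0.
Proof.
apply: contrapT => no; apply: psi0; apply/funext => t.
apply: contrapT => pt; apply: no; exists t.
by rewrite /eta -normc_gt0 normc_conj normc_gt0; apply/eqP.
Qed.

Let c_ratio (h : nat -> V) x : h @ \oo --> at_infty ->
  ccvg (fun k => (c (h k + x) / c (h k))%:C) (expR (dotv beta x))%:C.
Proof.
move=> hoo e e0.
have H := uniform_cvg_norm (FF := at_infty_filter) (c_lim (@compact_set1 V x)) e0.
apply: filterS (sequence_near hoo H) => k /(_ x erefl).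
by rewrite -(rmorphB (real_complex R)) normc_real (addrC x).
Qed.

(** The function [J] is given almost everywhere only; it agrees almost
    everywhere with a measurable function, as the limit of the transforms along
    a sequence. *)
Lemma exponential_asymptotics : exists C : R[i],
  S_asymptotic f c (regular (fun t => C * (expR (dotv beta t))%:C)) /\
  {ae lebesgue_rV n, forall xi : V, J xi =
    C * cintegral (fun t => (expR (dotv beta t))%:C * (wave xi t * eta t))}.
Proof.
have [ct [A [K [K0 ct0 c_ct ct_shift ct_c]]]] := slow_majorant c_gt0 c_locb c_lim.
have [h0 h0oo] := @sequence_exists R n hn.
have [t1 et1] := eta_neq0.
have ct_lim (h : nat -> V) x : h @ \oo --> at_infty ->
    ccvg (fun k => (ct (h k + x) / ct (h k))%:C) (expR (dotv beta x))%:C.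
  move=> hoo e e0.
  have n1 : \forall k \near \oo, ct (h k) = c (h k) by exact: sequence_near hoo ct_c.
  have n2 : \forall k \near \oo, ct (h k + x) = c (h k + x).
    exact: sequence_near (@sequence_shift R n _ x hoo) ct_c.
  have n3 := c_ratio x hoo e0.
  apply: filterS3 n1 n2 n3 => k e1 e2.
  by rewrite e1 e2.
have [s [M HM]] := J_growth.
have [S [D [D0 HD]]] := @growth_power R n s.
have growth h xi : normc (translate h f (fun t => wave xi t * eta t)) <=
    `|M| * D * K * (1 + `|xi|) ^+ S * ct h.
  rewrite normc_STFT//.
  have e0 : 0 < 1 + enorm xi by rewrite ltr_pwDl// sqrtr_ge0.
  have p0 : 0 < (1 + enorm xi) `^ s by exact: powR_gt0.
  have := HM h xi; rewrite powRN ler_pdivrMl// ler_pdivrMr// => /le_trans; apply.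
  apply: (@le_trans _ _ (D * (1 + `|xi|) ^+ S * `|M| * (K * ct h))).
    apply: (@le_trans _ _ (D * (1 + `|xi|) ^+ S * `|M| * c h)).
      rewrite ler_wpM2r ?(ltW (c_gt0 h))// (le_trans (ler_wpM2l (ltW p0) (ler_norm M)))//.
      by rewrite ler_wpM2r.
    by rewrite ler_wpM2l// mulr_ge0// mulr_ge0// exprn_ge0// addr_ge0.
  by rewrite le_eqVlt; apply/orP; left; apply/eqP; ring.
have M0 : 0 <= `|M| * D * K by rewrite !mulr_ge0 ?(ltW K0).
have lim : {ae lebesgue_rV n, forall xi, forall h : nat -> V, h @ \oo --> at_infty ->
    ccvg (fun k => translate (h k) f (fun t => wave xi t * eta t) / (ct (h k))%:C) (J xi)}.
  apply: filterS J_lim => xi Jxi h hoo e e0.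
  have n1 : \forall k \near \oo, ct (h k) = c (h k) by exact: sequence_near hoo ct_c.
  have n2 := cvg_sequence Jxi hoo e0.
  apply: filterS2 n1 n2 => k ->.
  by rewrite mulrA STFT_wave.
have [J' [mJ' JJ']] : exists J', cmeas J' /\ {ae lebesgue_rV n, forall xi, J xi = J' xi}.
  apply: (@cmeas_ae_cvg _ _ _ _
    (fun k xi => translate (h0 k) f (fun t => wave xi t * eta t) / (ct (h0 k))%:C)).
    move=> k; apply: cmeasM (cmeas_cst _).
    exact: cmeas_dual_wave (dual_translate (h0 k) hf) Keta.
  by apply: filterS lim => xi; exact.
have lim' : {ae lebesgue_rV n, forall xi, forall h : nat -> V, h @ \oo --> at_infty ->
    ccvg (fun k => translate (h k) f (fun t => wave xi t * eta t) / (ct (h k))%:C) (J' xi)}.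
  by apply: filterS2 lim JJ' => xi + <-.
have [C HC] := exponential_limit hf ct0 K0 ct_shift ct_lim Keta et1 M0 growth mJ' lim' h0oo.
exists C; split.
  move=> phi Kp; rewrite regular_exp//; apply: sequences_cvg => h hoo e e0.
  have n1 : \forall k \near \oo, ct (h k) = c (h k) by exact: sequence_near hoo ct_c.
  have n2 := HC phi Kp h hoo e e0.
  by apply: filterS2 n1 n2 => k <-.
apply: filterS lim => xi lxi.
exact: ccvg_unique (lxi _ h0oo) (HC _ (K1_wave xi Keta) _ h0oo).
Qed.

(** Otherwise the transform of [expR (dotv beta t) * eta] vanishes almost
    everywhere, hence everywhere by continuity, and so does the window by
    inversion. *)
Lemma exponential_constant_unique (C C' : R[i]) :
  {ae lebesgue_rV n, forall xi : V,
    C * cintegral (fun t => (expR (dotv beta t))%:C * (wave xi t * eta t)) =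
    C' * cintegral (fun t => (expR (dotv beta t))%:C * (wave xi t * eta t))} -> C = C'.
Proof.
move=> CC'; apply: contrapT => neq; have [t1 et1] := eta_neq0.
pose u t := (expR (dotv beta t))%:C * eta t; have Ku : K1 u by exact: K1_exp_mul.
pose D xi := cintegral (fun t => wave xi t * u t).
have ED xi : cintegral (fun t => (expR (dotv beta t))%:C * (wave xi t * eta t)) = D xi.
  by apply: eq_cintegral => t; rewrite mulrCA.
have D0 : forall xi, D xi = 0.
  apply: ae_zero_continuous; first exact: dual_wave_continuous (@dual_integral R n) Ku.
  apply: filterS CC' => xi; rewrite ED => /eqP; rewrite -subr_eq0 -mulrBl mulf_eq0.
  by rewrite subr_eq0 => /orP[/eqP/neq//|/eqP].
have [kappa k0 inv] := @ift_inversion R n (ex_intro _ eta (conj Keta eta_neq0)).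
have := inv u t1 Ku.
have -> : cintegral (fun xi => ift u xi * wave xi t1) = 0.
  transitivity (cintegral (fun _ : V => 0 : R[i])); last exact: (cint0 (lebesgue_rV n)).
  by apply: eq_cintegral => xi; rewrite (D0 (- xi) : ift u xi = 0) mul0r.
move=> /esym/eqP; rewrite !mulf_eq0 (negbTE k0) (negbTE et1) orbF /=.
by apply/negP; rewrite -normc_gt0 normc_real normr_gt0 gt_eqF ?expR_gt0.
Qed.

End converse.

(* In the first part, uniformity is over the points z of the tube that lie in
   an arbitrary compact subset K of C^n. It fails over the whole tube: for
   n = 1, f = delta', c = 1, g = 0 and psi a Gaussian,
   STFT psi f (x + h) z is unbounded in Re z for every fixed x and h. *)
Theorem theorem6p2 (R : realType) (n : nat) (hn : (0 < n)%N)
    (beta : 'rV[R]_n) (c : 'rV[R]_n -> R)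
    (c_gt0 : forall h, 0 < c h)
    (c_locb : [locally [bounded c x | x in [set: 'rV[R]_n]]])
    (c_meas : lebesgue_measurable_fun c)
    (c_lim : forall L : set 'rV[R]_n, compact L ->
       {uniform L, (fun h t => c (t + h) / c h) @ at_infty
                   --> (fun t => expR (dotv beta t))})
    (f : functional R n) (hf : K1_dual f)
    (psi : 'rV[R]_n -> R[i]) (hpsi : K1 psi) (psi0 : psi <> (fun=> 0)) :
  (forall g : functional R n, K1_dual g -> S_asymptotic f c g ->
     forall lambda : R, 0 <= lambda ->
     forall (K : set 'rV[R[i]]_n) (L : set 'rV[R]_n), compact K -> compact L ->
       {uniform (tube lambda `&` K) `*` L,
         (fun (h : 'rV[R]_n) (p : 'rV[R[i]]_n * 'rV[R]_n) =>
            cexp (two_pi_i * dotv p.1 (cvec h)) *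
            (STFT psi f (p.2 + h) p.1 / (c h)%:C)) @ at_infty
         --> (fun p : 'rV[R[i]]_n * 'rV[R]_n => STFT psi g p.2 p.1)})
  /\
  (forall J : 'rV[R]_n -> R[i],
     {ae lebesgue_rV n, forall xi : 'rV[R]_n,
       (fun x : 'rV[R]_n => cexp (two_pi_i * (dotv xi x)%:C) *
          (STFT psi f x (cvec xi) / (c x)%:C)) @ at_infty --> J xi} ->
     (exists s M : R, forall x xi : 'rV[R]_n,
        (1 + enorm xi) `^ (- s) * (normc (STFT psi f x (cvec xi)) / c x) <= M) ->
     exists C : R[i],
       let g := regular (fun t => C * (expR (dotv beta t))%:C) in
       let C_eq (C' : R[i]) := {ae lebesgue_rV n, forall xi : 'rV[R]_n,
         J xi = C' *
           ((fourier psi (- cvec xi + ('i%C / (2 * pi)%:C) *: cvec beta))^*)%C} in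
       [/\ K1_dual g, S_asymptotic f c g, C_eq C &
           forall C' : R[i], C_eq C' -> C' = C]).
Proof.
split.
  move=> g dg fg lam _ K L cK cL.
  apply: uniform_cvg_normc => e e0.
  apply: filterS (STFT_uniform_limit c_gt0 hf dg fg hpsi cK cL e0) => h H p [[_ Kp] Lp].
  exact: H.
move=> J J_lim J_growth.
have [C [fC JC]] :=
  exponential_asymptotics hn c_gt0 c_locb c_lim hf hpsi psi0 J_lim J_growth.
exists C; split=> //.
- exact: dual_exp.
- by apply: filterS JC => xi ->; rewrite fourier_conj.
- move=> C' JC'; apply: (exponential_constant_unique (beta := beta) hpsi psi0).
  by apply: filterS2 JC' JC => xi + <-; rewrite fourier_conj.
Qed.
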